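(* Let $\alpha\in\mathbb{N}_0$, $M\ge0$, $N>0$. (i) The operator $\mathcal{L}_x^{\alpha,M,N}$ is symmetric with respect to the inner product $(\cdot,\cdot)_{w(\alpha,M,N)}$, i.e. $$\big(\mathcal{L}_x^{\alpha,M,N}f,g\big)_{w(\alpha,M,N)}=\big(f,\mathcal{L}_x^{\alpha,M,N}g\big)_{w(\alpha,M,N)},\qquad f,g\in C^{(4\alpha+10)}[0,\infty).$$ (ii) The polynomial eigenfunctions $y_n(x)=L_n^{\alpha,M,N}(x)$, $n\in\mathbb{N}_0$, of the Sobolev-Laguerre equation $\mathcal{L}_x^{\alpha,M,N}y_n(x)=-\lambda_n^{\alpha,M,N}y_n(x)$ satisfy the orthogonality relation $$\big(y_n,y_m\big)_{w(\alpha,M,N)}=0,\qquad n\ne m,\ n,m\in\mathbb{N}_0.$$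
   Context: Notation: $\mathbb{N}_0=\{0,1,2,\dots\}$; $D_x^i$ is $i$-fold differentiation with respect to $x$; $(a)_0=1$ and $(a)_n=a(a+1)\cdots(a+n-1)$ is the shifted factorial. The classical Laguerre polynomials are $L_n^{\alpha}(x)=\frac{(\alpha+1)_n}{n!}\,{}_1F_1(-n;\alpha+1;x)$. Inner product of Sobolev type: $$(f,g)_{w(\alpha,M,N)}=\frac{1}{\Gamma(\alpha+1)}\int_0^{\infty}f(x)g(x)e^{-x}x^{\alpha}\,dx+M\,f(0)g(0)+N\,f'(0)g'(0).$$ The Sobolev-Laguerre differential operator is $$\mathcal{L}_x^{\alpha,M,N}=\mathcal{L}_x^{\alpha}+M\,\breve{\mathcal{L}}_{2\alpha+4,x}^{\alpha}+N\,\widetilde{\mathcal{L}}_{2\alpha+8,x}^{\alpha}+MN\,\widehat{\mathcal{L}}_{4\alpha+10,x}^{\alpha},$$ where $$\mathcal{L}_x^{\alpha}y(x)=xy''(x)+(\alpha+1-x)y'(x),$$ $$\breve{\mathcal{L}}_{2\alpha+4,x}^{\alpha}y(x)=\frac{(-1)^{\alpha+1}}{(\alpha+2)!}e^xx\,D_x^{\alpha+2}\big\{e^{-x}D_x^{\alpha+2}[x^{\alpha+1}y(x)]\big\},$$ $$\widetilde{\mathcal{L}}_{2\alpha+8,x}^{\alpha}y(x)=\frac{(-1)^{\alpha}}{(\alpha+1)(\alpha+4)!}\big[\mathcal{E}_x^{\alpha}+\mathcal{F}_x^{\alpha}+\mathcal{G}_x^{\alpha}\big]y(x),$$ $$\mathcal{E}_x^{\alpha}y(x)=-(\alpha+2)\,e^xx\,D_x^{\alpha+4}\big\{e^{-x}x^2D_x^{\alpha+4}[x^{\alpha+1}y(x)]\big\},$$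 $$\mathcal{F}_x^{\alpha}y(x)=(\alpha+4)\,e^xx\,D_x^{\alpha+3}\big\{e^{-x}(x+2\alpha+4)D_x^{\alpha+3}[x^{\alpha+1}y(x)]\big\},$$ $$\mathcal{G}_x^{\alpha}y(x)=(\alpha+1)(\alpha+3)(\alpha+4)\,e^xD_x^{\alpha+2}\big\{e^{-x}(x+2\alpha+4)D_x^{\alpha+2}[x^{\alpha}y(x)]\big\},$$ $$\widehat{\mathcal{L}}_{4\alpha+10,x}^{\alpha}y(x)=\sum_{j=0}^{\alpha+2}\frac{(\alpha+3-j)_{2j}}{j!(j+1)!}\mathcal{H}_x^{\alpha,j}y(x),$$ $$\mathcal{H}_x^{\alpha,j}y(x)=\frac{(-1)^{\alpha+j}}{(\alpha+1)(\alpha+3+j)!}e^xx\,D_x^{\alpha+3+j}\big\{e^{-x}x^j(x+q_j^{\alpha})D_x^{\alpha+3+j}[x^{\alpha+1}y(x)]\big\},\quad q_j^{\alpha}=\frac{(\alpha+2-j)(\alpha+3+j)}{\alpha+2}.$$ The Sobolev-Laguerre polynomials are, for $n\in\mathbb{N}_0$, $$L_n^{\alpha,M,N}(x)=L_n^{\alpha}(x)+M\,T_n^{\alpha}(x)+N\,U_n^{\alpha}(x)+MN\,V_n^{\alpha}(x),\quad 0\le x<\infty,$$ where $T_0^{\alpha}=U_0^{\alpha}=U_1^{\alpha}=V_0^{\alpha}=V_1^{\alpha}=0$ and, for the other values of $n$, $$T_n^{\alpha}(x)=-\frac{(\alpha+2)_{n-1}}{n!}xL_{n-1}^{\alpha+2}(x)\quad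 (n\ge1),$$ $$U_n^{\alpha}(x)=\frac{(\alpha+3)_{n-2}}{(\alpha+1)(\alpha+3)(n-2)!}\Big[\frac{x^2}{n-1}L_{n-2}^{\alpha+4}(x)-(\alpha+2)xL_{n-1}^{\alpha+2}(x)-(n+\alpha+1)L_n^{\alpha}(x)\Big]\quad (n\ge2),$$ $$V_n^{\alpha}(x)=\frac{1}{\alpha+1}\frac{(\alpha+3)_{n-2}}{(n-1)!}\frac{(\alpha+4)_{n-2}}{n!}x^2L_{n-2}^{\alpha+4}(x)\quad (n\ge2).$$ The eigenvalues are $\lambda_n^{\alpha,M,N}=\lambda_n^{\alpha}+M\lambda_n^{\alpha,A}+N\lambda_n^{\alpha,B}+MN\lambda_n^{\alpha,C}$ with $$\lambda_n^{\alpha}=n,\quad \lambda_n^{\alpha,A}=\frac{(n)_{\alpha+2}}{(\alpha+2)!},\quad \lambda_n^{\alpha,B}=\frac{\alpha+2}{\alpha+1}\frac{(n-2)_{\alpha+4}}{(\alpha+4)!}+\frac{1}{\alpha+1}\frac{(n-1)_{\alpha+3}}{(\alpha+3)!},$$ $$\lambda_n^{\alpha,C}=\frac{1}{\alpha+1}\sum_{j=0}^{\min(n-2,\alpha+2)}\frac{(\alpha+3-j)_{2j}}{j!(j+1)!}\frac{(n-1-j)_{j+\alpha+3}}{(j+\alpha+3)!},$$ where an empty sum is $0$.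
   Formalization: In (i) the formal statement also assumes that for all i, j ≤ 4α+10 and all p the improper integral of x^p f^(i) g^(j) e^{-x} over (0,∞) converges; without a condition at infinity the integrals may diverge (f = g = e^x) or symmetry may fail. *)

(* Defs.v *)
From Stdlib Require Import Reals Factorial.
From Coquelicot Require Import Coquelicot.

Open Scope R_scope.

(** Functions on [0, oo) are represented by functions [R -> R]; everything below
    only depends on their values on [0, oo). In particular the derivative is
    taken within [0, oo), so it is one-sided at 0. *)

Definition half_line (x : R) : Prop := 0 <= x.

Definition is_D (f : R -> R) (x l : R) : Prop :=
  filterlim (fun y => (f y - f x) / (y - x))
    (within half_line (locally' x)) (locally l).

Definition D (f : R -> R) (x : R) : R := iota (is_D f x).

Fixpoint Dn (n : nat) (f : R -> R) : R -> R :=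
  match n with
  | O => f
  | S m => D (Dn m f)
  end.

Definition Ck (k : nat) (f : R -> R) : Prop :=
  (forall (i : nat) (x : R), (i < k)%nat -> half_line x ->
     exists l : R, is_D (Dn i f) x l)
  /\ continuous_on half_line (Dn k f).

Fixpoint poch (a : R) (n : nat) : R :=
  match n with
  | O => 1
  | S m => poch a m * (a + INR m)
  end.

Definition hyp1F1 (a b x : R) : R :=
  PSeries (fun k => poch a k / (poch b k * INR (fact k))) x.

Definition Laguerre (n : nat) (a x : R) : R :=
  poch (a + 1) n / INR (fact n) * hyp1F1 (- INR n) (a + 1) x.

Definition Gamma (z : R) : R :=
  RInt_gen (fun t => Rpower t (z - 1) * exp (- t))
    (at_right 0) (Rbar_locally p_infty).

Definition sobolev_ip (alpha : nat) (M N : R) (f g : R -> R) : R :=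
  / Gamma (INR alpha + 1)
    * RInt_gen (fun x => f x * g x * exp (- x) * x ^ alpha)
        (at_point 0) (Rbar_locally p_infty)
  + M * f 0 * g 0 + N * D f 0 * D g 0.

(** Smoothness on [0, oo) says nothing about growth at infinity: without a
    condition there, the integrals may diverge (f = g = exp), and even if they
    converge the integrated terms at infinity need not vanish. The condition
    below says that the products occurring under the integral sign when the
    inner product is integrated by parts have convergent improper integrals. It
    holds for instance when f, g and their derivatives of order at most [k] are
    O(exp (c * x)) for some c < 1/2, hence for all polynomials. *)
Definition products_integrable (k : nat) (f g : R -> R) : Prop :=
  forall i j p : nat, (i <= k)%nat -> (j <= k)%nat ->
    ex_RInt_gen (fun x => x ^ p * Dn i f x * Dn j g x * exp (- x))
      (at_point 0) (Rbar_locally p_infty).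

Definition L_classical (alpha : nat) (y : R -> R) (x : R) : R :=
  x * Dn 2 y x + (INR alpha + 1 - x) * Dn 1 y x.

Definition L_breve (alpha : nat) (y : R -> R) (x : R) : R :=
  (-1) ^ (alpha + 1) / INR (fact (alpha + 2)) * exp x * x *
  Dn (alpha + 2)
    (fun t => exp (- t) * Dn (alpha + 2) (fun s => s ^ (alpha + 1) * y s) t) x.

Definition E_op (alpha : nat) (y : R -> R) (x : R) : R :=
  - (INR alpha + 2) * exp x * x *
  Dn (alpha + 4)
    (fun t => exp (- t) * t ^ 2
              * Dn (alpha + 4) (fun s => s ^ (alpha + 1) * y s) t) x.

Definition F_op (alpha : nat) (y : R -> R) (x : R) : R :=
  (INR alpha + 4) * exp x * x *
  Dn (alpha + 3)
    (fun t => exp (- t) * (t + 2 * INR alpha + 4)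
              * Dn (alpha + 3) (fun s => s ^ (alpha + 1) * y s) t) x.

Definition G_op (alpha : nat) (y : R -> R) (x : R) : R :=
  (INR alpha + 1) * (INR alpha + 3) * (INR alpha + 4) * exp x *
  Dn (alpha + 2)
    (fun t => exp (- t) * (t + 2 * INR alpha + 4)
              * Dn (alpha + 2) (fun s => s ^ alpha * y s) t) x.

Definition L_tilde (alpha : nat) (y : R -> R) (x : R) : R :=
  (-1) ^ alpha / ((INR alpha + 1) * INR (fact (alpha + 4)))
  * (E_op alpha y x + F_op alpha y x + G_op alpha y x).

Definition q_coef (alpha j : nat) : R :=
  (INR alpha + 2 - INR j) * (INR alpha + 3 + INR j) / (INR alpha + 2).

Definition H_op (alpha j : nat) (y : R -> R) (x : R) : R :=
  (-1) ^ (alpha + j) / ((INR alpha + 1) * INR (fact (alpha + 3 + j)))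
  * exp x * x *
  Dn (alpha + 3 + j)
    (fun t => exp (- t) * t ^ j * (t + q_coef alpha j)
              * Dn (alpha + 3 + j) (fun s => s ^ (alpha + 1) * y s) t) x.

Definition L_hat (alpha : nat) (y : R -> R) (x : R) : R :=
  sum_f_R0
    (fun j => poch (INR alpha + 3 - INR j) (2 * j)
              / (INR (fact j) * INR (fact (j + 1))) * H_op alpha j y x)
    (alpha + 2).

Definition L_sobolev (alpha : nat) (M N : R) (y : R -> R) (x : R) : R :=
  L_classical alpha y x + M * L_breve alpha y x + N * L_tilde alpha y x
  + M * N * L_hat alpha y x.

Definition T_poly (n alpha : nat) (x : R) : R :=
  match n with
  | O => 0
  | S _ =>
      - (poch (INR alpha + 2) (n - 1) / INR (fact n))
      * x * Laguerre (n - 1) (INR alpha + 2) x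
  end.

Definition U_poly (n alpha : nat) (x : R) : R :=
  match n with
  | O | S O => 0
  | S (S _) =>
      poch (INR alpha + 3) (n - 2)
      / ((INR alpha + 1) * (INR alpha + 3) * INR (fact (n - 2)))
      * (x ^ 2 / (INR n - 1) * Laguerre (n - 2) (INR alpha + 4) x
         - (INR alpha + 2) * x * Laguerre (n - 1) (INR alpha + 2) x
         - (INR n + INR alpha + 1) * Laguerre n (INR alpha) x)
  end.

Definition V_poly (n alpha : nat) (x : R) : R :=
  match n with
  | O | S O => 0
  | S (S _) =>
      / (INR alpha + 1)
      * (poch (INR alpha + 3) (n - 2) / INR (fact (n - 1)))
      * (poch (INR alpha + 4) (n - 2) / INR (fact n))
      * x ^ 2 * Laguerre (n - 2) (INR alpha + 4) x
  end.

Definition SobolevLaguerre (n alpha : nat) (M N : R) (x : R) : R :=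
  Laguerre n (INR alpha) x + M * T_poly n alpha x + N * U_poly n alpha x
  + M * N * V_poly n alpha x.

Definition lambda_A (n alpha : nat) : R :=
  poch (INR n) (alpha + 2) / INR (fact (alpha + 2)).

Definition lambda_B (n alpha : nat) : R :=
  (INR alpha + 2) / (INR alpha + 1)
    * (poch (INR n - 2) (alpha + 4) / INR (fact (alpha + 4)))
  + / (INR alpha + 1)
    * (poch (INR n - 1) (alpha + 3) / INR (fact (alpha + 3))).

Definition lambda_C (n alpha : nat) : R :=
  match n with
  | O | S O => 0
  | S (S _) =>
      / (INR alpha + 1) *
      sum_f_R0
        (fun j => poch (INR alpha + 3 - INR j) (2 * j)
                  / (INR (fact j) * INR (fact (j + 1)))
                  * (poch (INR n - 1 - INR j) (j + alpha + 3)
                     / INR (fact (j + alpha + 3))))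
        (Nat.min (n - 2) (alpha + 2))
  end.

Definition lambda (n alpha : nat) (M N : R) : R :=
  INR n + M * lambda_A n alpha + N * lambda_B n alpha
  + M * N * lambda_C n alpha.

(* Main.v *)
From Stdlib Require Import Reals Factorial ZArith Lra Lia FunctionalExtensionality.
From Coquelicot Require Import Coquelicot.
Require Import Defs.
Open Scope R_scope.

(** Symmetry is proved by a boundary computation and orthogonality by moments,
    independently of each other; together they give the eigenvalue equation.

    Symmetry.  Up to the classical part, the operator is a sum of pieces
    [e^x x D^m (e^-x w D^m (x^(alpha+1) y))] (for one piece, without the factor
    [x] and with [x^alpha]), where [w] is a polynomial.  Against
    [g x^alpha e^-x], integrating by parts [m] times leaves an energy, symmetric
    in the two functions, and boundary terms.  At infinity these vanish because
    the integrals of the products and of their derivatives converge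
    ([is_int_D]).  At 0 nearly all of them vanish as well: [w] vanishes to order
    [p], the power [x^a] to order [a], and [m = a + p + 2] leaves two terms
    ([green_two_terms]); for [w = 1] a single term is left.  Hence [(L f, g)]
    is a symmetric expression plus [b0 f * g 0 + b1 f * g' 0], where [b0] and
    [b1] are linear in the Taylor coefficients of [f] at 0 and include the point
    evaluations of [L f].
    Symmetry follows from [b0 f = 0] ([value_terms_cancel]) and
    [b1 f = c * f' 0] ([slope_terms_sum]).  Sorted by powers of [M] and [N],
    these identities hold coefficient by coefficient once the derivatives at 0
    are expanded ([Dn_damp_expansion]); only two need a summation over the
    terms of the order [4 alpha + 10] part, and both sums telescope
    ([hat_value_coef_eq], [hat_term_sum]).

    Orthogonality.  The polynomial [y_n] combines [L_n^alpha],
    [x L_(n-1)^(alpha+2)] and [x^2 L_(n-2)^(alpha+4)].  The Chu-Vandermonde sum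
    gives all moments of these three ([kummer_moment]).  Against [x^k] with
    [2 <= k < n] they vanish, and so do the point terms; the cases [k = 0] and
    [k = 1] are two linear relations between the three coefficients
    ([comb_orthogonal_pow]).

    Eigenvalue equation.  The operator sends [x^n] to [- lambda_n x^n] plus
    lower terms ([L_sobolev_pow_lead]), so [p = L y_n + lambda_n y_n] has degree
    less than [n].  By symmetry [(p, p) = (y_n, L p) + lambda_n (y_n, p)], and
    both terms are 0 because [y_n] is orthogonal to lower degrees.  The inner
    product is definite on polynomials, so [p = 0]. *)

(** * One-sided derivatives and regularity on the half-line *)

Lemma is_D_eps (f : R -> R) (x l : R) :
  is_D f x l <->
  forall eps, 0 < eps -> exists delta, 0 < delta /\
    forall y, 0 <= y -> y <> x -> Rabs (y - x) < delta ->
      Rabs ((f y - f x) / (y - x) - l) < eps.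
Proof.
  split.
  - intros H eps He.
    destruct (proj1 (filterlim_locally _ _) H (mkposreal eps He)) as [d Hd].
    exists d; split; [apply cond_pos|].
    intros y Hy Hn Hb. exact (Hd y Hb Hn Hy).
  - intros H. apply filterlim_locally. intros eps.
    destruct (H eps (cond_pos eps)) as [d [Hd Hy]].
    exists (mkposreal d Hd). intros y Hb Hn Hp. exact (Hy y Hp Hn Hb).
Qed.

Lemma is_D_D_in (f d : R -> R) (x : R) :
  is_D f x (d x) <-> D_in f d half_line x.
Proof.
  rewrite is_D_eps. unfold D_in, limit1_in, limit_in, D_x, half_line; simpl.
  unfold Rdist.
  split; intros H eps He; destruct (H eps He) as [a [Ha Hy]];
    exists a; (split; [exact Ha|]).
  - intros y [[Hp Hn] Hb]. apply Hy; auto.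
  - intros y Hp Hn Hb. apply Hy; auto.
Qed.

Lemma half_line_proper (x : R) :
  0 <= x -> ProperFilter (within half_line (locally' x)).
Proof.
  intros Hx. constructor.
  - intros P [d Hd]. exists (x + d / 2).
    pose proof (cond_pos d) as Hp.
    apply (Hd (x + d / 2)); unfold half_line; try lra.
    change (Rabs (x + d / 2 - x) < d).
    rewrite Rabs_pos_eq; lra.
  - apply within_filter, within_filter, locally_filter.
Qed.

Lemma D_unique (f : R -> R) (x l : R) : 0 <= x -> is_D f x l -> D f x = l.
Proof.
  intros Hx H. unfold D, is_D.
  pose proof (half_line_proper x Hx).
  apply (iota_filterlim_locally (K := R_AbsRing) (V := R_CompleteNormedModule)).
  exact H.
Qed.

Lemma is_D_ext (f g : R -> R) (x l : R) :
  (forall y, 0 <= y -> f y = g y) -> 0 <= x -> is_D f x l -> is_D g x l.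
Proof.
  intros E Hx H. apply is_D_eps. intros eps He.
  destruct (proj1 (is_D_eps _ _ _) H eps He) as [d [Hd Hy]].
  exists d; split; auto. intros y Hp Hn Hb.
  rewrite <- (E y Hp), <- (E x Hx). auto.
Qed.

(** No differentiability is assumed: the two functions have the same derivatives
    in the sense of [is_D], hence [iota] makes the same choice for both. *)
Lemma D_ext (f g : R -> R) (x : R) :
  (forall y, 0 <= y -> f y = g y) -> 0 <= x -> D f x = D g x.
Proof.
  intros E Hx. unfold D. apply eq_close.
  apply (close_iota (T := R_CompleteSpace)). intros l.
  split; apply is_D_ext; auto. intros; symmetry; auto.
Qed.

Lemma Dn_ext (n : nat) (f g : R -> R) :
  (forall y, 0 <= y -> f y = g y) -> forall x, 0 <= x -> Dn n f x = Dn n g x.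
Proof.
  intros E. induction n as [|n IH]; simpl; auto.
  intros x Hx. apply D_ext; auto.
Qed.

Lemma Dn_D (n : nat) (f : R -> R) : Dn n (D f) = Dn (S n) f.
Proof. induction n as [|n IH]; simpl; [reflexivity | now rewrite IH]. Qed.

Lemma Dn_add (n m : nat) (f : R -> R) : Dn (n + m) f = Dn n (Dn m f).
Proof. induction n as [|n IH]; simpl; [reflexivity | now rewrite IH]. Qed.

Lemma is_D_plus (f g : R -> R) (x a b : R) :
  is_D f x a -> is_D g x b -> is_D (fun t => f t + g t) x (a + b).
Proof.
  intros Hf Hg.
  apply (is_D_D_in _ (fun _ => a + b)).
  apply (Dadd half_line (fun _ => a) (fun _ => b)); now apply is_D_D_in.
Qed.

Lemma is_D_mult (f g : R -> R) (x a b : R) :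
  is_D f x a -> is_D g x b ->
  is_D (fun t => f t * g t) x (a * g x + f x * b).
Proof.
  intros Hf Hg.
  apply (is_D_D_in _ (fun x => a * g x + f x * b)).
  apply (Dmult half_line (fun _ => a) (fun _ => b)); now apply is_D_D_in.
Qed.

Lemma is_derive_is_D (f : R -> R) (x l : R) : is_derive f x l -> is_D f x l.
Proof.
  intros H. apply (is_D_D_in f (fun _ => l)).
  apply D_in_imp with (D := no_cond); [now intros|].
  apply (derivable_pt_lim_D_in f (fun _ => l)). now apply is_derive_Reals.
Qed.

Lemma is_D_const (c x : R) : is_D (fun _ => c) x 0.
Proof. apply is_derive_is_D. apply is_derive_Reals, derivable_pt_lim_const. Qed.

Lemma is_D_id (x : R) : is_D (fun t => t) x 1.
Proof. apply is_derive_is_D. apply is_derive_Reals, derivable_pt_lim_id. Qed.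

Lemma is_D_exp (x : R) : is_D (fun t => exp (- t)) x (- exp (- x)).
Proof. apply is_derive_is_D. auto_derive; auto; ring. Qed.

Lemma is_D_scal (c : R) (f : R -> R) (x a : R) :
  is_D f x a -> is_D (fun t => c * f t) x (c * a).
Proof.
  intros H. replace (c * a) with (0 * f x + c * a) by ring.
  apply (is_D_mult (fun _ => c)); auto using is_D_const.
Qed.

(** Continuity on the half-line, expressed by the extension that is constant
    on the negative axis: two-sided continuity is what the integration lemmas
    ask for. *)
Definition contH (h : R -> R) : Prop := forall x, continuous (fun t => h (Rmax 0 t)) x.

Lemma Rmax0_lip (x y : R) : Rabs (Rmax 0 y - Rmax 0 x) <= Rabs (y - x).
Proof.
  unfold Rmax. destruct (Rle_dec 0 y), (Rle_dec 0 x); unfold Rabs;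
    repeat destruct Rcase_abs; lra.
Qed.

Lemma continuous_on_contH (h : R -> R) : continuous_on half_line h <-> contH h.
Proof.
  split.
  - intros H x. apply filterlim_locally. intros eps.
    assert (Hm : half_line (Rmax 0 x)) by apply Rmax_l.
    destruct (proj1 (filterlim_locally _ _) (H _ Hm) eps) as [d Hd].
    exists d. intros y Hy. apply Hd; [|apply Rmax_l].
    eapply Rle_lt_trans; [apply Rmax0_lip | exact Hy].
  - intros H x Hx. apply filterlim_locally. intros eps.
    destruct (proj1 (filterlim_locally _ _) (H x) eps) as [d Hd].
    exists d. intros y Hy Hp. specialize (Hd y Hy).
    unfold half_line in *.
    rewrite !Rmax_right in Hd by assumption. exact Hd.
Qed.

Lemma contH_ext (f g : R -> R) :
  (forall y, 0 <= y -> f y = g y) -> contH f -> contH g.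
Proof.
  intros E H x. apply continuous_ext with (2 := H x).
  intros; apply E, Rmax_l.
Qed.

Lemma contH_plus (f g : R -> R) :
  contH f -> contH g -> contH (fun t => f t + g t).
Proof. intros Hf Hg x. apply (continuous_plus (V := R_NormedModule)); auto. Qed.

Lemma contH_mult (f g : R -> R) :
  contH f -> contH g -> contH (fun t => f t * g t).
Proof. intros Hf Hg x. apply (continuous_mult (K := R_AbsRing)); auto. Qed.

Lemma contH_of_D (f : R -> R) :
  (forall x, 0 <= x -> exists l, is_D f x l) -> contH f.
Proof.
  intros H. apply continuous_on_contH. intros x Hx.
  destruct (H x Hx) as [l Hl].
  apply (is_D_D_in f (fun _ => l)) in Hl. apply cont_deriv in Hl.
  apply filterlim_locally. intros eps.
  destruct (Hl eps (cond_pos eps)) as [d [Hd Hy]].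
  exists (mkposreal d Hd). intros y Hb Hp.
  change (Rabs (f y - f x) < eps).
  destruct (Req_dec y x) as [->|Hn].
  - rewrite Rminus_eq_0, Rabs_R0. apply cond_pos.
  - apply Hy. split; [split; auto | exact Hb].
Qed.

Lemma contH_id : contH (fun t => t).
Proof. apply contH_of_D. intros x _. exists 1; apply is_D_id. Qed.

Lemma contH_const (c : R) : contH (fun _ => c).
Proof. apply contH_of_D. intros x _. exists 0; apply is_D_const. Qed.

Lemma contH_exp : contH (fun t => exp (- t)).
Proof. apply contH_of_D. intros x _. eexists; apply is_D_exp. Qed.

(** Continuity of [h] suffices here; the operator has order [4 alpha + 10], so
    that its image is [x] times a function which need only be continuous. *)
Lemma is_D_mulx_0 (h : R -> R) : contH h -> is_D (fun t => t * h t) 0 (h 0).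
Proof.
  intros H. apply is_D_eps. intros eps He.
  destruct (proj1 (filterlim_locally _ _) (H 0) (mkposreal eps He)) as [d Hd].
  exists d; split; [apply cond_pos|]. intros y Hp Hn Hb.
  specialize (Hd y Hb). rewrite !Rmax_right in Hd by lra.
  replace ((y * h y - 0 * h 0) / (y - 0)) with (h y) by (field; lra).
  exact Hd.
Qed.

(** The recursive description on which the closure properties below rest. *)
Lemma Ck_S (k : nat) (h : R -> R) :
  Ck (S k) h <-> (forall x, 0 <= x -> exists l, is_D h x l) /\ Ck k (D h).
Proof.
  unfold Ck. split.
  - intros [H C]. split; [|split].
    + intros x Hx. apply (H 0%nat x); [lia | exact Hx].
    + intros i x Hi Hx. rewrite Dn_D. apply H; [lia | exact Hx].
    + rewrite Dn_D. exact C.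
  - intros [H [H1 C]]. split.
    + intros [|i] x Hi Hx; [apply H; exact Hx|].
      rewrite <- Dn_D. apply H1; [lia | exact Hx].
    + rewrite Dn_D in C. exact C.
Qed.

Lemma Ck_0 (h : R -> R) : Ck 0 h <-> contH h.
Proof.
  rewrite <- continuous_on_contH. unfold Ck; simpl. split; [tauto|].
  intros H; split; auto. intros; lia.
Qed.

Lemma Ck_D (k : nat) (h : R -> R) : Ck (S k) h -> Ck k (D h).
Proof. intros H. now apply Ck_S in H. Qed.

Lemma Ck_is_D (k : nat) (h : R -> R) (x : R) :
  Ck (S k) h -> 0 <= x -> is_D h x (D h x).
Proof.
  intros H Hx. apply Ck_S in H. destruct (proj1 H x Hx) as [l Hl].
  now rewrite (D_unique _ _ _ Hx Hl).
Qed.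

Lemma Ck_ext (k : nat) (f g : R -> R) :
  (forall y, 0 <= y -> f y = g y) -> Ck k f -> Ck k g.
Proof.
  intros E [H C]. split.
  - intros i x Hi Hx. destruct (H i x Hi Hx) as [l Hl]. exists l.
    apply is_D_ext with (3 := Hl); auto. now apply Dn_ext.
  - apply continuous_on_contH. apply continuous_on_contH in C.
    apply contH_ext with (2 := C). now apply Dn_ext.
Qed.

Lemma Ck_intro (k : nat) (h d : R -> R) :
  (forall x, 0 <= x -> is_D h x (d x)) -> Ck k d -> Ck (S k) h.
Proof.
  intros H C. apply Ck_S. split.
  - intros x Hx. exists (d x); auto.
  - apply Ck_ext with (2 := C). intros y Hy. symmetry. apply D_unique; auto.
Qed.

Lemma Ck_pred (k : nat) (h : R -> R) : Ck (S k) h -> Ck k h.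
Proof.
  revert h. induction k as [|k IH]; intros h H.
  - apply Ck_0, contH_of_D. now apply Ck_S in H.
  - apply Ck_intro with (D h); [intros; eapply Ck_is_D; eauto|].
    apply IH. now apply Ck_D.
Qed.

Lemma Ck_le (j k : nat) (h : R -> R) : (j <= k)%nat -> Ck k h -> Ck j h.
Proof. induction 1; auto using Ck_pred. Qed.

Lemma Ck_contH (k : nat) (h : R -> R) : Ck k h -> contH h.
Proof. intros H. apply Ck_0. apply Ck_le with k; [lia | exact H]. Qed.

Lemma Ck_Dn (i k : nat) (h : R -> R) : Ck (i + k) h -> Ck k (Dn i h).
Proof.
  revert h. induction i as [|i IH]; intros h H; auto.
  rewrite <- Dn_D. apply IH, Ck_D, H.
Qed.

Lemma Ck_plus (k : nat) (f g : R -> R) :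
  Ck k f -> Ck k g -> Ck k (fun t => f t + g t).
Proof.
  revert f g. induction k as [|k IH]; intros f g Hf Hg.
  - apply Ck_0, contH_plus; now apply Ck_0.
  - apply Ck_intro with (fun x => D f x + D g x).
    + intros x Hx. apply is_D_plus; eapply Ck_is_D; eauto.
    + apply IH; now apply Ck_D.
Qed.

Lemma Ck_mult (k : nat) (f g : R -> R) :
  Ck k f -> Ck k g -> Ck k (fun t => f t * g t).
Proof.
  revert f g. induction k as [|k IH]; intros f g Hf Hg.
  - apply Ck_0, contH_mult; now apply Ck_0.
  - apply Ck_intro with (fun x => D f x * g x + f x * D g x).
    + intros x Hx. apply is_D_mult; eapply Ck_is_D; eauto.
    + apply Ck_plus; apply IH; auto using Ck_D, Ck_pred.
Qed.

Lemma Ck_const (k : nat) (c : R) : Ck k (fun _ => c).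
Proof.
  revert c. induction k as [|k IH]; intros c.
  - apply Ck_0, contH_const.
  - apply Ck_intro with (fun _ => 0); auto. intros; apply is_D_const.
Qed.

Lemma Ck_id (k : nat) : Ck k (fun t => t).
Proof.
  destruct k as [|k]; [apply Ck_0, contH_id|].
  apply Ck_intro with (fun _ => 1); [intros; apply is_D_id | apply Ck_const].
Qed.

Lemma Ck_exp (k : nat) : Ck k (fun t => exp (- t)).
Proof.
  induction k as [|k IH]; [apply Ck_0, contH_exp|].
  apply Ck_intro with (fun x => (-1) * exp (- x)).
  - intros x _. replace ((-1) * exp (- x)) with (- exp (- x)) by ring.
    apply is_D_exp.
  - apply Ck_mult; auto using Ck_const.
Qed.

Lemma Ck_pow (k n : nat) : Ck k (fun t => t ^ n).
Proof.
  induction n as [|n IH]; simpl; [apply Ck_const|].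
  apply Ck_mult; auto using Ck_id.
Qed.

Lemma Ck_scal (k : nat) (c : R) (f : R -> R) : Ck k f -> Ck k (fun t => c * f t).
Proof. intros H. apply Ck_mult; auto using Ck_const. Qed.

Lemma Dn_plus (n : nat) (f g : R -> R) (x : R) :
  Ck n f -> Ck n g -> 0 <= x ->
  Dn n (fun t => f t + g t) x = Dn n f x + Dn n g x.
Proof.
  revert f g. induction n as [|n IH]; intros f g Hf Hg Hx; auto.
  rewrite <- !Dn_D, <- (IH (D f) (D g)); auto using Ck_D.
  apply Dn_ext; auto. intros y Hy.
  apply D_unique; auto. apply is_D_plus; eapply Ck_is_D; eauto.
Qed.

Lemma Dn_scal (n : nat) (c : R) (f : R -> R) (x : R) :
  Ck n f -> 0 <= x -> Dn n (fun t => c * f t) x = c * Dn n f x.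
Proof.
  revert f. induction n as [|n IH]; intros f Hf Hx; auto.
  rewrite <- !Dn_D, <- (IH (D f)); auto using Ck_D.
  apply Dn_ext; auto. intros y Hy.
  apply D_unique; auto. apply is_D_scal; eapply Ck_is_D; eauto.
Qed.

Lemma Dn_mulx (n : nat) (h : R -> R) (x : R) :
  Ck n h -> 0 <= x ->
  Dn n (fun t => t * h t) x = x * Dn n h x + INR n * Dn (pred n) h x.
Proof.
  revert h. induction n as [|n IH]; intros h Hh Hx; [simpl; ring|].
  rewrite <- !Dn_D.
  rewrite (Dn_ext n _ (fun t => t * D h t + h t)); auto.
  - rewrite Dn_plus; auto using Ck_pred.
    + rewrite IH; auto using Ck_D.
      destruct n as [|n]; [simpl; ring|].
      rewrite (S_INR (S n)). simpl pred. rewrite !Dn_D. ring.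
    + apply Ck_mult; auto using Ck_id, Ck_D.
  - intros y Hy. apply D_unique; auto.
    replace (y * D h y + h y) with (1 * h y + y * D h y) by ring.
    apply (is_D_mult (fun t => t)); [apply is_D_id | eapply Ck_is_D; eauto].
Qed.

(** Conjugating by the exponential turns [D] into [D - 1]. *)
Lemma Dn_exp (n : nat) (h : R -> R) (x : R) :
  Ck (S n) h -> 0 <= x ->
  Dn (S n) (fun t => exp (- t) * h t) x
  = Dn n (fun t => exp (- t) * D h t) x - Dn n (fun t => exp (- t) * h t) x.
Proof.
  intros H Hx. rewrite <- Dn_D.
  transitivity (Dn n (fun t => exp (-t) * D h t + (-1) * (exp (- t) * h t)) x).
  - apply Dn_ext; auto. intros y Hy. apply D_unique; auto.
    replace (exp (- y) * D h y + -1 * (exp (- y) * h y))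
      with (- exp (- y) * h y + exp (- y) * D h y) by ring.
    apply (is_D_mult (fun t => exp (- t)));
      [apply is_D_exp | eapply Ck_is_D; eauto].
  - rewrite Dn_plus, Dn_scal; auto; try ring;
    repeat apply Ck_mult; auto using Ck_exp, Ck_D, Ck_pred, Ck_const.
Qed.

(** * Improper integrals over the half-line *)

Definition is_int (f : R -> R) (l : R) : Prop :=
  is_RInt_gen f (at_point 0) (Rbar_locally p_infty) l.

Definition ex_int (f : R -> R) : Prop := exists l, is_int f l.

Lemma products_integrable_ex_int (k : nat) (f g : R -> R) :
  products_integrable k f g <->
  forall i j p : nat, (i <= k)%nat -> (j <= k)%nat ->
    ex_int (fun x => x ^ p * Dn i f x * Dn j g x * exp (- x)).
Proof.
  unfold products_integrable, ex_RInt_gen, ex_int, is_int. reflexivity.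
Qed.

Definition int (f : R -> R) : R :=
  RInt_gen f (at_point 0) (Rbar_locally p_infty).

Lemma is_int_unique (f : R -> R) (l : R) : is_int f l -> int f = l.
Proof.
  unfold is_int, int. intros H.
  exact (is_RInt_gen_unique (V := R_CompleteNormedModule)
           (Fa := at_point 0) (Fb := Rbar_locally p_infty) f l H).
Qed.

Lemma ex_int_is (f : R -> R) : ex_int f -> is_int f (int f).
Proof. intros [l Hl]. now rewrite (is_int_unique _ _ Hl). Qed.

Lemma is_int_ext (f g : R -> R) (l : R) :
  (forall x, 0 <= x -> f x = g x) -> is_int f l -> is_int g l.
Proof.
  unfold is_int. intros E H.
  apply (is_RInt_gen_ext (V := R_NormedModule) f g) with (2 := H).
  apply Filter_prod with (fun a => a = 0) (fun b => 0 < b).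
  - reflexivity.
  - exists 0; auto.
  - intros a b -> Hb x. simpl. rewrite Rmin_left by lra. intros Hx.
    apply E; lra.
Qed.

Lemma ex_int_ext (f g : R -> R) :
  (forall x, 0 <= x -> f x = g x) -> ex_int f -> ex_int g.
Proof. intros E [l Hl]. exists l. now apply is_int_ext with f. Qed.

Lemma int_ext (f g : R -> R) :
  (forall x, 0 <= x -> f x = g x) -> ex_int f -> int f = int g.
Proof.
  intros E H. symmetry. apply is_int_unique.
  apply is_int_ext with f; auto using ex_int_is.
Qed.

Lemma is_int_plus (f g : R -> R) (a b : R) :
  is_int f a -> is_int g b -> is_int (fun x => f x + g x) (a + b).
Proof. unfold is_int. intros. now apply (is_RInt_gen_plus (V := R_NormedModule)). Qed.

Lemma is_int_scal (c : R) (f : R -> R) (a : R) :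
  is_int f a -> is_int (fun x => c * f x) (c * a).
Proof. unfold is_int. intros. now apply (is_RInt_gen_scal (V := R_NormedModule)). Qed.

Lemma ex_int_plus (f g : R -> R) :
  ex_int f -> ex_int g -> ex_int (fun x => f x + g x).
Proof. intros [a Ha] [b Hb]. exists (a + b). now apply is_int_plus. Qed.

Lemma ex_int_scal (c : R) (f : R -> R) :
  ex_int f -> ex_int (fun x => c * f x).
Proof. intros [a Ha]. exists (c * a). now apply is_int_scal. Qed.

Lemma int_plus (f g : R -> R) :
  ex_int f -> ex_int g -> int (fun x => f x + g x) = int f + int g.
Proof. intros. apply is_int_unique, is_int_plus; now apply ex_int_is. Qed.

Lemma int_scal (c : R) (f : R -> R) :
  ex_int f -> int (fun x => c * f x) = c * int f.
Proof. intros. apply is_int_unique, is_int_scal; now apply ex_int_is. Qed.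

Lemma is_int_lim (f F : R -> R) (l : R) :
  (forall b, 0 <= b -> is_RInt f 0 b (F b)) ->
  is_int f l <-> is_lim F p_infty l.
Proof.
  intros HF.
  change (is_int f l <-> filterlim F (Rbar_locally p_infty) (locally l)).
  unfold is_int, is_RInt_gen. rewrite filterlimi_locally.
  rewrite filterlim_locally. split; intros H eps; specialize (H eps).
  - destruct H as [P Q HP [B HQ] H].
    exists (Rmax 0 B). intros b Hb.
    destruct (H 0 b HP) as [z [Hz Bz]].
    { apply HQ. eapply Rle_lt_trans; [apply Rmax_r | exact Hb]. }
    simpl in Hz. replace (F b) with z; auto.
    assert (Hb0 : 0 <= b) by (eapply Rle_trans; [apply (Rmax_l 0 B) | lra]).
    pose proof (is_RInt_unique _ _ _ _ Hz) as E1.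
    pose proof (is_RInt_unique _ _ _ _ (HF b Hb0)) as E2.
    congruence.
  - destruct H as [B HB].
    apply Filter_prod with (fun a => a = 0) (fun b => Rmax 0 B < b).
    + reflexivity.
    + exists (Rmax 0 B); auto.
    + intros a b -> Hb. exists (F b).
      assert (0 <= b) by (eapply Rle_trans; [apply (Rmax_l 0 B) | lra]).
      split; [now apply HF|]. apply HB.
      eapply Rle_lt_trans; [apply (Rmax_r 0) | exact Hb].
Qed.

(** The fundamental theorem of calculus for one-sided derivatives: continuing
    [h] by its tangent at 0 gives a function that is differentiable on both
    sides of every point of the half-line. *)
Lemma is_RInt_D (h d : R -> R) (b : R) :
  (forall x, 0 <= x -> is_D h x (d x)) -> contH d -> 0 <= b ->
  is_RInt d 0 b (h b - h 0).
Proof.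
  intros Hd Cd Hb.
  set (k := fun x => if Rle_dec 0 x then h x else h 0 + x * d 0).
  assert (Ek : forall x, 0 <= x -> k x = h x).
  { intros x Hx. unfold k. destruct (Rle_dec 0 x); [reflexivity | lra]. }
  apply is_RInt_ext with (fun t => d (Rmax 0 t)).
  { rewrite Rmin_left by lra. intros x Hx. rewrite Rmax_right; lra. }
  rewrite <- (Ek b), <- (Ek 0) by lra.
  apply (is_RInt_derive (V := R_CompleteNormedModule) k (fun t => d (Rmax 0 t)));
    rewrite Rmin_left, Rmax_right by lra; [|intros x _; apply Cd].
  intros x [Hx _]. rewrite (Rmax_right 0 x) by lra.
  apply is_derive_Reals. intros eps He.
  destruct (proj1 (is_D_eps _ _ _) (Hd x Hx) eps He) as [e [He0 Hy]].
  (* For [x > 0] the increment must not leave the half-line. *)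
  assert (Hp : 0 < (if Rle_dec x 0 then e else Rmin x e)).
  { destruct (Rle_dec x 0); [lra | apply Rmin_glb_lt; lra]. }
  exists (mkposreal _ Hp). intros t Ht Hlt. simpl in Hlt.
  assert (Rabs t < e).
  { destruct (Rle_dec x 0); auto. eapply Rlt_le_trans; [exact Hlt | apply Rmin_r]. }
  destruct (Rle_dec 0 (x + t)) as [Hpos|Hneg].
  - rewrite (Ek (x + t)), (Ek x) by assumption.
    replace ((h (x + t) - h x) / t) with ((h (x + t) - h x) / ((x + t) - x))
      by (f_equal; ring).
    apply Hy; auto; try lra. replace (x + t - x) with t by ring; auto.
  - assert (x = 0).
    { destruct (Rle_dec x 0); [lra|]. exfalso.
      assert (Rabs t < x) by (eapply Rlt_le_trans; [exact Hlt | apply Rmin_l]).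
      unfold Rabs in *. destruct (Rcase_abs t); lra. }
    subst x. rewrite (Ek 0) by lra. unfold k.
    destruct (Rle_dec 0 (0 + t)); [lra|].
    replace ((h 0 + (0 + t) * d 0 - h 0) / t - d 0) with 0 by (field; lra).
    rewrite Rabs_R0; lra.
Qed.

(** Convergence of the integrals of [h] and of its derivative forces [h] to
    vanish at infinity: the derivative makes [h] converge, and by the mean
    value theorem its limit is that of the integrals of [h] over [x, x + 1]. *)
Lemma is_int_D (h d : R -> R) :
  (forall x, 0 <= x -> is_D h x (d x)) -> contH d ->
  ex_int h -> ex_int d -> is_int d (- h 0).
Proof.
  intros Hd Cd [I HI] [J HJ].
  assert (Ch : contH h).
  { apply contH_of_D. intros x Hx. exists (d x); auto. }
  assert (Eh : forall b, 0 <= b -> is_RInt d 0 b (h b - h 0)).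
  { intros; now apply is_RInt_D. }
  assert (Lh : is_lim h p_infty (J + h 0)).
  { apply (is_lim_ext (fun x => (h x - h 0) + h 0)); [intros; ring|].
    apply (is_lim_plus' (fun x => h x - h 0) (fun _ => h 0));
      [|apply is_lim_const].
    now apply (is_int_lim d (fun x => h x - h 0)). }
  (* [h] is extended to the left of 0 to have a primitive on the whole line. *)
  set (H := fun b => RInt (fun t => h (Rmax 0 t)) 0 b).
  assert (DH : forall x, is_derive H x (h (Rmax 0 x))).
  { intros x. apply (is_derive_RInt (fun t => h (Rmax 0 t)) H 0).
    - exists (mkposreal 1 Rlt_0_1). intros y _. unfold H.
      apply (RInt_correct (V := R_CompleteNormedModule)).
      apply (ex_RInt_continuous (V := R_CompleteNormedModule)).
      intros; apply Ch.
    - apply Ch. }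
  assert (LH : is_lim H p_infty I).
  { apply (is_int_lim h H); auto. intros b Hb.
    apply is_RInt_ext with (fun t => h (Rmax 0 t)).
    - rewrite Rmin_left by lra. intros x Hx. rewrite Rmax_right; lra.
    - apply (RInt_correct (V := R_CompleteNormedModule)).
      apply (ex_RInt_continuous (V := R_CompleteNormedModule)).
      intros; apply Ch. }
  assert (Z : J + h 0 = 0).
  { apply cond_eq. intros eps He.
    rewrite Rminus_0_r.
    apply is_lim_spec in Lh. apply is_lim_spec in LH.
    assert (He3 : 0 < eps / 3) by lra.
    destruct (Lh (mkposreal _ He3)) as [B1 H1].
    destruct (LH (mkposreal _ He3)) as [B2 H2]. simpl in H1, H2.
    set (b := Rmax 0 (Rmax B1 B2) + 1).
    assert (Hb : 0 < b /\ B1 < b /\ B2 < b).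
    { unfold b. pose proof (Rmax_l 0 (Rmax B1 B2)).
      pose proof (Rmax_r 0 (Rmax B1 B2)).
      pose proof (Rmax_l B1 B2). pose proof (Rmax_r B1 B2). lra. }
    destruct (MVT_gen H b (b + 1) (fun x => h (Rmax 0 x))) as [c [Hc Ec]].
    - intros; apply DH.
    - intros x _. apply continuity_pt_filterlim.
      apply (ex_derive_continuous H). eexists; apply DH.
    - rewrite Rmin_left, Rmax_right in Hc by lra.
      rewrite Rmax_right in Ec by lra.
      pose proof (H1 c ltac:(lra)) as A1.
      pose proof (H2 b ltac:(lra)) as A2.
      pose proof (H2 (b + 1) ltac:(lra)) as A3.
      apply Rabs_def1; apply Rabs_def2 in A1, A2, A3; lra. }
  replace (- h 0) with J by lra. exact HJ.
Qed.

Lemma pow_le_exp (n : nat) (x : R) : 0 <= x -> x ^ n <= INR (fact n) * exp x.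
Proof.
  intros Hx. pose proof (INR_fact_lt_0 n) as Hf.
  pose proof (exp_ge_taylor x n Hx) as H.
  assert (T : x ^ n / INR (fact n) <= exp x).
  { eapply Rle_trans; [|exact H]. destruct n as [|n]; [simpl; lra|].
    rewrite tech5.
    assert (0 <= sum_f_R0 (fun k => x ^ k / INR (fact k)) n); [|lra].
    apply cond_pos_sum. intros k. apply Rmult_le_pos; [now apply pow_le|].
    apply Rlt_le, Rinv_0_lt_compat, INR_fact_lt_0. }
  apply Rmult_le_compat_l with (r := INR (fact n)) in T; [|lra].
  replace (INR (fact n) * (x ^ n / INR (fact n))) with (x ^ n) in T; auto.
  field; lra.
Qed.

(** Compare with [(n + 1)! / x], by the Taylor bound of order [n + 1]. *)
Lemma is_lim_pow_exp (n : nat) : is_lim (fun x => x ^ n * exp (- x)) p_infty 0.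
Proof.
  apply is_lim_le_le_loc with (fun _ => 0) (fun x => INR (fact (S n)) * / x).
  - exists 1. intros x Hx. split.
    + apply Rmult_le_pos; [apply pow_le; lra | apply Rlt_le, exp_pos].
    + apply Rmult_le_reg_r with (x * exp x).
      { apply Rmult_lt_0_compat; [lra | apply exp_pos]. }
      pose proof (pow_le_exp (S n) x ltac:(lra)) as H. simpl pow in H.
      replace (x ^ n * exp (- x) * (x * exp x))
        with (x * x ^ n * (exp (- x) * exp x)) by ring.
      rewrite <- exp_plus. replace (- x + x) with 0 by ring. rewrite exp_0.
      replace (INR (fact (S n)) * / x * (x * exp x))
        with (INR (fact (S n)) * exp x) by (field; lra). lra.
  - apply is_lim_const.
  - replace (Finite 0) with (Rbar_mult (INR (fact (S n))) (Rbar_inv p_infty))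
      by (simpl; f_equal; ring).
    apply is_lim_scal_l. apply is_lim_inv; [apply is_lim_id | discriminate].
Qed.

Fixpoint exp_primitive (n : nat) (x : R) : R :=
  match n with
  | O => - exp (- x)
  | S m => - (x ^ S m * exp (- x)) + INR (S m) * exp_primitive m x
  end.

Lemma exp_primitive_0 (n : nat) : exp_primitive n 0 = - INR (fact n).
Proof.
  induction n as [|n IH].
  - simpl. rewrite Ropp_0, exp_0. reflexivity.
  - cbn [exp_primitive]. rewrite IH, pow_i by lia.
    rewrite fact_simpl, mult_INR. ring.
Qed.

Lemma exp_primitive_derive (n : nat) (x : R) :
  is_derive (exp_primitive n) x (x ^ n * exp (- x)).
Proof.
  assert (H : forall m, is_derive (fun t => - (t ^ m * exp (- t))) x
    (- (INR m * x ^ pred m * exp (- x) - x ^ m * exp (- x)))).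
  { intros m. auto_derive; auto; ring. }
  induction n as [|n IH].
  - simpl. auto_derive; auto; ring.
  - replace (x ^ S n * exp (- x)) with
      (- (INR (S n) * x ^ n * exp (- x) - x ^ S n * exp (- x))
       + INR (S n) * (x ^ n * exp (- x))) by ring.
    apply (is_derive_plus (V := R_NormedModule)).
    + apply (H (S n)).
    + apply is_derive_scal. exact IH.
Qed.

Lemma exp_primitive_lim (n : nat) : is_lim (exp_primitive n) p_infty 0.
Proof.
  induction n as [|n IH].
  - replace (Finite 0) with (Rbar_opp 0) by (simpl; f_equal; ring).
    apply is_lim_opp.
    apply is_lim_ext with (fun x => x ^ 0 * exp (- x)); [intros; simpl; ring|].
    apply is_lim_pow_exp.
  - replace (Finite 0) with (Finite (- 0 + INR (S n) * 0)) by (f_equal; ring).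
    apply is_lim_plus'.
    + apply (is_lim_opp (fun x => x ^ S n * exp (- x)) p_infty 0).
      apply is_lim_pow_exp.
    + apply (is_lim_scal_l (exp_primitive n) (INR (S n)) p_infty 0). exact IH.
Qed.

(** The left end point is approached through an arbitrary filter: the inner
    product starts at 0, the Gamma function at 0+. *)
Lemma exp_moment_gen (n : nat) (F : (R -> Prop) -> Prop) {FF : Filter F} :
  filter_le F (locally 0) ->
  is_RInt_gen (fun x => x ^ n * exp (- x)) F (Rbar_locally p_infty)
    (INR (fact n)).
Proof.
  intros HF.
  replace (INR (fact n)) with (0 - exp_primitive n 0)
    by (rewrite exp_primitive_0; ring).
  assert (ED : forall x, Derive (exp_primitive n) x = x ^ n * exp (- x)).
  { intros x. apply is_derive_unique, exp_primitive_derive. }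
  apply is_RInt_gen_ext with (Derive (exp_primitive n)).
  { apply filter_forall. intros ab x _. apply ED. }
  apply is_RInt_gen_Derive.
  - apply filter_forall. intros ab x _. eexists; apply exp_primitive_derive.
  - apply filter_forall. intros ab x _.
    apply continuous_ext with (fun x => x ^ n * exp (- x)).
    { intros; symmetry; apply ED. }
    apply (ex_derive_continuous (fun x => x ^ n * exp (- x))).
    auto_derive; auto.
  - apply filterlim_filter_le_1 with (1 := HF).
    apply (ex_derive_continuous (exp_primitive n)).
    eexists; apply exp_primitive_derive.
  - apply exp_primitive_lim.
Qed.

Lemma exp_moment (n : nat) : is_int (fun x => x ^ n * exp (- x)) (INR (fact n)).
Proof.
  apply (exp_moment_gen n (at_point 0)).
  intros P [d Hd]. apply Hd. apply ball_center.
Qed.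

Lemma Gamma_fact (n : nat) : Gamma (INR n + 1) = INR (fact n).
Proof.
  unfold Gamma. apply (is_RInt_gen_unique (V := R_CompleteNormedModule)).
  apply is_RInt_gen_ext with (fun x => x ^ n * exp (- x)).
  - apply Filter_prod with (fun a => 0 < a) (fun b => 0 < b).
    + exists (mkposreal 1 Rlt_0_1). auto.
    + exists 0; auto.
    + intros a b Ha Hb x [Hx _]. simpl in Hx. f_equal.
      replace (INR n + 1 - 1) with (INR n) by ring.
      symmetry. apply Rpower_pow.
      eapply Rlt_trans; [|exact Hx]. now apply Rmin_glb_lt.
  - apply (exp_moment_gen n (at_right 0)). intros P [d Hd]. exists d. auto.
Qed.

(** * Green's formula and Taylor coefficients at 0 *)

(** Linear combinations of the [x^p f^(i)] with [i <= k]. The integrability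
    hypothesis concerns products of such terms, and the class is stable under
    differentiation, which keeps every integral of the repeated integration by
    parts convergent without computing an integrand. *)
Inductive jet (f : R -> R) (k : nat) : (R -> R) -> Prop :=
| jet_Dn_f i : (i <= k)%nat -> jet f k (Dn i f)
| jet_mulx h : jet f k h -> jet f k (fun t => t * h t)
| jet_plus h1 h2 : jet f k h1 -> jet f k h2 -> jet f k (fun t => h1 t + h2 t)
| jet_scal c h : jet f k h -> jet f k (fun t => c * h t)
| jet_ext h1 h2 :
    (forall x, 0 <= x -> h1 x = h2 x) -> jet f k h1 -> jet f k h2.

Lemma jet_le (f h : R -> R) (j k : nat) :
  (j <= k)%nat -> jet f j h -> jet f k h.
Proof.
  intros Hjk. induction 1; eauto using jet_mulx, jet_plus, jet_scal, jet_ext.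
  apply jet_Dn_f; lia.
Qed.

Lemma jet_pow (f h : R -> R) (k p : nat) :
  jet f k h -> jet f k (fun t => t ^ p * h t).
Proof.
  intros H. induction p as [|p IH].
  - apply jet_ext with h; auto. intros; simpl; ring.
  - apply jet_ext with (fun t => t * (t ^ p * h t)); [intros; simpl; ring|].
    now apply jet_mulx.
Qed.

Lemma jet_Ck (K k : nat) (f h : R -> R) :
  Ck K f -> (k <= K)%nat -> jet f k h -> Ck (K - k) h.
Proof.
  intros Hf Hk. induction 1;
    eauto using Ck_mult, Ck_id, Ck_plus, Ck_scal, Ck_ext.
  apply Ck_Dn. apply Ck_le with K; auto. lia.
Qed.

Lemma jet_D (K k : nat) (f h : R -> R) :
  Ck K f -> (k < K)%nat -> jet f k h -> jet f (S k) (D h).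
Proof.
  intros Hf Hk H.
  assert (R : forall u, jet f k u -> forall x, 0 <= x -> is_D u x (D u x)).
  { intros u Hu x Hx. apply Ck_is_D with (K - S k)%nat; auto.
    replace (S (K - S k)) with (K - k)%nat by lia.
    apply jet_Ck with f; auto; lia. }
  induction H as [i Hi|u Hu IH|u1 u2 H1 IH1 H2 IH2|c u Hu IH|u1 u2 E Hu IH].
  - apply (jet_Dn_f f (S k) (S i)); lia.
  - apply jet_ext with (fun t => u t + t * D u t).
    + intros x Hx. symmetry. apply D_unique; auto.
      replace (u x + x * D u x) with (1 * u x + x * D u x) by ring.
      apply (is_D_mult (fun t => t)); auto using is_D_id.
    + apply jet_plus; [apply jet_le with k; auto | now apply jet_mulx].
  - apply jet_ext with (fun t => D u1 t + D u2 t); [|now apply jet_plus].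
    intros x Hx. symmetry. apply D_unique; auto. apply is_D_plus; auto.
  - apply jet_ext with (fun t => c * D u t); [|now apply jet_scal].
    intros x Hx. symmetry. apply D_unique; auto. apply is_D_scal; auto.
  - apply jet_ext with (D u1); auto. intros x Hx. now apply D_ext.
Qed.

Lemma jet_Dn (K k m : nat) (f h : R -> R) :
  Ck K f -> (m + k <= K)%nat -> jet f k h -> jet f (m + k) (Dn m h).
Proof.
  intros Hf. induction m as [|m IH]; intros Hk H; auto.
  simpl. apply jet_D with K; auto. apply IH; auto; lia.
Qed.

(** Multiplication by [x] inside either factor is absorbed by the exponent [p],
    which the induction therefore has to keep arbitrary. *)
Lemma jet_products (K : nat) (f g h1 h2 : R -> R) (p : nat) :
  products_integrable K f g -> jet f K h1 -> jet g K h2 ->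
  ex_int (fun x => x ^ p * h1 x * h2 x * exp (- x)).
Proof.
  intros HI H1 H2. apply products_integrable_ex_int in HI. revert p.
  induction H1 as [i Hi|u Hu IH|u1 u2 _ IH1 _ IH2|c u _ IH|u1 u2 E _ IH]; intros p.
  - revert p.
    induction H2 as [j Hj|v Hv IH|v1 v2 _ IH1 _ IH2|c v _ IH|v1 v2 E _ IH]; intros p.
    + now apply HI.
    + apply ex_int_ext with (2 := IH (S p)). intros; simpl; ring.
    + apply ex_int_ext with (2 := ex_int_plus _ _ (IH1 p) (IH2 p)).
      intros; simpl; ring.
    + apply ex_int_ext with (2 := ex_int_scal c _ (IH p)). intros; simpl; ring.
    + apply ex_int_ext with (2 := IH p). intros x Hx. now rewrite E.
  - apply ex_int_ext with (2 := IH (S p)). intros; simpl; ring.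
  - apply ex_int_ext with (2 := ex_int_plus _ _ (IH1 p) (IH2 p)).
    intros; simpl; ring.
  - apply ex_int_ext with (2 := ex_int_scal c _ (IH p)). intros; simpl; ring.
  - apply ex_int_ext with (2 := IH p). intros x Hx. now rewrite E.
Qed.

(** The exponential weight is attached to one of the two factors: it then suffices
    to differentiate products of two functions. *)
Definition damp (h : R -> R) (t : R) : R := exp (- t) * h t.

Definition damped_jet (f : R -> R) (k : nat) (w : R -> R) : Prop :=
  exists h, jet f k h /\ forall x, 0 <= x -> w x = damp h x.

Lemma damped_jet_damp (f h : R -> R) (k : nat) : jet f k h -> damped_jet f k (damp h).
Proof. intros H. exists h; auto. Qed.

Lemma Ck_damp (k : nat) (h : R -> R) : Ck k h -> Ck k (damp h).
Proof. intros H. apply Ck_mult; auto using Ck_exp. Qed.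

Lemma damped_jet_Ck (K k : nat) (f w : R -> R) :
  Ck K f -> (k <= K)%nat -> damped_jet f k w -> Ck (K - k) w.
Proof.
  intros Hf Hk [h [Hh E]]. apply Ck_ext with (damp h).
  - intros; symmetry; auto.
  - apply Ck_damp. now apply jet_Ck with f.
Qed.

Lemma damped_jet_D (K k : nat) (f w : R -> R) :
  Ck K f -> (k < K)%nat -> damped_jet f k w -> damped_jet f (S k) (D w).
Proof.
  intros Hf Hk [h [Hh E]]. exists (fun t => D h t + (-1) * h t). split.
  - apply jet_plus; [now apply jet_D with K|].
    apply jet_scal. apply jet_le with k; auto.
  - intros x Hx. rewrite (D_ext w (damp h)); auto.
    apply D_unique; auto. unfold damp.
    replace (exp (- x) * (D h x + -1 * h x))
      with (- exp (- x) * h x + exp (- x) * D h x) by ring.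
    apply (is_D_mult (fun t => exp (- t))); [apply is_D_exp|].
    apply Ck_is_D with (K - S k)%nat; auto.
    replace (S (K - S k)) with (K - k)%nat by lia.
    apply jet_Ck with f; auto; lia.
Qed.

Lemma damped_jet_Dn (K k m : nat) (f w : R -> R) :
  Ck K f -> (m + k <= K)%nat -> damped_jet f k w -> damped_jet f (m + k) (Dn m w).
Proof.
  intros Hf. induction m as [|m IH]; intros Hk H; auto.
  simpl. apply damped_jet_D with K; auto. apply IH; auto; lia.
Qed.

Lemma damped_jet_products (K k l : nat) (f g w v : R -> R) :
  products_integrable K f g -> (k <= K)%nat -> (l <= K)%nat ->
  damped_jet f k w -> jet g l v -> ex_int (fun x => w x * v x).
Proof.
  intros HI Hk Hl [h [Hh E]] Hv.
  apply ex_int_ext with (fun x => x ^ 0 * h x * v x * exp (- x)).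
  - intros x Hx. rewrite E by assumption. unfold damp. simpl. ring.
  - apply (jet_products K f g); auto.
    + apply jet_le with k; auto.
    + apply jet_le with l; auto.
Qed.

Section Green.

Variables (K : nat) (f g : R -> R).
Hypothesis (Hf : Ck K f) (Hg : Ck K g) (HI : products_integrable K f g).

(** One integration by parts; the term at infinity is 0 by [is_int_D]. *)
Lemma green_step (k l : nat) (w v : R -> R) :
  (k < K)%nat -> (l < K)%nat -> damped_jet f k w -> jet g l v ->
  int (fun x => D w x * v x) = - (w 0 * v 0) - int (fun x => w x * D v x).
Proof.
  intros Hk Hl Hw Hv.
  assert (Hw' := damped_jet_D K k f w Hf Hk Hw).
  assert (Hv' := jet_D K l g v Hg Hl Hv).
  assert (I1 : ex_int (fun x => D w x * v x)).
  { apply (damped_jet_products K (S k) l f g); auto; lia. }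
  assert (I2 : ex_int (fun x => w x * D v x)).
  { apply (damped_jet_products K k (S l) f g); auto; lia. }
  assert (Cw := damped_jet_Ck K k f w Hf (Nat.lt_le_incl _ _ Hk) Hw).
  assert (Cv := jet_Ck K l g v Hg (Nat.lt_le_incl _ _ Hl) Hv).
  replace (K - k)%nat with (S (K - S k)) in Cw by lia.
  replace (K - l)%nat with (S (K - S l)) in Cv by lia.
  assert (J : is_int (fun x => D w x * v x + w x * D v x) (- (w 0 * v 0))).
  { apply (is_int_D (fun x => w x * v x)).
    - intros x Hx. apply is_D_mult; eapply Ck_is_D; eauto.
    - apply contH_plus; apply contH_mult; eapply Ck_contH; eauto using Ck_D.
    - apply (damped_jet_products K k l f g); auto; lia.
    - now apply ex_int_plus. }
  apply is_int_unique in J. rewrite int_plus in J by assumption. lra.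
Qed.

Lemma green_vanish (m k l : nat) (w v : R -> R) :
  (m + k <= K)%nat -> (m + l <= K)%nat -> damped_jet f k w -> jet g l v ->
  (forall r, (r < m)%nat -> Dn (m - 1 - r) w 0 * Dn r v 0 = 0) ->
  int (fun x => Dn m w x * v x) = (-1) ^ m * int (fun x => w x * Dn m v x).
Proof.
  revert l v. induction m as [|m IH]; intros l v Hk Hl Hw Hv Z.
  - simpl. ring.
  - simpl Dn at 1.
    rewrite (green_step (m + k) l (Dn m w) v); try lia; auto.
    + rewrite (IH (S l) (D v)); try lia; auto.
      * assert (Z0 := Z 0%nat ltac:(lia)). simpl Dn in Z0 at 2.
        replace (S m - 1 - 0)%nat with m in Z0 by lia. rewrite Z0.
        rewrite Dn_D. simpl. ring.
      * apply jet_D with K; auto; lia.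
      * intros r Hr. rewrite Dn_D.
        replace (m - 1 - r)%nat with (S m - 1 - S r)%nat by lia.
        apply Z; lia.
    + apply damped_jet_Dn with K; auto; lia.
Qed.

(** With [v] vanishing to order [a] and [w] to order [p] at 0, the first [a] and
    the last [p] of the [a + p + 2] integrations by parts contribute nothing; the
    two in the middle give the boundary terms. *)
Lemma green_two_terms (a p k l : nat) (w v : R -> R) :
  (a + (p + 2) + k <= K)%nat -> (a + (p + 2) + l <= K)%nat ->
  damped_jet f k w -> jet g l v ->
  (forall r, (r < p)%nat -> Dn r w 0 = 0) ->
  (forall r, (r < a)%nat -> Dn r v 0 = 0) ->
  int (fun x => Dn (a + (p + 2)) w x * v x)
  = (-1) ^ (a + p) * int (fun x => w x * Dn (a + (p + 2)) v x)
    + (-1) ^ a * (Dn p w 0 * Dn (S a) v 0 - Dn (S p) w 0 * Dn a v 0).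
Proof.
  intros Hk Hl Hw Hv Zw Zv.
  rewrite Dn_add.
  rewrite (green_vanish a (p + 2 + k) l); try lia; auto.
  2:{ apply damped_jet_Dn with K; auto; lia. }
  2:{ intros r Hr. rewrite (Zv r Hr). ring. }
  replace (p + 2)%nat with (S (S p)) by lia. simpl Dn at 1.
  rewrite (green_step (S p + k) (a + l)); try lia.
  2:{ apply (damped_jet_Dn K k (S p)); auto; lia. }
  2:{ apply jet_Dn with K; auto; lia. }
  simpl Dn at 3.
  rewrite (green_step (p + k) (S (a + l))); try lia.
  2:{ apply damped_jet_Dn with K; auto; lia. }
  2:{ apply (jet_Dn K l (S a)); auto; lia. }
  rewrite (green_vanish p k (S (S (a + l)))); try lia; auto.
  2:{ apply (jet_Dn K l (S (S a))); auto; lia. }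
  2:{ intros r Hr. rewrite Zw by lia. ring. }
  change (D (D (Dn a v))) with (Dn (S (S a)) v). rewrite <- Dn_add.
  replace (p + S (S a))%nat with (a + S (S p))%nat by lia.
  rewrite pow_add. simpl Dn. ring.
Qed.

End Green.

Definition taylor (i : nat) (f : R -> R) : R := Dn i f 0 / INR (fact i).

(** Multiplication by a power of [x] shifts Taylor coefficients: this lemma and
    the next state it for the derivatives at 0. *)
Lemma Dn_pow_lt (p r : nat) (h : R -> R) :
  Ck r h -> (r < p)%nat -> Dn r (fun t => t ^ p * h t) 0 = 0.
Proof.
  revert r. induction p as [|p IH]; intros r Hh Hr; [lia|].
  rewrite (Dn_ext r _ (fun t => t * (t ^ p * h t))); [|intros; simpl; ring|lra].
  rewrite Dn_mulx; [| apply Ck_mult; auto using Ck_pow | lra].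
  destruct r as [|r]; [simpl; ring|].
  simpl pred. rewrite (IH r); auto using Ck_pred; [ring | lia].
Qed.

Lemma Dn_pow_add (p r : nat) (h : R -> R) :
  Ck (r + p) h ->
  Dn (r + p) (fun t => t ^ p * h t) 0
  = INR (fact (r + p)) / INR (fact r) * Dn r h 0.
Proof.
  induction p as [|p IH]; intros Hh.
  - rewrite Nat.add_0_r. rewrite (Dn_ext r _ h); [|intros; simpl; ring|lra].
    field. apply INR_fact_neq_0.
  - rewrite Nat.add_succ_r in *.
    rewrite (Dn_ext _ _ (fun t => t * (t ^ p * h t))); [|intros; simpl; ring|lra].
    rewrite Dn_mulx; [| apply Ck_mult; auto using Ck_pow | lra].
    simpl pred. rewrite IH by auto using Ck_pred.
    rewrite fact_simpl, mult_INR. field. apply INR_fact_neq_0.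
Qed.

Lemma damp_pow_ext (p : nat) (h : R -> R) (x : R) :
  damp (fun t => t ^ p * h t) x = x ^ p * damp h x.
Proof. unfold damp. ring. Qed.

Lemma Dn_damp_pow_lt (p r : nat) (h : R -> R) :
  Ck r h -> (r < p)%nat -> Dn r (damp (fun t => t ^ p * h t)) 0 = 0.
Proof.
  intros Hh Hr.
  rewrite (Dn_ext r _ (fun t => t ^ p * damp h t));
    [| intros; apply damp_pow_ext | lra].
  apply Dn_pow_lt; auto using Ck_damp.
Qed.

Lemma Dn_damp_pow_add (p r : nat) (h : R -> R) :
  Ck (r + p) h ->
  Dn (r + p) (damp (fun t => t ^ p * h t)) 0
  = INR (fact (r + p)) / INR (fact r) * Dn r (damp h) 0.
Proof.
  intros Hh.
  rewrite (Dn_ext _ _ (fun t => t ^ p * damp h t));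
    [| intros; apply damp_pow_ext | lra].
  apply Dn_pow_add; auto using Ck_damp.
Qed.

(** Reciprocal factorial, extended by 0 to negative arguments, so that [z]
    times its value at [z] is its value at [z - 1] for every [z]. *)
Definition inv_fact (z : Z) : R :=
  if (z <? 0)%Z then 0 else / INR (fact (Z.to_nat z)).

Lemma inv_fact_neg (z : Z) : (z < 0)%Z -> inv_fact z = 0.
Proof. intros H. unfold inv_fact. now rewrite (proj2 (Z.ltb_lt z 0) H). Qed.

Lemma inv_fact_nat (n : nat) : inv_fact (Z.of_nat n) = / INR (fact n).
Proof.
  unfold inv_fact. destruct (Z.ltb_spec (Z.of_nat n) 0); [lia|].
  now rewrite Nat2Z.id.
Qed.

Lemma inv_fact_pred (z : Z) : inv_fact (z - 1) = IZR z * inv_fact z.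
Proof.
  destruct (Z.lt_trichotomy z 0) as [H|[->|H]].
  - rewrite !inv_fact_neg by lia. ring.
  - simpl. rewrite (inv_fact_neg (-1)) by lia. ring.
  - replace z with (Z.of_nat (S (Z.to_nat (z - 1)))) at 2 3 by lia.
    replace (z - 1)%Z with (Z.of_nat (Z.to_nat (z - 1))) at 1 by lia.
    rewrite !inv_fact_nat, <- INR_IZR_INZ, fact_simpl, mult_INR.
    field. split; [apply INR_fact_neq_0 | apply not_0_INR; lia].
Qed.

Lemma sum_single (u : nat -> R) (d n : nat) :
  (d <= n)%nat -> (forall i, i <> d -> u i = 0) -> sum_f_R0 u n = u d.
Proof.
  intros Hd Z. induction n as [|n IH].
  - replace d with 0%nat by lia. reflexivity.
  - rewrite tech5. destruct (Nat.eq_dec d (S n)) as [->|Hn].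
    + rewrite (sum_eq_R0 u n); [ring|]. intros; apply Z; lia.
    + rewrite IH by lia. rewrite (Z (S n)) by auto. ring.
Qed.

(** The coefficient of the [i]-th Taylor coefficient of [f] in the [r]-th
    derivative at 0 of [e^-x D^(a+d) (x^a f)]. Written with [inv_fact] it is 0
    outside the range [d <= i <= r + d], so that expansions with different [d]
    and [r] can all be summed over one range of [i]. *)
Definition damp_coef (a d r : nat) (i : nat) : R :=
  INR (fact r) * INR (fact (a + i)) * (-1) ^ (r + i + d)
  * inv_fact (Z.of_nat i - Z.of_nat d)
  * inv_fact (Z.of_nat r + Z.of_nat d - Z.of_nat i).

(** Induction on [r] by [Dn_exp]; the step is the relation
    [r + 1 = (i - d) + (r + 1 + d - i)] between the arguments of [inv_fact]. *)
Lemma Dn_damp_expansion (n a d r : nat) (f : R -> R) :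
  Ck (r + (a + d)) f -> (r + d <= n)%nat ->
  Dn r (damp (Dn (a + d) (fun t => t ^ a * f t))) 0
  = sum_f_R0 (fun i => damp_coef a d r i * taylor i f) n.
Proof.
  revert d. induction r as [|r IH]; intros d Hf Hn.
  - rewrite (sum_single _ d); [|lia|].
    2:{ intros i Hi. unfold damp_coef. destruct (Nat.lt_ge_cases i d).
        - rewrite (inv_fact_neg (Z.of_nat i - Z.of_nat d)) by lia. ring.
        - rewrite (inv_fact_neg (Z.of_nat 0 + Z.of_nat d - Z.of_nat i)) by lia.
          ring. }
    simpl Dn. unfold damp. rewrite Ropp_0, exp_0.
    rewrite (Nat.add_comm a d), Dn_pow_add by (rewrite Nat.add_comm; exact Hf).
    unfold damp_coef, taylor. rewrite Z.sub_diag.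
    replace (Z.of_nat 0 + Z.of_nat d - Z.of_nat d)%Z with 0%Z by lia.
    change (inv_fact 0) with (/ INR 1). simpl plus.
    rewrite pow_add, <- Rpow_mult_distr, (Nat.add_comm a d).
    replace (-1 * -1) with 1 by ring. rewrite pow1. simpl. field.
    apply INR_fact_neq_0.
  - assert (Hc : Ck (S r) (Dn (a + d) (fun t => t ^ a * f t))).
    { apply Ck_Dn. apply Ck_mult; [apply Ck_pow|].
      apply Ck_le with (2 := Hf); lia. }
    unfold damp. rewrite Dn_exp by (auto; lra).
    change (D (Dn (a + d) (fun t => t ^ a * f t)))
      with (Dn (S (a + d)) (fun t => t ^ a * f t)).
    replace (S (a + d)) with (a + S d)%nat by lia.
    fold (damp (Dn (a + S d) (fun t => t ^ a * f t))).
    fold (damp (Dn (a + d) (fun t => t ^ a * f t))).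
    rewrite (IH (S d)) by (try lia; apply Ck_le with (2 := Hf); lia).
    rewrite (IH d) by (try lia; apply Ck_le with (2 := Hf); lia).
    rewrite <- minus_sum. apply sum_eq. intros i _.
    unfold damp_coef. rewrite fact_simpl, mult_INR.
    replace (Z.of_nat i - Z.of_nat (S d))%Z
      with (Z.of_nat i - Z.of_nat d - 1)%Z by lia.
    rewrite inv_fact_pred.
    replace (Z.of_nat r + Z.of_nat d - Z.of_nat i)%Z
      with (Z.of_nat (S r) + Z.of_nat d - Z.of_nat i - 1)%Z by lia.
    rewrite inv_fact_pred.
    replace (Z.of_nat r + Z.of_nat (S d) - Z.of_nat i)%Z
      with (Z.of_nat (S r) + Z.of_nat d - Z.of_nat i)%Z by lia.
    replace (r + i + S d)%nat with (S (r + i + d)) by lia.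
    replace (S r + i + d)%nat with (S (r + i + d)) by lia.
    rewrite !minus_IZR, !plus_IZR, <- !INR_IZR_INZ, !S_INR. simpl pow. ring.
Qed.

(** * The operator as a sum of formally self-adjoint pieces *)

Definition weighted (m a p : nat) (c1 c0 : R) (y : R -> R) : R -> R :=
  damp (fun t => t ^ p * ((c1 * t + c0) * Dn m (fun s => s ^ a * y s) t)).

(** All pieces of the operator have this shape, with weight [t^p (c1 t + c0)].
    The letters B, E, F, G, H below refer to the summands of the operator. *)
Definition core (m a p : nat) (c1 c0 : R) (y : R -> R) : R -> R :=
  Dn m (weighted m a p c1 c0 y).

Definition coefB (alpha : nat) : R := (-1) ^ (alpha + 1) / INR (fact (alpha + 2)).
Definition coefT (alpha : nat) : R :=
  (-1) ^ alpha / ((INR alpha + 1) * INR (fact (alpha + 4))).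
Definition coefG (alpha : nat) : R :=
  (INR alpha + 1) * (INR alpha + 3) * (INR alpha + 4).
Definition coefH (alpha j : nat) : R :=
  poch (INR alpha + 3 - INR j) (2 * j) / (INR (fact j) * INR (fact (j + 1)))
  * ((-1) ^ (alpha + j) / ((INR alpha + 1) * INR (fact (alpha + 3 + j)))).

Definition coreB (alpha : nat) := core (alpha + 2) (alpha + 1) 0 0 1.
Definition coreE (alpha : nat) := core (alpha + 1 + (1 + 2)) (alpha + 1) 1 1 0.
Definition coreF (alpha : nat) :=
  core (alpha + 1 + (0 + 2)) (alpha + 1) 0 1 (2 * INR alpha + 4).
Definition coreG (alpha : nat) :=
  core (alpha + (0 + 2)) alpha 0 1 (2 * INR alpha + 4).
Definition coreH (alpha j : nat) :=
  core (alpha + 1 + (j + 2)) (alpha + 1) j 1 (q_coef alpha j).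

(** The pieces carrying a factor [x] in the operator, and the one without. Of
    the two, only the latter contributes to the value of [L y] at 0. *)
Definition partU (alpha : nat) (M N : R) (y : R -> R) (x : R) : R :=
  M * coefB alpha * coreB alpha y x
  + N * coefT alpha * (- (INR alpha + 2) * coreE alpha y x
                       + (INR alpha + 4) * coreF alpha y x)
  + M * N * sum_f_R0 (fun j => coefH alpha j * coreH alpha j y x) (alpha + 2).

Definition partW (alpha : nat) (N : R) (y : R -> R) (x : R) : R :=
  N * coefT alpha * coefG alpha * coreG alpha y x.

Lemma core_ext (m m' a p : nat) (c1 c0 : R) (w : R -> R) (y : R -> R) (x : R) :
  m = m' -> 0 <= x ->
  (forall t, w t = exp (- t) * (t ^ p * ((c1 * t + c0) * Dn m (fun s => s ^ a * y s) t))) ->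
  Dn m w x = core m' a p c1 c0 y x.
Proof. intros <- Hx E. apply Dn_ext; auto. Qed.

Lemma L_sobolev_parts (alpha : nat) (M N : R) (y : R -> R) (x : R) :
  0 <= x ->
  L_sobolev alpha M N y x
  = L_classical alpha y x + exp x * (x * partU alpha M N y x + partW alpha N y x).
Proof.
  intros Hx.
  assert (EB : L_breve alpha y x = coefB alpha * exp x * x * coreB alpha y x).
  { unfold L_breve, coefB, coreB. f_equal.
    apply core_ext; auto. intros; simpl; ring. }
  assert (ET : L_tilde alpha y x = coefT alpha *
    (exp x * x * (- (INR alpha + 2) * coreE alpha y x
                  + (INR alpha + 4) * coreF alpha y x)
     + coefG alpha * exp x * coreG alpha y x)).
  { unfold L_tilde, coefT, coefG, E_op, F_op, G_op, coreE, coreF, coreG.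
    rewrite <- (core_ext (alpha + 4) _ (alpha + 1) 1 1 0
      (fun t => exp (- t) * t ^ 2
              * Dn (alpha + 4) (fun s => s ^ (alpha + 1) * y s) t));
      [| lia | assumption | intros; simpl; ring].
    rewrite <- (core_ext (alpha + 3) _ (alpha + 1) 0 1 (2 * INR alpha + 4)
      (fun t => exp (- t) * (t + 2 * INR alpha + 4)
              * Dn (alpha + 3) (fun s => s ^ (alpha + 1) * y s) t));
      [| lia | assumption | intros; simpl; ring].
    rewrite <- (core_ext (alpha + 2) _ alpha 0 1 (2 * INR alpha + 4)
      (fun t => exp (- t) * (t + 2 * INR alpha + 4)
              * Dn (alpha + 2) (fun s => s ^ alpha * y s) t));
      [| lia | assumption | intros; simpl; ring].
    ring. }
  assert (EH : L_hat alpha y x = exp x * x *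
    sum_f_R0 (fun j => coefH alpha j * coreH alpha j y x) (alpha + 2)).
  { unfold L_hat. rewrite scal_sum. apply sum_eq. intros j _.
    unfold coefH, coreH, H_op.
    rewrite <- (core_ext (alpha + 3 + j) _ (alpha + 1) j 1 (q_coef alpha j)
      (fun t => exp (- t) * t ^ j * (t + q_coef alpha j)
              * Dn (alpha + 3 + j) (fun s => s ^ (alpha + 1) * y s) t));
      [| lia | assumption | intros; simpl; ring].
    ring. }
  unfold L_sobolev, partU, partW. rewrite EB, ET, EH. ring.
Qed.

Lemma Dn_damp_lin (r : nat) (c1 c0 : R) (h : R -> R) :
  Ck (S r) h ->
  Dn (S r) (damp (fun t => (c1 * t + c0) * h t)) 0
  = c1 * (INR (S r) * Dn r (damp h) 0) + c0 * Dn (S r) (damp h) 0.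
Proof.
  intros Hh. pose proof (Ck_damp _ _ Hh) as Hd.
  rewrite (Dn_ext _ _ (fun t => c1 * (t * damp h t) + c0 * damp h t));
    [| intros; unfold damp; ring | lra].
  rewrite Dn_plus, !Dn_scal, Dn_mulx;
    auto using Ck_mult, Ck_id, Ck_const, Rle_refl.
  simpl pred. ring.
Qed.

Lemma damp_0 (h : R -> R) : damp h 0 = h 0.
Proof. unfold damp. rewrite Ropp_0, exp_0. ring. Qed.

Lemma Dn1_damp_0 (h : R -> R) : Ck 1 h -> Dn 1 (damp h) 0 = Dn 1 h 0 - h 0.
Proof.
  intros H. unfold damp. rewrite Dn_exp by (auto; lra).
  change (damp (D h) 0 - damp h 0 = Dn 1 h 0 - h 0).
  now rewrite !damp_0.
Qed.

Lemma Ck_weight (k p m a : nat) (c1 c0 : R) (f : R -> R) :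
  Ck (m + k) f ->
  Ck k (fun t => t ^ p * ((c1 * t + c0) * Dn m (fun s => s ^ a * f s) t)).
Proof.
  intros Hf. apply Ck_mult; [apply Ck_pow|]. apply Ck_mult.
  - apply Ck_plus; auto using Ck_mult, Ck_const, Ck_id.
  - apply Ck_Dn. apply Ck_mult; auto using Ck_pow.
Qed.

Lemma Ck_core (k m a p : nat) (c1 c0 : R) (f : R -> R) :
  Ck (m + (m + k)) f -> Ck k (core m a p c1 c0 f).
Proof. intros Hf. apply Ck_Dn, Ck_damp, Ck_weight, Hf. Qed.

Lemma Dn_pow_taylor (a d : nat) (f : R -> R) :
  Ck (a + d) f ->
  Dn (a + d) (fun s => s ^ a * f s) 0 = INR (fact (a + d)) * taylor d f.
Proof.
  intros Hf. rewrite Nat.add_comm in *. rewrite Dn_pow_add by auto.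
  unfold taylor. field. apply INR_fact_neq_0.
Qed.

(** This lemma and the next give the derivatives that survive in
    [green_two_terms]: one and two Taylor coefficients of [f], as the power
    [x^a] and the differentiation of order [a + d] shift indices by [d]. *)
Lemma weight_jet_p (a d p : nat) (c1 c0 : R) (f : R -> R) :
  Ck (a + d + p) f ->
  Dn p (damp (fun t => t ^ p * ((c1 * t + c0)
                 * Dn (a + d) (fun s => s ^ a * f s) t))) 0
  = INR (fact p) * (c0 * (INR (fact (a + d)) * taylor d f)).
Proof.
  intros Hf.
  assert (Hd : Ck (a + d) f) by (apply Ck_le with (2 := Hf); lia).
  rewrite <- Dn_pow_taylor by assumption.
  rewrite (Dn_damp_pow_add p 0); [rewrite Nat.add_0_l; simpl (fact 0); simpl Dn at 1|].
  - rewrite damp_0. simpl INR. field.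
  - apply Ck_mult; [auto using Ck_plus, Ck_mult, Ck_const, Ck_id|].
    apply Ck_Dn. apply Ck_mult; auto using Ck_pow.
Qed.

Lemma weight_jet_Sp (a d p : nat) (c1 c0 : R) (f : R -> R) :
  Ck (a + d + S p) f ->
  Dn (S p) (damp (fun t => t ^ p * ((c1 * t + c0)
                 * Dn (a + d) (fun s => s ^ a * f s) t))) 0
  = INR (fact (S p)) *
    (c1 * (INR (fact (a + d)) * taylor d f)
     + c0 * (INR (fact (a + S d)) * taylor (S d) f - INR (fact (a + d)) * taylor d f)).
Proof.
  intros Hf.
  assert (Hd : Ck (a + d + 1) f) by (apply Ck_le with (2 := Hf); lia).
  assert (Hh : Ck 1 (Dn (a + d) (fun s => s ^ a * f s))).
  { apply Ck_Dn. apply Ck_mult; auto using Ck_pow. }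
  rewrite <- !Dn_pow_taylor by (apply Ck_le with (2 := Hd); lia).
  rewrite (Dn_damp_pow_add p 1).
  - rewrite Dn_damp_lin by assumption. rewrite Dn1_damp_0 by assumption.
    rewrite Nat.add_succ_r. simpl Dn. rewrite damp_0. simpl (1 + p)%nat.
    simpl (fact 1). simpl (INR 1). field.
  - apply Ck_mult; [auto using Ck_plus, Ck_mult, Ck_const, Ck_id|].
    apply Ck_Dn. apply Ck_mult; [apply Ck_pow|].
    apply Ck_le with (2 := Hf); lia.
Qed.

(** A derivative at 0 of a weighted piece, of order greater than the order [p] to
    which the weight vanishes: the power [t^p] is a shift, and the remaining
    linear factor combines two of the expansions of [Dn_damp_expansion]. *)
Lemma weighted_expansion (n m a d p s : nat) (c1 c0 : R) (f : R -> R) :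
  m = (a + d)%nat -> Ck (p + S s + m) f -> (S s + d <= n)%nat ->
  Dn (p + S s) (weighted m a p c1 c0 f) 0
  = INR (fact (p + S s)) / INR (fact (S s)) *
    sum_f_R0 (fun i => (c1 * INR (S s) * damp_coef a d s i + c0 * damp_coef a d (S s) i)
                       * taylor i f) n.
Proof.
  intros -> Hf Hn. unfold weighted.
  assert (Hh : Ck (S s + p) (Dn (a + d) (fun t => t ^ a * f t))).
  { apply Ck_Dn. apply Ck_mult; [apply Ck_pow|].
    apply Ck_le with (2 := Hf); lia. }
  rewrite (Nat.add_comm p), Dn_damp_pow_add.
  2:{ apply Ck_mult; auto using Ck_plus, Ck_mult, Ck_const, Ck_id. }
  rewrite Dn_damp_lin by (apply Ck_le with (2 := Hh); lia).
  rewrite (Dn_damp_expansion n) by (try lia; apply Ck_le with (2 := Hf); lia).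
  rewrite (Dn_damp_expansion n) by (try lia; apply Ck_le with (2 := Hf); lia).
  f_equal.
  rewrite !scal_sum, <- plus_sum. apply sum_eq. intros; ring.
Qed.

(** * Integration by parts of the operator *)

Lemma is_int_sum (u : nat -> R -> R) (l : nat -> R) (n : nat) :
  (forall j, (j <= n)%nat -> is_int (u j) (l j)) ->
  is_int (fun x => sum_f_R0 (fun j => u j x) n) (sum_f_R0 l n).
Proof.
  induction n as [|n IH]; intros H; simpl; [auto|].
  apply is_int_plus; auto.
Qed.

Definition energy (m a p : nat) (c1 c0 : R) (f g : R -> R) : R :=
  int (fun x => weighted m a p c1 c0 f x * Dn m (fun s => s ^ a * g s) x).

Lemma energy_sym (m a p : nat) (c1 c0 : R) (f g : R -> R) :
  energy m a p c1 c0 f g = energy m a p c1 c0 g f.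
Proof.
  unfold energy. f_equal. apply functional_extensionality. intros x.
  unfold weighted, damp. ring.
Qed.

(** The coefficients of [g 0] and [g' 0] in the boundary terms of a piece, as
    delivered by [green_two_terms] together with [weight_jet_p] and
    [weight_jet_Sp]. *)
Definition value_coef (a p : nat) (c1 c0 : R) (f : R -> R) : R :=
  - (-1) ^ a * INR (fact a) * INR (fact (S p)) *
    (c1 * (INR (fact (a + (p + 2))) * taylor (p + 2) f)
     + c0 * (INR (fact (a + S (p + 2))) * taylor (S (p + 2)) f
             - INR (fact (a + (p + 2))) * taylor (p + 2) f)).

Definition slope_coef (a p : nat) (c0 : R) (f : R -> R) : R :=
  (-1) ^ a * INR (fact (S a)) * INR (fact p)
  * (c0 * (INR (fact (a + (p + 2))) * taylor (p + 2) f)).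

Lemma Dn_pow_diag (a : nat) (g : R -> R) :
  Ck a g -> Dn a (fun s => s ^ a * g s) 0 = INR (fact a) * g 0.
Proof.
  intros Hg. pose proof (Dn_pow_taylor a 0 g) as H. rewrite Nat.add_0_r in H.
  rewrite H by exact Hg. unfold taylor. simpl. field.
Qed.

Lemma Dn_pow_diag_S (a : nat) (g : R -> R) :
  Ck (S a) g -> Dn (S a) (fun s => s ^ a * g s) 0 = INR (fact (S a)) * D g 0.
Proof.
  intros Hg. pose proof (Dn_pow_taylor a 1 g) as H.
  replace (a + 1)%nat with (S a) in H by lia.
  rewrite H by exact Hg. unfold taylor. simpl. field.
Qed.

Section Pairing.

Variables (K : nat) (f g : R -> R).
Hypothesis (Hf : Ck K f) (Hg : Ck K g) (HI : products_integrable K f g).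

Lemma weighted_damped_jet (m a p : nat) (c1 c0 : R) :
  (m <= K)%nat -> damped_jet f m (weighted m a p c1 c0 f).
Proof.
  intros Hm. apply damped_jet_damp. apply jet_pow.
  assert (H : jet f m (Dn m (fun s => s ^ a * f s))).
  { rewrite <- (Nat.add_0_r m) at 1. apply jet_Dn with K; auto; [lia|].
    apply jet_pow. apply (jet_Dn_f f 0 0). lia. }
  apply jet_ext with (fun t =>
    c1 * (t * Dn m (fun s => s ^ a * f s) t) + c0 * Dn m (fun s => s ^ a * f s) t).
  - intros; ring.
  - apply jet_plus; apply jet_scal; auto using jet_mulx.
Qed.

Lemma pow_jet (a : nat) : jet g 0 (fun s => s ^ a * g s).
Proof. apply jet_pow. apply (jet_Dn_f g 0 0). lia. Qed.

Lemma core_pair_ex (m a b p : nat) (c1 c0 : R) :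
  (m + m <= K)%nat -> ex_int (fun x => core m a p c1 c0 f x * (x ^ b * g x)).
Proof.
  intros Hm. apply (damped_jet_products K (m + m) 0 f g); auto; try lia.
  - apply damped_jet_Dn with K; auto. apply weighted_damped_jet; lia.
  - apply pow_jet.
Qed.

Lemma is_int_core (a p : nat) (c1 c0 : R) :
  (a + (p + 2) + (a + (p + 2)) <= K)%nat ->
  is_int (fun x => core (a + (p + 2)) a p c1 c0 f x * (x ^ a * g x))
    ((-1) ^ (a + p) * energy (a + (p + 2)) a p c1 c0 f g
     + value_coef a p c1 c0 f * g 0 + slope_coef a p c0 f * D g 0).
Proof.
  intros Hm.
  assert (E := core_pair_ex (a + (p + 2)) a a p c1 c0 Hm).
  assert (Hw := weighted_damped_jet (a + (p + 2)) a p c1 c0 ltac:(lia)).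
  apply ex_int_is in E.
  replace (_ + value_coef a p c1 c0 f * g 0 + slope_coef a p c0 f * D g 0) with
    (int (fun x => core (a + (p + 2)) a p c1 c0 f x * (x ^ a * g x))); auto.
  unfold core.
  rewrite (green_two_terms K f g Hf Hg HI a p (a + (p + 2)) 0
             _ (fun x => x ^ a * g x)); auto; try lia.
  - fold (energy (a + (p + 2)) a p c1 c0 f g).
    unfold weighted.
    rewrite weight_jet_p, weight_jet_Sp by (apply Ck_le with (2 := Hf); lia).
    rewrite Dn_pow_diag, Dn_pow_diag_S by (apply Ck_le with (2 := Hg); lia).
    unfold value_coef, slope_coef. ring.
  - apply pow_jet.
  - intros r Hr. apply Dn_damp_pow_lt; auto.
    apply Ck_mult; [auto using Ck_plus, Ck_mult, Ck_const, Ck_id|].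
    apply Ck_Dn. apply Ck_mult; [apply Ck_pow|].
    apply Ck_le with (2 := Hf); lia.
  - intros r Hr. apply Dn_pow_lt; auto. apply Ck_le with (2 := Hg); lia.
Qed.

(** The weight 1 leaves a single boundary term. It is the degenerate case of
    [green_two_terms] where [v = x^(alpha+1) g] is regarded as vanishing only to
    order [alpha]. *)
Lemma is_int_coreB (alpha : nat) :
  (alpha + 2 + (alpha + 2) <= K)%nat ->
  is_int (fun x => coreB alpha f x * (x ^ (alpha + 1) * g x))
    ((-1) ^ alpha * energy (alpha + 2) (alpha + 1) 0 0 1 f g
     + (-1) ^ alpha * INR (fact (alpha + 2)) * INR (fact (alpha + 1))
       * taylor 1 f * g 0).
Proof.
  intros Hm.
  assert (E := core_pair_ex (alpha + 2) (alpha + 1) (alpha + 1) 0 0 1 Hm).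
  assert (Hw := weighted_damped_jet (alpha + 2) (alpha + 1) 0 0 1 ltac:(lia)).
  apply ex_int_is in E. unfold coreB.
  match type of E with is_int _ ?v => match goal with |- is_int _ ?w =>
    replace w with v; [exact E|] end end.
  unfold core.
  change (alpha + 2)%nat with (alpha + (0 + 2))%nat at 1.
  rewrite (green_two_terms K f g Hf Hg HI alpha 0 (alpha + 2) 0
             _ (fun x => x ^ (alpha + 1) * g x)); auto; try lia.
  - simpl (0 + 2)%nat.
    fold (energy (alpha + 2) (alpha + 1) 0 0 1 f g).
    unfold weighted.
    assert (J := weight_jet_p (alpha + 1) 1 0 0 1 f ltac:(apply Ck_le with (2 := Hf); lia)).
    replace (alpha + 1 + 1)%nat with (alpha + 2)%nat in J by lia.
    rewrite J. clear J.
    rewrite (Dn_pow_lt (alpha + 1) alpha) by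
      (try lia; apply Ck_le with (2 := Hg); lia).
    replace (S alpha) with (alpha + 1)%nat by lia.
    rewrite Dn_pow_diag by (apply Ck_le with (2 := Hg); lia).
    rewrite Nat.add_0_r. simpl (fact 0). simpl (INR 1). ring.
  - apply pow_jet.
  - intros r Hr. apply Dn_pow_lt; [|lia]. apply Ck_le with (2 := Hg); lia.
Qed.

Definition energy_classical (alpha : nat) : R :=
  int (fun x => damp (fun t => t ^ (alpha + 1) * D f t) x * D g x).

(** Formal self-adjointness:
    [x^alpha e^-x (x y'' + (alpha + 1 - x) y')] is the derivative of
    [x^(alpha+1) e^-x y']. *)
Lemma is_int_classical (alpha : nat) :
  (2 <= K)%nat ->
  is_int (fun x => L_classical alpha f x * (exp (- x) * (x ^ alpha * g x)))
    (- energy_classical alpha).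
Proof.
  intros HK.
  assert (Hj : jet f 1 (fun t => t ^ (alpha + 1) * D f t)).
  { apply jet_pow. apply (jet_Dn_f f 1 1). lia. }
  assert (Hg0 : jet g 0 g) by (apply (jet_Dn_f g 0 0); lia).
  assert (Cf : Ck 2 f) by (apply Ck_le with K; auto).
  assert (G := green_step K f g Hf Hg HI 1 0 _ g ltac:(lia) ltac:(lia)
                 (damped_jet_damp _ _ _ Hj) Hg0).
  assert (E : ex_int (fun x => D (damp (fun t => t ^ (alpha + 1) * D f t)) x * g x)).
  { apply (damped_jet_products K 2 0 f g); auto; try lia.
    apply (damped_jet_D K 1); auto. now apply damped_jet_damp. }
  apply ex_int_is in E. rewrite G in E. rewrite damp_0 in E.
  rewrite pow_i in E by lia.
  replace (- (0 * D f 0 * g 0) -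
    int (fun x => damp (fun t => t ^ (alpha + 1) * D f t) x * D g x))
    with (- energy_classical alpha) in E by (unfold energy_classical; ring).
  apply is_int_ext with (2 := E). intros x Hx.
  assert (DD : D (damp (fun t => t ^ (alpha + 1) * D f t)) x
    = exp (- x) * x ^ alpha * L_classical alpha f x).
  { apply D_unique; auto. unfold damp.
    replace (exp (- x) * x ^ alpha * L_classical alpha f x) with
      (- exp (- x) * (x ^ (alpha + 1) * D f x)
       + exp (- x) * (INR (alpha + 1) * x ^ pred (alpha + 1) * D f x
                      + x ^ (alpha + 1) * Dn 2 f x)).
    - apply (is_D_mult (fun t => exp (- t)) (fun t => t ^ (alpha + 1) * D f t));
        [apply is_D_exp|].
      apply (is_D_mult (fun t => t ^ (alpha + 1)) (D f) x
               (INR (alpha + 1) * x ^ pred (alpha + 1)) (Dn 2 f x)).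
      + apply is_derive_is_D. auto_derive; auto. ring.
      + exact (Ck_is_D 0 (D f) x (Ck_D _ _ Cf) Hx).
    - unfold L_classical. replace (pred (alpha + 1)) with alpha by lia.
      rewrite plus_INR, pow_add. simpl. ring. }
  rewrite DD. ring.
Qed.

Definition sum_energy (alpha : nat) (M N : R) : R :=
  - energy_classical alpha
  + M * coefB alpha * ((-1) ^ alpha * energy (alpha + 2) (alpha + 1) 0 0 1 f g)
  + N * coefT alpha *
    (- (INR alpha + 2) * ((-1) ^ (alpha + 1 + 1)
        * energy (alpha + 1 + (1 + 2)) (alpha + 1) 1 1 0 f g)
     + (INR alpha + 4) * ((-1) ^ (alpha + 1 + 0)
        * energy (alpha + 1 + (0 + 2)) (alpha + 1) 0 1 (2 * INR alpha + 4) f g)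
     + coefG alpha * ((-1) ^ (alpha + 0)
        * energy (alpha + (0 + 2)) alpha 0 1 (2 * INR alpha + 4) f g))
  + M * N * sum_f_R0 (fun j => coefH alpha j * ((-1) ^ (alpha + 1 + j)
      * energy (alpha + 1 + (j + 2)) (alpha + 1) j 1 (q_coef alpha j) f g))
      (alpha + 2).

End Pairing.

(** Contributions of the parts in [N] and in [M N] to the boundary terms. *)
Definition tilde_value_coef (alpha : nat) (f : R -> R) : R :=
  coefT alpha *
    (- (INR alpha + 2) * value_coef (alpha + 1) 1 1 0 f
     + (INR alpha + 4) * value_coef (alpha + 1) 0 1 (2 * INR alpha + 4) f
     + coefG alpha * value_coef alpha 0 1 (2 * INR alpha + 4) f).

Definition tilde_slope_coef (alpha : nat) (f : R -> R) : R :=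
  coefT alpha *
    (- (INR alpha + 2) * slope_coef (alpha + 1) 1 0 f
     + (INR alpha + 4) * slope_coef (alpha + 1) 0 (2 * INR alpha + 4) f
     + coefG alpha * slope_coef alpha 0 (2 * INR alpha + 4) f).

Definition hat_value_coef (alpha : nat) (f : R -> R) : R :=
  sum_f_R0 (fun j => coefH alpha j * value_coef (alpha + 1) j 1 (q_coef alpha j) f)
    (alpha + 2).

Definition hat_slope_coef (alpha : nat) (f : R -> R) : R :=
  sum_f_R0 (fun j => coefH alpha j * slope_coef (alpha + 1) j (q_coef alpha j) f)
    (alpha + 2).

Lemma is_int_L (alpha : nat) (M N : R) (f g : R -> R) :
  Ck (4 * alpha + 10) f -> Ck (4 * alpha + 10) g ->
  products_integrable (4 * alpha + 10) f g ->
  is_int (fun x => L_sobolev alpha M N f x * g x * exp (- x) * x ^ alpha)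
    (sum_energy f g alpha M N
     + (M * (coefB alpha * ((-1) ^ alpha * INR (fact (alpha + 2))
              * INR (fact (alpha + 1)) * taylor 1 f))
        + N * tilde_value_coef alpha f + M * N * hat_value_coef alpha f) * g 0
     + (N * tilde_slope_coef alpha f + M * N * hat_slope_coef alpha f) * D g 0).
Proof.
  intros Hf Hg HI.
  pose proof (is_int_classical _ f g Hf Hg HI alpha ltac:(lia)) as Icl.
  pose proof (is_int_coreB _ f g Hf Hg HI alpha ltac:(lia)) as IB.
  pose proof (is_int_core _ f g Hf Hg HI (alpha + 1) 1 1 0 ltac:(lia)) as IE.
  pose proof (is_int_core _ f g Hf Hg HI (alpha + 1) 0 1 (2 * INR alpha + 4)
                ltac:(lia)) as IF.
  pose proof (is_int_core _ f g Hf Hg HI alpha 0 1 (2 * INR alpha + 4)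
                ltac:(lia)) as IG.
  pose proof (is_int_sum _ _ (alpha + 2) (fun j Hj => is_int_scal (coefH alpha j) _ _
    (is_int_core _ f g Hf Hg HI (alpha + 1) j 1 (q_coef alpha j) ltac:(lia)))) as IH.
  apply (is_int_scal (M * coefB alpha)) in IB.
  apply (is_int_scal (N * coefT alpha * - (INR alpha + 2))) in IE.
  apply (is_int_scal (N * coefT alpha * (INR alpha + 4))) in IF.
  apply (is_int_scal (N * coefT alpha * coefG alpha)) in IG.
  apply (is_int_scal (M * N)) in IH.
  pose proof (is_int_plus _ _ _ _ Icl (is_int_plus _ _ _ _ IB
    (is_int_plus _ _ _ _ IE (is_int_plus _ _ _ _ IF
       (is_int_plus _ _ _ _ IG IH))))) as I.
  match type of I with is_int _ ?v => match goal with |- is_int _ ?w =>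
    replace w with v end end.
  - apply is_int_ext with (2 := I). intros x Hx.
    rewrite L_sobolev_parts by assumption.
    unfold partU, partW.
    rewrite Rmult_plus_distr_r.
    assert (Ex : exp x * exp (- x) = 1).
    { rewrite <- exp_plus, Rplus_opp_r. apply exp_0. }
    transitivity (L_classical alpha f x * (exp (- x) * (x ^ alpha * g x)) +
      (exp x * exp (- x)) * (x * x ^ alpha * partU alpha M N f x
        + x ^ alpha * partW alpha N f x) * g x).
    2: unfold partU, partW; ring.
    rewrite Ex. unfold partU, partW.
    rewrite (sum_eq _ (fun j => coefH alpha j * coreH alpha j f x
               * (x ^ (alpha + 1) * g x)) (alpha + 2)).
    2: intros; unfold coreH; ring.
    rewrite <- scal_sum.
    replace (x ^ (alpha + 1)) with (x * x ^ alpha)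
      by (rewrite Nat.add_1_r; reflexivity).
    unfold coreE, coreF, coreG. ring.
  - unfold sum_energy, tilde_value_coef, tilde_slope_coef, hat_value_coef, hat_slope_coef.
    match goal with |- context [sum_f_R0 ?h (alpha + 2)] =>
      match h with context [energy] => match h with context [value_coef] =>
      replace (sum_f_R0 h (alpha + 2)) with
        (sum_f_R0 (fun j => coefH alpha j * ((-1) ^ (alpha + 1 + j)
           * energy (alpha + 1 + (j + 2)) (alpha + 1) j 1 (q_coef alpha j) f g))
           (alpha + 2)
         + sum_f_R0 (fun j =>
             coefH alpha j * value_coef (alpha + 1) j 1 (q_coef alpha j) f)
             (alpha + 2) * g 0
         + sum_f_R0 (fun j =>
             coefH alpha j * slope_coef (alpha + 1) j (q_coef alpha j) f)
             (alpha + 2) * D g 0)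
      end end end.
    + ring.
    + rewrite !(Rmult_comm (sum_f_R0 _ _)), !scal_sum, <- !plus_sum.
      apply sum_eq. intros; ring.
Qed.

Lemma sum_energy_sym (alpha : nat) (M N : R) (f g : R -> R) :
  sum_energy f g alpha M N = sum_energy g f alpha M N.
Proof.
  unfold sum_energy.
  assert (E : energy_classical f g alpha = energy_classical g f alpha).
  { unfold energy_classical. f_equal. apply functional_extensionality.
    intros x. unfold damp. ring. }
  rewrite E, !(energy_sym _ _ _ _ _ f g). f_equal. f_equal.
  apply sum_eq. intros j _. now rewrite (energy_sym _ _ _ _ _ f g).
Qed.

(** * Identities between the boundary terms at 0 *)

(* Generalizes factorials and casts, keeping the facts that [field] needs about
   denominators. *)
Ltac atoms :=
  repeat match goal with
  | |- context [inv_fact ?z] => generalize (inv_fact z); intro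
  | |- context [INR (fact ?n)] =>
      generalize (INR_fact_neq_0 n); generalize (INR (fact n)); intros ? ?
  | |- context [INR ?n] =>
      generalize (pos_INR n); generalize (INR n); intros ? ?
  end.

Lemma poch_fact (k n : nat) : poch (INR k + 1) n * INR (fact k) = INR (fact (k + n)).
Proof.
  induction n as [|n IH]; simpl poch.
  - rewrite Nat.add_0_r. ring.
  - rewrite Nat.add_succ_r, fact_simpl, mult_INR, <- IH, S_INR, plus_INR. ring.
Qed.

(** [(alpha + 3 - j)_(2 j) / j!], in a form that vanishes for [j > alpha + 2]; this
    is what closes the telescoping sums at their upper end. *)
Definition hat_weight (alpha j : nat) : R :=
  INR (fact (alpha + 2 + j)) * inv_fact (Z.of_nat alpha + 2 - Z.of_nat j)
  / INR (fact j).

Lemma hat_weight_S (alpha j : nat) :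
  hat_weight alpha (S j) * (INR j + 1)
  = (INR alpha + 3 + INR j) * (INR alpha + 2 - INR j) * hat_weight alpha j.
Proof.
  unfold hat_weight.
  replace (Z.of_nat alpha + 2 - Z.of_nat (S j))%Z
    with (Z.of_nat alpha + 2 - Z.of_nat j - 1)%Z by lia.
  rewrite inv_fact_pred, minus_IZR, plus_IZR, <- !INR_IZR_INZ.
  replace (alpha + 2 + S j)%nat with (S (alpha + 2 + j)) by lia.
  rewrite !fact_simpl, !mult_INR, !S_INR, !plus_INR. simpl (INR 2).
  cbn [INR]. atoms. field; lra.
Qed.

Lemma coefH_weight (alpha j : nat) :
  (j <= alpha + 2)%nat ->
  coefH alpha j
  = (-1) ^ (alpha + j) * hat_weight alpha j
    / (INR (fact (S j)) * (INR alpha + 1) * INR (fact (alpha + 3 + j))).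
Proof.
  intros Hj. unfold coefH, hat_weight.
  pose proof (poch_fact (alpha + 2 - j) (2 * j)) as P.
  rewrite minus_INR, plus_INR in P by lia. simpl (INR 2) in P.
  replace (INR alpha + (1 + 1) - INR j + 1) with (INR alpha + 3 - INR j) in P by ring.
  replace (alpha + 2 - j + 2 * j)%nat with (alpha + 2 + j)%nat in P by lia.
  rewrite <- P.
  replace (Z.of_nat alpha + 2 - Z.of_nat j)%Z
    with (Z.of_nat (alpha + 2 - j)) by lia.
  rewrite inv_fact_nat, Nat.add_1_r. pose proof (pos_INR alpha).
  field; repeat split; try apply INR_fact_neq_0; lra.
Qed.

Lemma sum_shift2 (u : nat -> R) (n : nat) :
  sum_f_R0 u (S (S n)) = u 0%nat + u 1%nat + sum_f_R0 (fun j => u (S (S j))) n.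
Proof.
  rewrite (decomp_sum u) by lia. simpl pred.
  rewrite (decomp_sum (fun i => u (S i))) by lia. simpl pred. ring.
Qed.

Lemma sum_telescope (V : nat -> R) (n : nat) :
  sum_f_R0 (fun j => V (S j) - V j) n = V (S n) - V 0%nat.
Proof. induction n as [|n IH]; simpl; [ring | rewrite IH; ring]. Qed.

Lemma sign_sqr (n : nat) : (-1) ^ n = 1 \/ (-1) ^ n = -1.
Proof. induction n as [|n [IH|IH]]; simpl; rewrite ?IH; lra. Qed.

Lemma damp_coef_lt (a d r i : nat) : (i < d)%nat -> damp_coef a d r i = 0.
Proof.
  intros H. unfold damp_coef. rewrite (inv_fact_neg (Z.of_nat i - Z.of_nat d)) by lia.
  ring.
Qed.

(* Expands successors and sums inside factorials, casts and powers. *)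
Ltac norm_nat :=
  repeat (rewrite Nat.add_succ_r || rewrite Nat.add_0_r || rewrite Nat.add_succ_l
          || rewrite Nat.add_0_l);
  rewrite ?fact_simpl, ?mult_INR; rewrite ?S_INR, ?plus_INR;
  cbn [pow fact INR]; rewrite ?pow_add.

Lemma tilde_value_coef_vanish (alpha : nat) (f : R -> R) : tilde_value_coef alpha f = 0.
Proof.
  unfold tilde_value_coef, value_coef, coefG. norm_nat. ring.
Qed.

Lemma tilde_slope_coef_eq (alpha : nat) (f : R -> R) :
  tilde_slope_coef alpha f = - INR (fact alpha) * (2 * (INR alpha + 2) * taylor 2 f).
Proof.
  unfold tilde_slope_coef, slope_coef, coefG, coefT. norm_nat.
  pose proof (pos_INR alpha). 
  destruct (sign_sqr alpha) as [-> | ->]; field;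
    repeat split; try apply INR_fact_neq_0; lra.
Qed.
(** The part of order [2 alpha + 8] contributes nothing to [(L f)' 0]: each Taylor
    coefficient of [f] enters with total weight 0. *)
Lemma tilde_deriv_vanish (alpha : nat) (f : R -> R) :
  Ck (4 * alpha + 10) f ->
  - (INR alpha + 2) * coreE alpha f 0 + (INR alpha + 4) * coreF alpha f 0
  + coefG alpha * (D (coreG alpha f) 0 + coreG alpha f 0) = 0.
Proof.
  intros Hf.
  assert (EE := weighted_expansion (alpha + 6) (alpha + 1 + (1 + 2)) (alpha + 1)
    3 1 (alpha + 2) 1 0 f ltac:(lia) ltac:(apply Ck_le with (2 := Hf); lia) ltac:(lia)).
  assert (EF := weighted_expansion (alpha + 6) (alpha + 1 + (0 + 2)) (alpha + 1)
    2 0 (alpha + 2) 1 (2 * INR alpha + 4) f ltac:(lia)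
    ltac:(apply Ck_le with (2 := Hf); lia) ltac:(lia)).
  assert (EG := weighted_expansion (alpha + 6) (alpha + (0 + 2)) alpha
    2 0 (alpha + 1) 1 (2 * INR alpha + 4) f ltac:(lia)
    ltac:(apply Ck_le with (2 := Hf); lia) ltac:(lia)).
  assert (EG' := weighted_expansion (alpha + 6) (alpha + (0 + 2)) alpha
    2 0 (alpha + 2) 1 (2 * INR alpha + 4) f ltac:(lia)
    ltac:(apply Ck_le with (2 := Hf); lia) ltac:(lia)).
  replace (1 + S (alpha + 2))%nat with (alpha + 1 + (1 + 2))%nat in EE by lia.
  replace (0 + S (alpha + 2))%nat with (alpha + 1 + (0 + 2))%nat in EF by lia.
  replace (0 + S (alpha + 1))%nat with (alpha + (0 + 2))%nat in EG by lia.
  replace (0 + S (alpha + 2))%nat with (S (alpha + (0 + 2)))%nat in EG' by lia.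
  unfold coreE, coreF, coreG.
  unfold core. rewrite EE, EF, EG.
  change (D (Dn (alpha + (0 + 2)) (weighted (alpha + (0 + 2)) alpha 0 1
           (2 * INR alpha + 4) f)) 0)
    with (Dn (S (alpha + (0 + 2))) (weighted (alpha + (0 + 2)) alpha 0 1
           (2 * INR alpha + 4) f) 0).
  rewrite EG'. clear EE EF EG EG'.
  rewrite !scal_sum, <- !plus_sum, !scal_sum, <- !plus_sum.
  apply sum_eq_R0. intros i Hi. unfold damp_coef, coefG.
  set (X := inv_fact (Z.of_nat i - Z.of_nat 2)).
  set (Y := inv_fact (Z.of_nat alpha + 5 - Z.of_nat i)).
  assert (E1 : inv_fact (Z.of_nat i - Z.of_nat 3) = (INR i - 2) * X).
  { replace (Z.of_nat i - Z.of_nat 3)%Z with (Z.of_nat i - Z.of_nat 2 - 1)%Z by lia.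
    rewrite inv_fact_pred, minus_IZR, <- !INR_IZR_INZ. reflexivity. }
  assert (E2 : inv_fact (Z.of_nat alpha + 4 - Z.of_nat i) = (INR alpha + 5 - INR i) * Y).
  { replace (Z.of_nat alpha + 4 - Z.of_nat i)%Z
      with (Z.of_nat alpha + 5 - Z.of_nat i - 1)%Z by lia.
    rewrite inv_fact_pred, minus_IZR, plus_IZR, <- !INR_IZR_INZ. reflexivity. }
  assert (E3 : inv_fact (Z.of_nat alpha + 3 - Z.of_nat i)
               = (INR alpha + 4 - INR i) * ((INR alpha + 5 - INR i) * Y)).
  { replace (Z.of_nat alpha + 3 - Z.of_nat i)%Z
      with (Z.of_nat alpha + 4 - Z.of_nat i - 1)%Z by lia.
    rewrite inv_fact_pred, E2, minus_IZR, plus_IZR, <- !INR_IZR_INZ. reflexivity. }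
  replace (Z.of_nat (alpha + 2) + Z.of_nat 3 - Z.of_nat i)%Z
    with (Z.of_nat alpha + 5 - Z.of_nat i)%Z by lia.
  replace (Z.of_nat (alpha + 2) + Z.of_nat 2 - Z.of_nat i)%Z
    with (Z.of_nat alpha + 4 - Z.of_nat i)%Z by lia.
  replace (Z.of_nat (S (alpha + 2)) + Z.of_nat 2 - Z.of_nat i)%Z
    with (Z.of_nat alpha + 5 - Z.of_nat i)%Z by lia.
  replace (Z.of_nat (S (alpha + 1)) + Z.of_nat 2 - Z.of_nat i)%Z
    with (Z.of_nat alpha + 4 - Z.of_nat i)%Z by lia.
  replace (Z.of_nat (alpha + 1) + Z.of_nat 2 - Z.of_nat i)%Z
    with (Z.of_nat alpha + 3 - Z.of_nat i)%Z by lia.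
  replace (alpha + 1 + i)%nat with (S (alpha + i)) by lia.
  fold X Y. rewrite E1, E2, E3.
  rewrite !pow_add. norm_nat.
  generalize (taylor i f). intros t.
  generalize X, Y. clear. intros X Y.
  generalize ((-1) ^ alpha), ((-1) ^ i). intros s1 s2. atoms.
  field; repeat split; auto; lra.
Qed.

(** The terms [j - 1] and [j] of the order [4 alpha + 10] part both involve the
    Taylor coefficient of index [j + 2]. Together with the corresponding term of
    the value at 0 of the piece G they leave the difference of consecutive
    values of [V], which is 0 at both ends of the range. *)
Lemma hat_value_coef_eq (alpha : nat) (f : R -> R) :
  Ck (4 * alpha + 10) f ->
  hat_value_coef alpha f
  = - INR (fact alpha) * (coefT alpha * coefG alpha * coreG alpha f 0).
Proof.
  intros Hf.
  assert (EG := weighted_expansion (S (S (alpha + 2))) (alpha + (0 + 2)) alpha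
    2 0 (alpha + 1) 1 (2 * INR alpha + 4) f ltac:(lia)
    ltac:(apply Ck_le with (2 := Hf); lia) ltac:(lia)).
  replace (0 + S (alpha + 1))%nat with (alpha + (0 + 2))%nat in EG by lia.
  unfold coreG, core. rewrite EG. clear EG.
  rewrite sum_shift2.
  rewrite !damp_coef_lt by lia.
  set (V := fun j => - INR (fact alpha) * ((-1) ^ j * INR j * (INR alpha + 3 + INR j)
              / (INR alpha + 2) * hat_weight alpha j * taylor (S (S j)) f)).
  assert (Z : sum_f_R0 (fun j => V (S j) - V j) (alpha + 2) = 0).
  { rewrite sum_telescope. unfold V, hat_weight.
    rewrite (inv_fact_neg (Z.of_nat alpha + 2 - Z.of_nat (S (alpha + 2)))) by lia.
    change (INR 0) with 0. unfold Rdiv. ring. }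
  match goal with |- ?a = ?b => cut (a - b = 0); [lra|] end.
  transitivity (sum_f_R0 (fun j => V (S j) - V j) (alpha + 2)); [|exact Z].
  unfold hat_value_coef.
  match goal with |- _ - ?c * (?d * (?e * (?z + ?s))) = _ =>
    replace (c * (d * (e * (z + s)))) with (c * d * e * s) by ring end.
  rewrite scal_sum, <- minus_sum. apply sum_eq. intros j Hj.
  unfold V. rewrite coefH_weight by assumption.
  assert (W := hat_weight_S alpha j).
  assert (WS : hat_weight alpha (S j) =
    (INR alpha + 3 + INR j) * (INR alpha + 2 - INR j) * hat_weight alpha j
    / (INR j + 1)).
  { rewrite <- W. field. pose proof (pos_INR j). lra. }
  rewrite WS. clear W WS.
  unfold damp_coef, value_coef, coefT, coefG, q_coef, hat_weight.
  replace (Z.of_nat (alpha + 1) + Z.of_nat 2 - Z.of_nat (S (S j)))%Z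
    with (Z.of_nat alpha + 2 - Z.of_nat j - 1)%Z by lia.
  replace (Z.of_nat (S (alpha + 1)) + Z.of_nat 2 - Z.of_nat (S (S j)))%Z
    with (Z.of_nat alpha + 2 - Z.of_nat j)%Z by lia.
  replace (Z.of_nat (S (S j)) - Z.of_nat 2)%Z with (Z.of_nat j) by lia.
  rewrite inv_fact_pred, minus_IZR, plus_IZR, <- !INR_IZR_INZ, inv_fact_nat.
  replace (j + 2)%nat with (S (S j)) by lia.
  rewrite !pow_add. norm_nat. 
  generalize (taylor (S (S j)) f), (taylor (S (S (S j))) f). intros t1 t2.
  destruct (sign_sqr alpha) as [-> | ->], (sign_sqr j) as [-> | ->];
  clear; atoms; field; repeat split; auto; lra.
Qed.

(** Here the terms correspond one to one; the first derivative of [f], the only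
    Taylor coefficient without a partner, is left over. *)
Lemma hat_slope_coef_eq (alpha : nat) (f : R -> R) :
  Ck (4 * alpha + 10) f ->
  hat_slope_coef alpha f
  = INR (fact alpha) *
    (coefB alpha * (damp_coef (alpha + 1) 1 (alpha + 2) 1 * taylor 1 f)
     - coefB alpha * coreB alpha f 0).
Proof.
  intros Hf.
  assert (EB := weighted_expansion (S (S (alpha + 2))) (alpha + 2) (alpha + 1)
    1 0 (alpha + 1) 0 1 f ltac:(lia)
    ltac:(apply Ck_le with (2 := Hf); lia) ltac:(lia)).
  replace (0 + S (alpha + 1))%nat with (alpha + 2)%nat in EB by lia.
  unfold coreB, core. rewrite EB. clear EB.
  rewrite sum_shift2.
  rewrite !(damp_coef_lt _ _ _ 0) by lia.
  replace (S (alpha + 1)) with (alpha + 2)%nat by lia.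
  match goal with |- ?a = ?b => cut (a - b = 0); [lra|] end.
  unfold hat_slope_coef.
  match goal with |- ?h - ?c * (?d * (?k * ?t) - ?d * (?e * (_ + _ + ?s))) = _ =>
    transitivity (h + c * d * e * s);
      [field; apply INR_fact_neq_0|] end.
  rewrite scal_sum, <- plus_sum. apply sum_eq_R0. intros j Hj.
  rewrite coefH_weight by assumption.
  unfold damp_coef, slope_coef, coefB, q_coef, hat_weight.
  replace (Z.of_nat (alpha + 2) + Z.of_nat 1 - Z.of_nat (S (S j)))%Z
    with (Z.of_nat alpha + 2 - Z.of_nat j - 1)%Z by lia.
  replace (Z.of_nat (S (S j)) - Z.of_nat 1)%Z with (Z.of_nat (S j)) by lia.
  rewrite inv_fact_pred, minus_IZR, plus_IZR, <- !INR_IZR_INZ, inv_fact_nat.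
  replace (j + 2)%nat with (S (S j)) by lia.
  rewrite !pow_add. norm_nat.
  generalize (taylor (S (S j)) f). intros t1.
  destruct (sign_sqr alpha) as [-> | ->], (sign_sqr j) as [-> | ->];
  clear; atoms; field; repeat split; auto; lra.
Qed.

Lemma sum_f_R0_switch (u : nat -> nat -> R) (m n : nat) :
  sum_f_R0 (fun i => sum_f_R0 (u i) n) m
  = sum_f_R0 (fun j => sum_f_R0 (fun i => u i j) m) n.
Proof.
  induction m as [|m IH]; simpl; [reflexivity|].
  rewrite IH, <- plus_sum. reflexivity.
Qed.

(** The coefficient of the [i]-th Taylor coefficient in the contribution to
    [(L f)' 0] of the order [4 alpha + 10] part is a sum over [j]. This is its
    summand, up to factors that do not depend on [j] and up to the linear factor
    that appears in [hat_term_sum]. *)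
Definition hat_term (alpha i j : nat) : R :=
  hat_weight alpha j / INR (fact (S j))
  * inv_fact (Z.of_nat i - 2 - Z.of_nat j)
  * inv_fact (Z.of_nat alpha + 5 + Z.of_nat j - Z.of_nat i).

(** The closed form comes from Gosper summation; it is 0 for [n = alpha + 2]. *)
Lemma hat_term_sum (alpha i n : nat) :
  sum_f_R0 (fun j => hat_term alpha i j
     * (INR alpha + 5 + INR j - INR i - q_coef alpha j)) n
  = - (INR alpha + 3 + INR n) * (INR alpha + 2 - INR n) * (INR i - 2 - INR n)
    / ((INR alpha + 2) * (INR alpha + 3)) * hat_term alpha i n.
Proof.
  induction n as [|n IH].
  - simpl sum_f_R0. unfold q_coef. simpl INR. pose proof (pos_INR alpha). field. lra.
  - rewrite tech5, IH. unfold hat_term.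
    assert (W := hat_weight_S alpha n).
    assert (WS : hat_weight alpha (S n) =
      (INR alpha + 3 + INR n) * (INR alpha + 2 - INR n) * hat_weight alpha n
      / (INR n + 1)).
    { rewrite <- W. field. pose proof (pos_INR n). lra. }
    rewrite WS. clear IH W WS.
    replace (Z.of_nat i - 2 - Z.of_nat (S n))%Z
      with (Z.of_nat i - 2 - Z.of_nat n - 1)%Z by lia.
    replace (Z.of_nat alpha + 5 + Z.of_nat n - Z.of_nat i)%Z
      with (Z.of_nat alpha + 5 + Z.of_nat (S n) - Z.of_nat i - 1)%Z by lia.
    rewrite !inv_fact_pred, !minus_IZR, !plus_IZR, <- !INR_IZR_INZ.
    unfold q_coef. norm_nat. generalize (hat_weight alpha n). intros w.
    atoms. field; repeat split; auto; lra.
Qed.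

(** After exchanging the two sums, the sum over [j] is that of [hat_term_sum]. *)
Lemma hat_deriv_vanish (alpha : nat) (f : R -> R) :
  Ck (4 * alpha + 10) f ->
  sum_f_R0 (fun j => coefH alpha j * coreH alpha j f 0) (alpha + 2) = 0.
Proof.
  intros Hf.
  (* The largest index occurs for [j = alpha + 2]: it is [(alpha + 3) + (j + 2)]. *)
  transitivity (sum_f_R0 (fun j => sum_f_R0 (fun i =>
     (-1) ^ i * INR (fact (alpha + 1 + i)) / (INR alpha + 1) * taylor i f
     * (hat_term alpha i j * (INR alpha + 5 + INR j - INR i - q_coef alpha j)))
     (2 * alpha + 7)) (alpha + 2)).
  - apply sum_eq. intros j Hj.
    assert (E := weighted_expansion (2 * alpha + 7) (alpha + 1 + (j + 2)) (alpha + 1)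
      (j + 2) j (alpha + 2) 1 (q_coef alpha j) f ltac:(lia)
      ltac:(apply Ck_le with (2 := Hf); lia) ltac:(lia)).
    replace (j + S (alpha + 2))%nat with (alpha + 1 + (j + 2))%nat in E by lia.
    unfold coreH, core. rewrite E. clear E.
    rewrite coefH_weight by assumption.
    rewrite !scal_sum. apply sum_eq. intros i _.
    unfold damp_coef, hat_term.
    replace (Z.of_nat (alpha + 2) + Z.of_nat (j + 2) - Z.of_nat i)%Z
      with (Z.of_nat alpha + 5 + Z.of_nat j - Z.of_nat i - 1)%Z by lia.
    replace (Z.of_nat (S (alpha + 2)) + Z.of_nat (j + 2) - Z.of_nat i)%Z
      with (Z.of_nat alpha + 5 + Z.of_nat j - Z.of_nat i)%Z by lia.
    replace (Z.of_nat i - Z.of_nat (j + 2))%Z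
      with (Z.of_nat i - 2 - Z.of_nat j)%Z by lia.
    rewrite inv_fact_pred, minus_IZR, !plus_IZR, <- !INR_IZR_INZ.
    replace (alpha + 1 + i)%nat with (S (alpha + i)) by lia.
    replace (alpha + 1 + (j + 2))%nat with (S (S (S (alpha + j)))) by lia.
    replace (alpha + 3 + j)%nat with (S (S (S (alpha + j)))) by lia.
    rewrite !pow_add. norm_nat.
    generalize (taylor i f), (q_coef alpha j), (hat_weight alpha j). intros t q w.
    destruct (sign_sqr alpha) as [-> | ->], (sign_sqr j) as [-> | ->];
      generalize ((-1) ^ i); intros sg;
      clear; atoms; field; repeat split; auto; lra.
  - rewrite sum_f_R0_switch. apply sum_eq_R0. intros i _.
    rewrite <- (sum_eq (fun j =>
      (hat_term alpha i j * (INR alpha + 5 + INR j - INR i - q_coef alpha j))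
      * ((-1) ^ i * INR (fact (alpha + 1 + i)) / (INR alpha + 1) * taylor i f)))
      by (intros; ring).
    rewrite <- scal_sum, hat_term_sum.
    rewrite plus_INR. simpl (INR 2). pose proof (pos_INR alpha).
    field. lra.
Qed.

(** * Symmetry of the operator *)

Lemma L_sobolev_0 (alpha : nat) (M N : R) (f : R -> R) :
  L_sobolev alpha M N f 0 = (INR alpha + 1) * taylor 1 f + partW alpha N f 0.
Proof.
  rewrite L_sobolev_parts by lra. unfold L_classical, taylor. rewrite exp_0.
  simpl (fact 1). simpl (INR 1). field.
Qed.

Lemma contH_sum (u : nat -> R -> R) (n : nat) :
  (forall j, (j <= n)%nat -> contH (u j)) ->
  contH (fun x => sum_f_R0 (fun j => u j x) n).
Proof.
  induction n as [|n IH]; intros H; simpl; [now apply (H 0%nat)|].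
  apply contH_plus; auto.
Qed.

Lemma partU_contH (alpha : nat) (M N : R) (f : R -> R) :
  Ck (4 * alpha + 10) f -> contH (partU alpha M N f).
Proof.
  intros Hf. unfold partU, coreB, coreE, coreF, coreH.
  assert (C : forall m a p c1 c0, (m <= 2 * alpha + 5)%nat ->
            contH (core m a p c1 c0 f)).
  { intros m a p c1 c0 Hm. apply (Ck_contH 0), Ck_core.
    apply Ck_le with (2 := Hf). lia. }
  repeat apply contH_plus.
  - apply contH_mult; [apply contH_const | apply C; lia].
  - apply contH_mult; [apply contH_const|].
    apply contH_plus; apply contH_mult; try apply contH_const; apply C; lia.
  - apply contH_mult; [apply contH_const|]. apply contH_sum. intros j Hj.
    apply contH_mult; [apply contH_const|]. apply C; lia.
Qed.

Lemma D_L_sobolev_0 (alpha : nat) (M N : R) (f : R -> R) :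
  Ck (4 * alpha + 10) f ->
  D (L_sobolev alpha M N f) 0
  = 2 * (INR alpha + 2) * taylor 2 f - taylor 1 f + partU alpha M N f 0
    + (D (partW alpha N f) 0 + partW alpha N f 0).
Proof.
  intros Hf.
  assert (CU := partU_contH alpha M N f Hf).
  assert (Cf : Ck 3 f) by (apply Ck_le with (2 := Hf); lia).
  assert (CW : Ck 1 (partW alpha N f)).
  { unfold partW. apply Ck_scal. apply Ck_core. apply Ck_le with (2 := Hf). lia. }
  apply D_unique; [lra|].
  apply is_D_ext with (fun x =>
    (x * Dn 2 f x + (INR alpha + 1 + (-1) * x) * Dn 1 f x)
    + exp x * (x * partU alpha M N f x + partW alpha N f x)).
  { intros x Hx. rewrite L_sobolev_parts by assumption.
    unfold L_classical. ring. }
  { lra. }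
  replace (2 * (INR alpha + 2) * taylor 2 f - taylor 1 f + partU alpha M N f 0
    + (D (partW alpha N f) 0 + partW alpha N f 0)) with
    ((Dn 2 f 0 + ((0 + (-1) * 1) * Dn 1 f 0
                  + (INR alpha + 1 + (-1) * 0) * Dn 2 f 0))
     + (exp 0 * (0 * partU alpha M N f 0 + partW alpha N f 0)
        + exp 0 * (partU alpha M N f 0 + D (partW alpha N f) 0))).
  2:{ rewrite exp_0. unfold taylor. simpl (fact 1). simpl (fact 2). simpl (INR 1).
      simpl (INR 2). field. }
  apply is_D_plus.
  - apply is_D_plus.
    + apply is_D_mulx_0. apply (Ck_contH 1). exact (Ck_D _ _ (Ck_D _ _ Cf)).
    + apply (is_D_mult (fun x => INR alpha + 1 + (-1) * x) (Dn 1 f)).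
      * apply is_D_plus; [apply is_D_const | apply is_D_scal, is_D_id].
      * exact (Ck_is_D 1 (D f) 0 (Ck_D _ _ Cf) (Rle_refl 0)).
  - apply (is_D_mult exp
             (fun x => x * partU alpha M N f x + partW alpha N f x)).
    + apply is_derive_is_D. auto_derive; auto; ring.
    + apply is_D_plus; [now apply is_D_mulx_0|].
      apply Ck_is_D with 0%nat; auto. lra.
Qed.

(** What remains of the boundary terms: [(L f, g)] contains
    [slope_factor * f' 0 * g' 0], which is symmetric. *)
Definition slope_factor (alpha : nat) (M N : R) : R :=
  M * N * coefB alpha * damp_coef (alpha + 1) 1 (alpha + 2) 1 - N.

Lemma value_terms_cancel (alpha : nat) (M N : R) (f : R -> R) :
  Ck (4 * alpha + 10) f ->
  / INR (fact alpha) *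
    (M * (coefB alpha * ((-1) ^ alpha * INR (fact (alpha + 2))
                         * INR (fact (alpha + 1)) * taylor 1 f))
     + N * tilde_value_coef alpha f + M * N * hat_value_coef alpha f)
  + M * L_sobolev alpha M N f 0 = 0.
Proof.
  intros Hf. rewrite L_sobolev_0, tilde_value_coef_vanish, hat_value_coef_eq by exact Hf.
  unfold partW, coefB.
  replace (alpha + 1)%nat with (S alpha) by lia.
  rewrite fact_simpl, mult_INR, S_INR. simpl pow.
  pose proof (INR_fact_neq_0 alpha). pose proof (INR_fact_neq_0 (alpha + 2)).
  destruct (sign_sqr alpha) as [-> | ->]; field; auto.
Qed.

Lemma slope_terms_sum (alpha : nat) (M N : R) (f : R -> R) :
  Ck (4 * alpha + 10) f ->
  / INR (fact alpha) * (N * tilde_slope_coef alpha f + M * N * hat_slope_coef alpha f)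
  + N * D (L_sobolev alpha M N f) 0
  = slope_factor alpha M N * D f 0.
Proof.
  intros Hf. rewrite D_L_sobolev_0, tilde_slope_coef_eq, hat_slope_coef_eq by exact Hf.
  assert (CG : Ck 1 (coreG alpha f)).
  { apply Ck_core. apply Ck_le with (2 := Hf). lia. }
  unfold partU. rewrite hat_deriv_vanish by exact Hf.
  assert (DW : D (partW alpha N f) 0
               = N * coefT alpha * coefG alpha * D (coreG alpha f) 0).
  { unfold partW. apply D_unique; [lra|]. apply is_D_scal.
    apply Ck_is_D with 0%nat; auto. lra. }
  rewrite DW. clear DW. unfold partW.
  assert (T := tilde_deriv_vanish alpha f Hf).
  assert (E1 : D f 0 = taylor 1 f) by (unfold taylor; simpl; field).
  rewrite E1. unfold slope_factor.
  apply Rminus_diag_uniq.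
  transitivity (N * N * coefT alpha *
    (- (INR alpha + 2) * coreE alpha f 0 + (INR alpha + 4) * coreF alpha f 0 +
      coefG alpha * (D (coreG alpha f) 0 + coreG alpha f 0))).
  - field. apply INR_fact_neq_0.
  - rewrite T. ring.
Qed.

Lemma sobolev_ip_int (alpha : nat) (M N : R) (f g : R -> R) :
  sobolev_ip alpha M N f g
  = / INR (fact alpha) * int (fun x => f x * g x * exp (- x) * x ^ alpha)
    + M * f 0 * g 0 + N * D f 0 * D g 0.
Proof. unfold sobolev_ip. now rewrite Gamma_fact. Qed.

(** Both terms on the right are symmetric in [f] and [g]. *)
Lemma sobolev_ip_L (alpha : nat) (M N : R) (f g : R -> R) :
  Ck (4 * alpha + 10) f -> Ck (4 * alpha + 10) g ->
  products_integrable (4 * alpha + 10) f g ->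
  sobolev_ip alpha M N (L_sobolev alpha M N f) g
  = / INR (fact alpha) * sum_energy f g alpha M N
    + slope_factor alpha M N * D f 0 * D g 0.
Proof.
  intros Hf Hg HI. rewrite sobolev_ip_int.
  rewrite (is_int_unique _ _ (is_int_L alpha M N f g Hf Hg HI)).
  pose proof (value_terms_cancel alpha M N f Hf) as B0.
  pose proof (slope_terms_sum alpha M N f Hf) as B1.
  rewrite <- B1.
  apply Rminus_diag_uniq.
  match type of B0 with ?u = _ => transitivity (u * g 0); [|rewrite B0] end; ring.
Qed.

Lemma sobolev_ip_comm (alpha : nat) (M N : R) (f g : R -> R) :
  sobolev_ip alpha M N f g = sobolev_ip alpha M N g f.
Proof.
  rewrite !sobolev_ip_int.
  replace (fun x => f x * g x * exp (- x) * x ^ alpha)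
    with (fun x => g x * f x * exp (- x) * x ^ alpha); [ring|].
  apply FunctionalExtensionality.functional_extensionality. intros; ring.
Qed.

Lemma products_integrable_comm (k : nat) (f g : R -> R) :
  products_integrable k f g -> products_integrable k g f.
Proof.
  rewrite !products_integrable_ex_int. intros H i j p Hi Hj.
  apply (ex_int_ext (fun x => x ^ p * Dn j f x * Dn i g x * exp (- x))).
  - intros; ring.
  - now apply H.
Qed.

Lemma L_sobolev_symmetric (alpha : nat) (M N : R) (f g : R -> R) :
  Ck (4 * alpha + 10) f -> Ck (4 * alpha + 10) g ->
  products_integrable (4 * alpha + 10) f g ->
  sobolev_ip alpha M N (L_sobolev alpha M N f) g
  = sobolev_ip alpha M N f (L_sobolev alpha M N g).
Proof.
  intros Hf Hg HI.
  rewrite (sobolev_ip_comm _ _ _ f), !sobolev_ip_L;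
    auto using products_integrable_comm.
  rewrite sum_energy_sym. ring.
Qed.

(** * Polynomials on the half-line and leading terms *)

(** Functions that agree on the half-line with a polynomial of degree less than
    [n]; the zero polynomial is the only one for [n = 0]. *)
Inductive poly_lt : nat -> (R -> R) -> Prop :=
| poly_lt_0 f : (forall x, 0 <= x -> f x = 0) -> poly_lt 0 f
| poly_lt_S n c f g :
    poly_lt n f -> (forall x, 0 <= x -> g x = f x + c * x ^ n) -> poly_lt (S n) g.

Lemma poly_lt_ext (n : nat) (f g : R -> R) :
  (forall x, 0 <= x -> f x = g x) -> poly_lt n f -> poly_lt n g.
Proof.
  intros E H. destruct H as [f Hf | n c f0 f Hf0 Hf].
  - apply poly_lt_0. intros x Hx. rewrite <- E; auto.
  - apply poly_lt_S with c f0; auto. intros x Hx. rewrite <- E; auto.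
Qed.

Lemma poly_lt_plus (n : nat) (f g : R -> R) :
  poly_lt n f -> poly_lt n g -> poly_lt n (fun x => f x + g x).
Proof.
  intros Hf. revert g. induction Hf as [f Hf | n c f0 f Hf0 IH Hf]; intros g Hg;
    inversion Hg as [g' Hg' | n' c' g0 g' Hg0 Hg']; subst.
  - apply poly_lt_0. intros x Hx. rewrite Hf, Hg'; auto. ring.
  - apply poly_lt_S with (c + c') (fun x => f0 x + g0 x); auto.
    intros x Hx. rewrite Hf, Hg'; auto. ring.
Qed.

Lemma poly_lt_scal (n : nat) (c : R) (f : R -> R) :
  poly_lt n f -> poly_lt n (fun x => c * f x).
Proof.
  induction 1 as [f Hf | n b f0 f Hf0 IH Hf].
  - apply poly_lt_0. intros x Hx. rewrite Hf; auto. ring.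
  - apply poly_lt_S with (c * b) (fun x => c * f0 x); auto.
    intros x Hx. rewrite Hf; auto. ring.
Qed.

Lemma poly_lt_succ (n : nat) (f : R -> R) : poly_lt n f -> poly_lt (S n) f.
Proof. intros H. apply poly_lt_S with 0 f; auto. intros; ring. Qed.

Lemma poly_lt_le (m n : nat) (f : R -> R) : (m <= n)%nat -> poly_lt m f -> poly_lt n f.
Proof. induction 1; auto using poly_lt_succ. Qed.

Lemma poly_lt_zero (n : nat) (f : R -> R) :
  (forall x, 0 <= x -> f x = 0) -> poly_lt n f.
Proof. intros H. apply poly_lt_le with 0%nat; [lia | now apply poly_lt_0]. Qed.

Lemma poly_lt_pow (n : nat) : poly_lt (S n) (fun x => x ^ n).
Proof.
  apply poly_lt_S with 1 (fun _ => 0); [now apply poly_lt_zero | intros; ring].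
Qed.

Lemma poly_lt_mulx (n : nat) (f : R -> R) : poly_lt n f -> poly_lt (S n) (fun x => x * f x).
Proof.
  induction 1 as [f Hf | n c f0 f Hf0 IH Hf].
  - apply poly_lt_zero. intros x Hx. rewrite Hf; auto. ring.
  - apply poly_lt_S with c (fun x => x * f0 x); auto.
    intros x Hx. rewrite Hf; auto. simpl. ring.
Qed.

Lemma poly_lt_mulpow (n p : nat) (f : R -> R) :
  poly_lt n f -> poly_lt (p + n) (fun x => x ^ p * f x).
Proof.
  intros H. induction p as [|p IH].
  - apply poly_lt_ext with f; auto. intros; simpl; ring.
  - apply poly_lt_ext with (fun x => x * (x ^ p * f x)); [intros; simpl; ring|].
    now apply poly_lt_mulx.
Qed.

Lemma poly_lt_Ck (k n : nat) (f : R -> R) : poly_lt n f -> Ck k f.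
Proof.
  induction 1 as [f Hf | n c f0 f Hf0 IH Hf].
  - apply Ck_ext with (fun _ => 0); [intros; symmetry; auto | apply Ck_const].
  - apply Ck_ext with (fun x => f0 x + c * x ^ n); [intros; symmetry; auto|].
    apply Ck_plus; auto. apply Ck_scal, Ck_pow.
Qed.

Lemma D_pow (n : nat) (x : R) : 0 <= x -> D (fun t => t ^ n) x = INR n * x ^ pred n.
Proof.
  intros Hx. apply D_unique; auto. apply is_derive_is_D. auto_derive; auto; ring.
Qed.

Lemma poly_lt_D (n : nat) (f : R -> R) : poly_lt (S n) f -> poly_lt n (D f).
Proof.
  intros H. remember (S n) as m eqn:Em. revert n Em.
  induction H as [f Hf | m c f0 f Hf0 IH Hf]; intros n Em; [discriminate|].
  injection Em as ->.
  assert (C0 := poly_lt_Ck 1 _ _ Hf0).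
  apply poly_lt_ext with (fun x => D f0 x + c * (INR n * x ^ pred n)).
  - intros x Hx. symmetry. rewrite (D_ext f (fun t => f0 t + c * t ^ n)); auto.
    apply D_unique; auto. rewrite <- D_pow by assumption.
    apply is_D_plus; [|apply is_D_scal]; apply Ck_is_D with 0%nat; auto using Ck_pow.
  - destruct n as [|n].
    + apply poly_lt_0. intros x Hx. inversion Hf0 as [h Hh|]; subst.
      rewrite (D_ext f0 (fun _ => 0)) by auto.
      rewrite (D_unique _ _ _ Hx (is_D_const 0 x)). simpl. ring.
    + apply poly_lt_plus; [apply poly_lt_succ, IH; reflexivity|].
      apply poly_lt_scal, poly_lt_scal, poly_lt_pow.
Qed.

Lemma poly_lt_D_le (n : nat) (f : R -> R) : poly_lt n f -> poly_lt n (D f).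
Proof. intros H. apply poly_lt_D, poly_lt_succ, H. Qed.

Lemma poly_lt_Dn (n i : nat) (f : R -> R) : poly_lt n f -> poly_lt n (Dn i f).
Proof. intros H. induction i as [|i IH]; simpl; auto using poly_lt_D_le. Qed.

Lemma poly_lt_mult (m n : nat) (f g : R -> R) :
  poly_lt m f -> poly_lt n g -> poly_lt (m + n) (fun x => f x * g x).
Proof.
  intros Hf Hg. induction Hf as [f Hf | m c f0 f Hf0 IH Hf].
  - apply poly_lt_zero. intros x Hx. rewrite Hf; auto. ring.
  - apply poly_lt_ext with (fun x => f0 x * g x + c * (x ^ m * g x)).
    + intros x Hx. rewrite Hf; auto. ring.
    + apply poly_lt_plus; [apply poly_lt_succ, IH|].
      apply poly_lt_succ, poly_lt_scal, poly_lt_mulpow, Hg.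
Qed.

Lemma poly_lt_ex_int (n : nat) (f : R -> R) :
  poly_lt n f -> ex_int (fun x => f x * exp (- x)).
Proof.
  induction 1 as [f Hf | n c f0 f Hf0 IH Hf].
  - apply ex_int_ext with (fun x => 0 * (x ^ 0 * exp (- x))).
    + intros x Hx. rewrite Hf; auto. ring.
    + apply ex_int_scal. eexists; apply exp_moment.
  - apply ex_int_ext with (fun x => f0 x * exp (- x) + c * (x ^ n * exp (- x))).
    + intros x Hx. rewrite Hf; auto. ring.
    + apply ex_int_plus; auto. apply ex_int_scal. eexists; apply exp_moment.
Qed.

Lemma poly_lt_products (k m n : nat) (f g : R -> R) :
  poly_lt m f -> poly_lt n g -> products_integrable k f g.
Proof.
  intros Hf Hg. apply products_integrable_ex_int. intros i j p _ _.
  apply (poly_lt_ex_int (p + m + n) (fun x => x ^ p * Dn i f x * Dn j g x)).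
  apply poly_lt_mult; [apply poly_lt_mulpow|]; now apply poly_lt_Dn.
Qed.

(** [c] is the coefficient of degree [n], possibly 0. *)
Definition lead (n : nat) (c : R) (f : R -> R) : Prop :=
  poly_lt n (fun x => f x - c * x ^ n).

Lemma lead_poly_lt (n : nat) (c : R) (f : R -> R) : lead n c f -> poly_lt (S n) f.
Proof. intros H. apply poly_lt_S with (1 := H) (c := c). intros; ring. Qed.

Lemma poly_lt_lead (n : nat) (f : R -> R) : poly_lt n f -> lead n 0 f.
Proof. intros H. apply poly_lt_ext with (2 := H). intros; ring. Qed.

Lemma lead_ext (n : nat) (c : R) (f g : R -> R) :
  (forall x, 0 <= x -> f x = g x) -> lead n c f -> lead n c g.
Proof.
  intros E H. apply poly_lt_ext with (2 := H). intros x Hx. now rewrite E.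
Qed.

Lemma lead_pow (n : nat) : lead n 1 (fun x => x ^ n).
Proof. apply poly_lt_zero. intros; ring. Qed.

Lemma lead_plus (n : nat) (a b : R) (f g : R -> R) :
  lead n a f -> lead n b g -> lead n (a + b) (fun x => f x + g x).
Proof.
  intros Hf Hg. apply poly_lt_ext with (2 := poly_lt_plus _ _ _ Hf Hg).
  intros; simpl; ring.
Qed.

Lemma lead_scal (n : nat) (a c : R) (f : R -> R) :
  lead n a f -> lead n (c * a) (fun x => c * f x).
Proof.
  intros Hf. apply poly_lt_ext with (2 := poly_lt_scal _ c _ Hf).
  intros; simpl; ring.
Qed.

Lemma lead_mulpow (n p : nat) (a : R) (f : R -> R) :
  lead n a f -> lead (p + n) a (fun x => x ^ p * f x).
Proof.
  intros Hf. apply poly_lt_ext with (2 := poly_lt_mulpow _ p _ Hf).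
  intros; simpl. rewrite pow_add. ring.
Qed.

Lemma lead_sum (n k : nat) (a : nat -> R) (f : nat -> R -> R) :
  (forall j, (j <= k)%nat -> lead n (a j) (f j)) ->
  lead n (sum_f_R0 a k) (fun x => sum_f_R0 (fun j => f j x) k).
Proof.
  induction k as [|k IH]; intros H; simpl; [auto|].
  apply lead_plus; auto.
Qed.

(** [D - 1] preserves the degree and changes the sign of the leading term. *)
Lemma lead_twist (m n : nat) (c : R) (u : R -> R) :
  lead n c u -> lead n ((-1) ^ m * c) (fun x => exp x * Dn m (damp u) x).
Proof.
  revert c u. induction m as [|m IH]; intros c u Hu.
  - apply lead_ext with u.
    + intros x _. simpl. unfold damp. rewrite <- Rmult_assoc, <- exp_plus.
      rewrite Rplus_opp_r, exp_0. ring.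
    + simpl. rewrite Rmult_1_l. exact Hu.
  - assert (Pu := lead_poly_lt _ _ _ Hu).
    assert (HD : lead n (-1 * c) (fun x => D u x + (-1) * u x)).
    { replace (-1 * c) with (0 + -1 * c) by ring.
      apply lead_plus; [|now apply lead_scal].
      apply poly_lt_lead, poly_lt_D, Pu. }
    apply lead_ext with (fun x => exp x * Dn m (damp (fun x => D u x + (-1) * u x)) x).
    + intros x Hx. f_equal. unfold damp at 2.
      rewrite Dn_exp by (eauto using poly_lt_Ck).
      assert (C1 := poly_lt_Ck m _ _ (poly_lt_D _ _ Pu)).
      assert (C0 := poly_lt_Ck m _ _ Pu).
      rewrite (Dn_ext m _ (fun t => damp (D u) t + (-1) * damp u t));
        [| intros; unfold damp; ring | assumption].
      rewrite Dn_plus, Dn_scal; auto using Ck_damp, Ck_scal. unfold damp. ring.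
    + replace ((-1) ^ S m * c) with ((-1) ^ m * (-1 * c)) by (simpl; ring).
      now apply IH.
Qed.

Lemma poch_front (a : R) (n : nat) : poch a (S n) = a * poch (a + 1) n.
Proof.
  induction n as [|n IH]; [simpl; ring|].
  change (poch a (S n) * (a + INR (S n)) = a * (poch (a + 1) n * (a + 1 + INR n))).
  rewrite IH, S_INR. ring.
Qed.

Lemma poch_zero (k n : nat) : (k < n)%nat -> poch (- INR k) n = 0.
Proof.
  induction 1 as [|n H IH]; simpl; [ring | rewrite IH; ring].
Qed.

(** For [m > n] the truncated exponent is harmless, since the shifted factorial
    then has a factor 0. *)
Lemma Dn_pow (m n : nat) (x : R) :
  0 <= x -> Dn m (fun t => t ^ n) x = poch (INR n - INR m + 1) m * x ^ (n - m).
Proof.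
  revert x. induction m as [|m IH]; intros x Hx.
  - simpl. rewrite Nat.sub_0_r. ring.
  - simpl Dn.
    rewrite (D_ext _ (fun t => poch (INR n - INR m + 1) m * t ^ (n - m))) by auto.
    rewrite (D_unique _ _ (poch (INR n - INR m + 1) m *
               (INR (n - m) * x ^ pred (n - m)))); auto.
    2:{ apply is_D_scal. rewrite <- D_pow by assumption.
        apply Ck_is_D with 0%nat; auto using Ck_pow. }
    replace (INR n - INR (S m) + 1) with (INR n - INR m) by (rewrite S_INR; ring).
    rewrite poch_front.
    destruct (Nat.le_gt_cases m n) as [H|H].
    + rewrite minus_INR by assumption.
      replace (pred (n - m)) with (n - S m)%nat by lia. ring.
    + replace (n - m)%nat with 0%nat by lia.
      replace (INR n - INR m + 1) with (- INR (m - S n))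
        by (rewrite minus_INR, S_INR by lia; ring).
      rewrite poch_zero by lia. simpl. ring.
Qed.

(** The degree first drops by [d], by the inner differentiation, and is then raised
    by the weight. *)
Lemma core_pow (m a d p n : nat) (c1 c0 x : R) :
  m = (a + d)%nat -> 0 <= x ->
  exp x * core m a p c1 c0 (fun t => t ^ n) x
  = exp x * Dn m (damp (fun t => poch (INR n - INR d + 1) m *
       (t ^ p * (c1 * (t * t ^ (n - d)) + c0 * t ^ (n - d))))) x.
Proof.
  intros -> Hx. f_equal. apply Dn_ext; auto. intros y Hy. unfold weighted, damp.
  f_equal.
  rewrite (Dn_ext _ (fun s => s ^ a * s ^ n) (fun s => s ^ (a + n)));
    [| intros; now rewrite pow_add | assumption].
  rewrite Dn_pow by assumption.
  replace (a + n - (a + d))%nat with (n - d)%nat by lia.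
  rewrite !plus_INR.
  replace (INR a + INR n - (INR a + INR d) + 1) with (INR n - INR d + 1) by ring.
  ring.
Qed.

(** When the differentiation kills the power, the coefficient predicted by the
    general formula is 0 as well. *)
Lemma core_pow_lt (m a d p n : nat) (c1 c0 x : R) :
  m = (a + d)%nat -> (n < d)%nat -> 0 <= x ->
  poch (INR n - INR d + 1) m = 0 /\
  exp x * core m a p c1 c0 (fun t => t ^ n) x = 0.
Proof.
  intros Em Hn Hx.
  assert (P : poch (INR n - INR d + 1) m = 0).
  { replace (INR n - INR d + 1) with (- INR (d - S n))
      by (rewrite minus_INR, S_INR by lia; ring).
    apply poch_zero. lia. }
  split; [exact P|]. rewrite (core_pow _ _ _ _ _ _ _ _ Em Hx), P.
  rewrite (Dn_ext _ _ (fun t => 0 * exp (- t)));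
    [|intros; unfold damp; ring | assumption].
  rewrite Dn_scal by auto using Ck_exp. ring.
Qed.

Lemma core_pow_lead (m a p n : nat) (c1 c0 : R) :
  m = (a + (p + 2))%nat -> (p + 2 <= n)%nat ->
  lead (pred n) ((-1) ^ m * (poch (INR n - INR (p + 2) + 1) m * c1))
    (fun x => exp x * core m a p c1 c0 (fun t => t ^ n) x).
Proof.
  intros Em Hn.
  apply lead_ext with (fun x => exp x * Dn m (damp (fun t =>
       poch (INR n - INR (p + 2) + 1) m *
       (t ^ p * (c1 * (t * t ^ (n - (p + 2))) + c0 * t ^ (n - (p + 2)))))) x).
  { intros x Hx. symmetry. apply core_pow; assumption. }
  apply lead_twist. apply lead_scal.
  replace (pred n) with (p + S (n - (p + 2)))%nat by lia.
  apply lead_mulpow. 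
  replace c1 with (c1 * 1 + 0) at 1 by ring.
  apply lead_plus.
  - apply lead_scal. apply (lead_pow (S (n - (p + 2)))).
  - apply poly_lt_lead, poly_lt_scal, poly_lt_pow.
Qed.

Lemma core_lead (m a p n : nat) (c1 c0 : R) :
  m = (a + (p + 2))%nat ->
  lead n ((-1) ^ m * (poch (INR n - INR (p + 2) + 1) m * c1))
    (fun x => x * (exp x * core m a p c1 c0 (fun t => t ^ n) x)).
Proof.
  intros Em. destruct (Nat.le_gt_cases (p + 2) n) as [Hn|Hn].
  - replace n with (1 + pred n)%nat at 1 by lia.
    apply lead_ext with (fun x => x ^ 1 *
      (exp x * core m a p c1 c0 (fun t => t ^ n) x)); [intros; ring|].
    now apply lead_mulpow, core_pow_lead.
  - destruct (core_pow_lt m a (p + 2) p n c1 c0 0 Em Hn (Rle_refl 0)) as [P _].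
    rewrite P. replace ((-1) ^ m * (0 * c1)) with 0 by ring.
    apply poly_lt_lead, poly_lt_zero. intros x Hx.
    rewrite (proj2 (core_pow_lt m a (p + 2) p n c1 c0 x Em Hn Hx)). ring.
Qed.

Lemma core_degree (m a p n : nat) (c1 c0 : R) :
  m = (a + (p + 2))%nat ->
  poly_lt n (fun x => exp x * core m a p c1 c0 (fun t => t ^ n) x).
Proof.
  intros Em. destruct (Nat.le_gt_cases (p + 2) n) as [Hn|Hn].
  - replace n with (S (pred n)) at 1 by lia.
    eapply lead_poly_lt. now apply core_pow_lead.
  - apply poly_lt_zero. intros x Hx.
    apply (core_pow_lt m a (p + 2) p n c1 c0 x Em Hn Hx).
Qed.

Lemma coreB_lead (alpha n : nat) :
  lead n ((-1) ^ (alpha + 2) * poch (INR n) (alpha + 2))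
    (fun x => x * (exp x * coreB alpha (fun t => t ^ n) x)).
Proof.
  assert (Em : (alpha + 2 = alpha + 1 + 1)%nat) by lia.
  unfold coreB. destruct n as [|n].
  - pose proof (poch_zero 0 (alpha + 2) ltac:(lia)) as P.
    change (INR 0) with 0 in *. rewrite Ropp_0 in P. rewrite P, Rmult_0_r.
    apply poly_lt_lead, poly_lt_zero. intros x Hx.
    rewrite (proj2 (core_pow_lt (alpha + 2) (alpha + 1) 1 0 0 0 1 x Em
               ltac:(lia) Hx)). ring.
  - apply lead_ext with (fun x => x ^ 1 * (exp x * Dn (alpha + 2) (damp (fun t =>
       poch (INR (S n)) (alpha + 2) * t ^ n)) x)).
    + intros x Hx. rewrite (core_pow _ _ _ _ _ _ _ _ Em Hx).
      rewrite pow_1. do 2 f_equal.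
      replace (INR (S n) - INR 1 + 1) with (INR (S n)) by (simpl (INR 1); ring).
      replace (S n - 1)%nat with n by lia.
      apply Dn_ext; auto. intros; unfold damp; simpl; ring.
    + replace (_ * poch (INR (S n)) (alpha + 2)) with
        ((-1) ^ (alpha + 2) * (poch (INR (S n)) (alpha + 2) * 1)) by ring.
      apply (lead_mulpow n 1). apply lead_twist, lead_scal, lead_pow.
Qed.

(** * The operator and the inner product on polynomials *)

Lemma core_lin (K m a p : nat) (c1 c0 c : R) (f g : R -> R) (x : R) :
  Ck K f -> Ck K g -> (m + m <= K)%nat -> 0 <= x ->
  core m a p c1 c0 (fun t => f t + c * g t) x
  = core m a p c1 c0 f x + c * core m a p c1 c0 g x.
Proof.
  intros Hf Hg Hm Hx.
  assert (W : forall h, Ck K h -> Ck m (weighted m a p c1 c0 h)).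
  { intros h Hh. apply Ck_damp, Ck_weight. apply Ck_le with K; auto. }
  assert (P : forall h, Ck K h -> Ck m (fun s => s ^ a * h s)).
  { intros h Hh. apply Ck_mult; [apply Ck_pow|]. apply Ck_le with K; auto. lia. }
  unfold core. rewrite <- (Dn_scal m c), <- Dn_plus; auto using Ck_scal.
  apply Dn_ext; auto. intros y Hy. unfold weighted, damp.
  rewrite (Dn_ext m (fun s => s ^ a * (f s + c * g s))
             (fun s => s ^ a * f s + c * (s ^ a * g s)));
    [| intros; ring | assumption].
  rewrite Dn_plus, Dn_scal; auto using Ck_scal. ring.
Qed.

Lemma core_ext_arg (m a p : nat) (c1 c0 : R) (f g : R -> R) (x : R) :
  (forall t, 0 <= t -> f t = g t) -> 0 <= x ->
  core m a p c1 c0 f x = core m a p c1 c0 g x.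
Proof.
  intros E Hx. apply Dn_ext; auto. intros y Hy. unfold weighted, damp.
  rewrite (Dn_ext m _ (fun s => s ^ a * g s)); auto.
  intros s Hs. now rewrite E.
Qed.

Lemma L_sobolev_ext (alpha : nat) (M N : R) (f g : R -> R) (x : R) :
  (forall t, 0 <= t -> f t = g t) -> 0 <= x ->
  L_sobolev alpha M N f x = L_sobolev alpha M N g x.
Proof.
  intros E Hx. rewrite !L_sobolev_parts by assumption.
  unfold L_classical, partU, partW, coreB, coreE, coreF, coreG, coreH.
  rewrite !(core_ext_arg _ _ _ _ _ f g), !(Dn_ext _ f g) by assumption.
  rewrite (sum_eq _ (fun j => coefH alpha j *
     core (alpha + 1 + (j + 2)) (alpha + 1) j 1 (q_coef alpha j) g x) (alpha + 2)).
  - reflexivity.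
  - intros j _. now rewrite (core_ext_arg _ _ _ _ _ f g).
Qed.

Lemma L_sobolev_lin (alpha : nat) (M N c : R) (f g : R -> R) (x : R) :
  Ck (4 * alpha + 10) f -> Ck (4 * alpha + 10) g -> 0 <= x ->
  L_sobolev alpha M N (fun t => f t + c * g t) x
  = L_sobolev alpha M N f x + c * L_sobolev alpha M N g x.
Proof.
  intros Hf Hg Hx. rewrite !L_sobolev_parts by assumption.
  unfold partU, partW, coreB, coreE, coreF, coreG, coreH.
  rewrite !(core_lin (4 * alpha + 10) _ _ _ _ _ c f g) by (auto; lia).
  rewrite (sum_eq _ (fun j =>
     coefH alpha j * core (alpha + 1 + (j + 2)) (alpha + 1) j 1 (q_coef alpha j) f x
     + coefH alpha j * core (alpha + 1 + (j + 2)) (alpha + 1) j 1 (q_coef alpha j) g x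
       * c) (alpha + 2)).
  2:{ intros j Hj. rewrite (core_lin (4 * alpha + 10)) by (auto; lia). ring. }
  rewrite plus_sum, <- scal_sum.
  assert (Ecl : L_classical alpha (fun t => f t + c * g t) x
                = L_classical alpha f x + c * L_classical alpha g x).
  { unfold L_classical.
    rewrite !(Dn_plus _ f (fun t => c * g t)), !(Dn_scal _ c g);
      try (ring || assumption);
      repeat apply Ck_scal;
      (apply Ck_le with (2 := Hf); lia) || (apply Ck_le with (2 := Hg); lia). }
  rewrite Ecl. ring.
Qed.

Lemma poly_lt_mulD (n : nat) (h : R -> R) : poly_lt n h -> poly_lt n (fun x => x * D h x).
Proof.
  destruct n as [|n]; intros H.
  - inversion H as [h' Hh|]; subst. apply poly_lt_0. intros x Hx.
    rewrite (D_ext h (fun _ => 0)) by auto.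
    rewrite (D_unique _ _ _ Hx (is_D_const 0 x)). ring.
  - apply poly_lt_mulx, poly_lt_D, H.
Qed.

Lemma L_classical_lead (alpha n : nat) :
  lead n (- INR n) (L_classical alpha (fun t => t ^ n)).
Proof.
  set (f := fun t : R => t ^ n).
  assert (P1 : poly_lt n (D f)) by apply poly_lt_D, poly_lt_pow.
  apply lead_ext with (fun x => (x * D (D f) x + (INR alpha + 1) * D f x)
                                + (-1) * (x * D f x)).
  { intros x _. unfold L_classical. simpl Dn. ring. }
  replace (- INR n) with (0 + (-1) * INR n) by ring.
  apply lead_plus.
  - apply poly_lt_lead, poly_lt_plus; [now apply poly_lt_mulD | now apply poly_lt_scal].
  - apply lead_scal. apply poly_lt_zero. intros x Hx. unfold f.
    rewrite D_pow by assumption. destruct n; simpl; ring.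
Qed.

Lemma sum_truncate (u : nat -> R) (m n : nat) :
  (m <= n)%nat -> (forall j, (m < j <= n)%nat -> u j = 0) ->
  sum_f_R0 u n = sum_f_R0 u m.
Proof.
  induction 1 as [|n Hm IH]; intros Z; [reflexivity|].
  rewrite tech5, IH, Z by (try lia; intros; apply Z; lia). ring.
Qed.

(** The bound [min (n - 2) (alpha + 2)] only cuts off summands that are 0. *)
Lemma lambda_C_full_sum (n alpha : nat) :
  lambda_C n alpha
  = / (INR alpha + 1) *
    sum_f_R0 (fun j => poch (INR alpha + 3 - INR j) (2 * j)
                  / (INR (fact j) * INR (fact (j + 1)))
                  * (poch (INR n - 1 - INR j) (j + alpha + 3)
                     / INR (fact (j + alpha + 3)))) (alpha + 2).
Proof.
  assert (Z : forall j, (n <= j + 1)%nat ->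
            poch (INR n - 1 - INR j) (j + alpha + 3) = 0).
  { intros j Hj. replace (INR n - 1 - INR j) with (- INR (j + 1 - n)).
    - apply poch_zero. lia.
    - rewrite minus_INR, plus_INR by lia. simpl (INR 1). ring. }
  assert (Z' : forall n', (n' <= 1)%nat -> n' = n -> 0 = / (INR alpha + 1) *
    sum_f_R0 (fun j => poch (INR alpha + 3 - INR j) (2 * j)
                  / (INR (fact j) * INR (fact (j + 1)))
                  * (poch (INR n - 1 - INR j) (j + alpha + 3)
                     / INR (fact (j + alpha + 3)))) (alpha + 2)).
  { intros n' Hn ->. rewrite sum_eq_R0; [ring|].
    intros j _. rewrite Z by lia. unfold Rdiv. ring. }
  destruct n as [|[|k]]; [apply (Z' 0%nat); lia | apply (Z' 1%nat); lia |].
  unfold lambda_C. f_equal. symmetry. apply sum_truncate; [lia|].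
  intros j Hj. rewrite Z by lia. unfold Rdiv. ring.
Qed.

(** The eigenvalues are read off from the leading coefficients, summand by
    summand; the piece G lowers the degree and does not contribute. *)
Lemma L_sobolev_pow_lead (alpha n : nat) (M N : R) :
  lead n (- lambda n alpha M N) (L_sobolev alpha M N (fun t => t ^ n)).
Proof.
  set (f := fun t : R => t ^ n).
  apply lead_ext with (fun x => L_classical alpha f x
    + (M * coefB alpha * (x * (exp x * coreB alpha f x))
    + (N * coefT alpha * (- (INR alpha + 2)) * (x * (exp x * coreE alpha f x))
    + (N * coefT alpha * (INR alpha + 4) * (x * (exp x * coreF alpha f x))
    + (M * N * sum_f_R0 (fun j => coefH alpha j * (x * (exp x * coreH alpha j f x)))
        (alpha + 2)
    + N * coefT alpha * coefG alpha * (exp x * coreG alpha f x)))))).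
  { intros x Hx. rewrite L_sobolev_parts by assumption. unfold partU, partW.
    rewrite (sum_eq _ (fun j => coefH alpha j * coreH alpha j f x * (x * exp x))
               (alpha + 2)) by (intros; ring).
    rewrite <- scal_sum. ring. }
  replace (- lambda n alpha M N) with
    (- INR n
     + (M * coefB alpha * ((-1) ^ (alpha + 2) * poch (INR n) (alpha + 2))
     + (N * coefT alpha * (- (INR alpha + 2)) *
         ((-1) ^ (alpha + 1 + (1 + 2)) *
          (poch (INR n - INR (1 + 2) + 1) (alpha + 1 + (1 + 2)) * 1))
     + (N * coefT alpha * (INR alpha + 4) *
         ((-1) ^ (alpha + 1 + (0 + 2)) *
          (poch (INR n - INR (0 + 2) + 1) (alpha + 1 + (0 + 2)) * 1))
     + (M * N * sum_f_R0 (fun j => coefH alpha j *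
         ((-1) ^ (alpha + 1 + (j + 2)) *
          (poch (INR n - INR (j + 2) + 1) (alpha + 1 + (j + 2)) * 1))) (alpha + 2)
     + N * coefT alpha * coefG alpha * 0))))).
  - repeat apply lead_plus; [apply L_classical_lead | ..]; apply lead_scal.
    + apply coreB_lead.
    + now apply core_lead.
    + now apply core_lead.
    + apply lead_sum with (f := fun j x => coefH alpha j * (x * (exp x * coreH alpha j f x))).
      intros j _. apply lead_scal. now apply core_lead.
    + apply poly_lt_lead. now apply core_degree.
  - unfold lambda. rewrite lambda_C_full_sum.
    rewrite (sum_eq (fun j => coefH alpha j * _)
      (fun j => poch (INR alpha + 3 - INR j) (2 * j)
                  / (INR (fact j) * INR (fact (j + 1)))
                  * (poch (INR n - 1 - INR j) (j + alpha + 3)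
                     / INR (fact (j + alpha + 3))) * (- / (INR alpha + 1)))).
    + rewrite <- scal_sum.
      generalize (sum_f_R0 (fun j => poch (INR alpha + 3 - INR j) (2 * j)
                  / (INR (fact j) * INR (fact (j + 1)))
                  * (poch (INR n - 1 - INR j) (j + alpha + 3)
                     / INR (fact (j + alpha + 3)))) (alpha + 2)). intros S.
      unfold lambda_A, lambda_B, coefB, coefT.
      replace (alpha + 1 + (1 + 2))%nat with (alpha + 4)%nat by lia.
      replace (alpha + 1 + (0 + 2))%nat with (alpha + 3)%nat by lia.
      replace (INR n - INR (1 + 2) + 1) with (INR n - 2) by (simpl; ring).
      replace (INR n - INR (0 + 2) + 1) with (INR n - 1) by (simpl; ring).
      generalize (poch (INR n) (alpha + 2)), (poch (INR n - 2) (alpha + 4)),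
        (poch (INR n - 1) (alpha + 3)). intros p1 p2 p3.
      norm_nat.
      destruct (sign_sqr alpha) as [-> | ->]; clear; atoms; field;
        repeat split; auto; lra.
    + intros j _. unfold coefH.
      replace (alpha + 1 + (j + 2))%nat with (j + alpha + 3)%nat by lia.
      replace (alpha + 3 + j)%nat with (j + alpha + 3)%nat by lia.
      replace (INR n - INR (j + 2) + 1) with (INR n - 1 - INR j)
        by (rewrite plus_INR; simpl; ring).
      generalize (poch (INR n - 1 - INR j) (j + alpha + 3)),
        (poch (INR alpha + 3 - INR j) (2 * j)). intros p1 p2.
      norm_nat.
      destruct (sign_sqr alpha) as [-> | ->], (sign_sqr j) as [-> | ->];
        clear; atoms; field; repeat split; auto; lra.
Qed.

Lemma L_sobolev_degree (alpha n : nat) (M N : R) (f : R -> R) :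
  poly_lt n f -> poly_lt n (L_sobolev alpha M N f).
Proof.
  induction 1 as [f Hf | n c f0 f Hf0 IH Hf].
  - assert (P0 : poly_lt 0 f) by now apply poly_lt_0.
    apply poly_lt_0. intros x Hx.
    rewrite (L_sobolev_ext _ _ _ f (fun t => f t + (-1) * f t)) by
      (auto; intros t Ht; rewrite Hf by assumption; ring).
    rewrite L_sobolev_lin by eauto using poly_lt_Ck. ring.
  - apply poly_lt_ext with (fun x => L_sobolev alpha M N f0 x
                        + c * L_sobolev alpha M N (fun t => t ^ n) x).
    + intros x Hx.
      rewrite (L_sobolev_ext _ _ _ f (fun t => f0 t + c * t ^ n)) by auto.
      rewrite L_sobolev_lin by eauto using poly_lt_Ck, Ck_pow. reflexivity.
    + apply poly_lt_plus; [now apply poly_lt_succ|]. apply poly_lt_scal.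
      eapply lead_poly_lt, L_sobolev_pow_lead.
Qed.

Lemma L_sobolev_reduces (alpha n : nat) (M N : R) (y : R -> R) :
  poly_lt (S n) y ->
  poly_lt n (fun x => L_sobolev alpha M N y x + lambda n alpha M N * y x).
Proof.
  intros H. inversion H as [|n' c f0 f Hf0 Hf]; subst.
  apply poly_lt_ext with (fun x =>
    (L_sobolev alpha M N f0 x + lambda n alpha M N * f0 x)
    + c * (L_sobolev alpha M N (fun t => t ^ n) x
           - (- lambda n alpha M N) * x ^ n)).
  - intros x Hx.
    rewrite (L_sobolev_ext _ _ _ y (fun t => f0 t + c * t ^ n)) by auto.
    rewrite L_sobolev_lin by eauto using poly_lt_Ck, Ck_pow.
    rewrite Hf by assumption. ring.
  - apply poly_lt_plus.
    + apply poly_lt_plus; [now apply L_sobolev_degree | now apply poly_lt_scal].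
    + apply poly_lt_scal, L_sobolev_pow_lead.
Qed.

Lemma poly_lt_ip_ex (alpha m n : nat) (f g : R -> R) :
  poly_lt m f -> poly_lt n g ->
  ex_int (fun x => f x * g x * exp (- x) * x ^ alpha).
Proof.
  intros Hf Hg.
  apply ex_int_ext with (fun x => (x ^ alpha * (f x * g x)) * exp (- x)).
  - intros; ring.
  - apply (poly_lt_ex_int (alpha + (m + n))).
    now apply poly_lt_mulpow, poly_lt_mult.
Qed.

Lemma sobolev_ip_ext_l (alpha m n : nat) (M N : R) (f f' g : R -> R) :
  (forall x, 0 <= x -> f x = f' x) -> poly_lt m f -> poly_lt n g ->
  sobolev_ip alpha M N f g = sobolev_ip alpha M N f' g.
Proof.
  intros E Hf Hg. rewrite !sobolev_ip_int.
  rewrite (int_ext _ (fun x => f' x * g x * exp (- x) * x ^ alpha)).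
  - rewrite (D_ext f f'), (E 0); auto; lra.
  - intros x Hx. now rewrite E.
  - now apply (poly_lt_ip_ex alpha m n).
Qed.

Lemma sobolev_ip_lin_l (alpha m n : nat) (M N c : R) (f f' g : R -> R) :
  poly_lt m f -> poly_lt m f' -> poly_lt n g ->
  sobolev_ip alpha M N (fun x => f x + c * f' x) g
  = sobolev_ip alpha M N f g + c * sobolev_ip alpha M N f' g.
Proof.
  intros Hf Hf' Hg. rewrite !sobolev_ip_int.
  assert (E1 := poly_lt_ip_ex alpha _ _ _ _ Hf Hg).
  assert (E2 := poly_lt_ip_ex alpha _ _ _ _ Hf' Hg).
  assert (ED : D (fun x => f x + c * f' x) 0 = D f 0 + c * D f' 0).
  { apply D_unique; [lra|]. apply is_D_plus; [|apply is_D_scal];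
      apply Ck_is_D with 0%nat; eauto using poly_lt_Ck, Rle_refl. }
  rewrite ED.
  rewrite (int_ext _ (fun x => f x * g x * exp (- x) * x ^ alpha
                     + c * (f' x * g x * exp (- x) * x ^ alpha))).
  - rewrite int_plus, int_scal by auto using ex_int_scal. ring.
  - intros; ring.
  - apply (poly_lt_ip_ex alpha m n); auto.
    apply poly_lt_plus; auto using poly_lt_scal.
Qed.

Lemma sobolev_ip_zero_l (alpha n : nat) (M N : R) (f g : R -> R) :
  (forall x, 0 <= x -> f x = 0) -> poly_lt n g -> sobolev_ip alpha M N f g = 0.
Proof.
  intros Hf Hg.
  assert (P : poly_lt 0 f) by now apply poly_lt_0.
  rewrite (sobolev_ip_ext_l alpha 0 n M N f (fun x => f x + (-1) * f x)); auto.
  - rewrite (sobolev_ip_lin_l alpha 0 n); auto. ring.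
  - intros x Hx. rewrite Hf by assumption. ring.
Qed.

Lemma sobolev_ip_low_degree (alpha n m : nat) (M N : R) (y q : R -> R) :
  poly_lt m y ->
  (forall k, (k < n)%nat -> sobolev_ip alpha M N (fun x => x ^ k) y = 0) ->
  poly_lt n q -> sobolev_ip alpha M N q y = 0.
Proof.
  intros Hy Z Hq. induction Hq as [f Hf | n c f0 f Hf0 IH Hf].
  - now apply sobolev_ip_zero_l with m.
  - rewrite (sobolev_ip_ext_l alpha (S n) m _ _ f (fun x => f0 x + c * x ^ n)); auto.
    + rewrite (sobolev_ip_lin_l alpha (S n) m); auto using poly_lt_succ, poly_lt_pow.
      rewrite IH, Z by auto. ring.
    + now apply poly_lt_S with c f0.
Qed.

(** The integrals up to [b] increase to the total integral. If that is 0 they are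
    all 0, and so is their derivative. *)
Lemma int_pos_zero (h : R -> R) :
  contH h -> (forall x, 0 <= x -> 0 <= h x) -> ex_int h ->
  0 <= int h /\ (int h <= 0 -> forall x, 0 < x -> h x = 0).
Proof.
  intros Ch Hp E.
  set (F := fun b => RInt (fun t => h (Rmax 0 t)) 0 b).
  assert (ER : forall a b, ex_RInt (fun t => h (Rmax 0 t)) a b).
  { intros. apply (ex_RInt_continuous (V := R_CompleteNormedModule)).
    intros; apply Ch. }
  assert (HF : forall b, 0 <= b -> is_RInt h 0 b (F b)).
  { intros b Hb. apply is_RInt_ext with (fun t => h (Rmax 0 t)).
    - rewrite Rmin_left by lra. intros x Hx. rewrite Rmax_right; lra.
    - apply (RInt_correct (V := R_CompleteNormedModule)), ER. }
  assert (Fmon : forall a b, 0 <= a -> a <= b -> F a <= F b).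
  { intros a b Ha Hab. unfold F.
    rewrite <- (RInt_Chasles (V := R_CompleteNormedModule) _ 0 a b) by apply ER.
    assert (0 <= RInt (fun t => h (Rmax 0 t)) a b).
    { apply RInt_ge_0; auto. intros; apply Hp, Rmax_l. }
    change (plus (RInt (fun t => h (Rmax 0 t)) 0 a)
                 (RInt (fun t => h (Rmax 0 t)) a b))
      with (RInt (fun t => h (Rmax 0 t)) 0 a + RInt (fun t => h (Rmax 0 t)) a b).
    lra. }
  assert (F0 : F 0 = 0) by apply (RInt_point (V := R_CompleteNormedModule)).
  assert (LF : is_lim F p_infty (int h)).
  { apply (is_int_lim h F); auto. now apply ex_int_is. }
  assert (Fle : forall b, 0 <= b -> F b <= int h).
  { intros b Hb.
    apply (is_lim_le_loc (fun _ => F b) F p_infty (F b) (int h)); auto.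
    - exists b. intros t Ht. apply Fmon; lra.
    - apply is_lim_const. }
  split; [rewrite <- F0; apply Fle; lra|].
  intros Hle x Hx.
  assert (Fz : forall b, 0 <= b -> F b = 0).
  { intros b Hb. apply Rle_antisym.
    - specialize (Fle b Hb). lra.
    - rewrite <- F0. apply Fmon; lra. }
  assert (DF : is_derive F x (h (Rmax 0 x))).
  { apply (is_derive_RInt (fun t => h (Rmax 0 t)) F 0).
    - exists (mkposreal 1 Rlt_0_1). intros y _.
      apply (RInt_correct (V := R_CompleteNormedModule)), ER.
    - apply Ch. }
  rewrite Rmax_right in DF by lra.
  apply is_derive_is_D in DF.
  rewrite <- (D_unique F x (h x)) by (lra || assumption).
  apply D_unique; [lra|].
  apply is_D_ext with (fun _ => 0); [intros; symmetry; auto | lra | apply is_D_const].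
Qed.

Lemma contH_zero (h : R -> R) :
  contH h -> (forall x, 0 < x -> h x = 0) -> forall x, 0 <= x -> h x = 0.
Proof.
  intros Ch Z x Hx. destruct (Rle_lt_or_eq_dec 0 x Hx) as [H|<-]; auto.
  apply cond_eq. intros eps He. rewrite Rminus_0_r.
  destruct (proj1 (filterlim_locally _ _) (Ch 0) (mkposreal eps He)) as [d Hd].
  pose proof (cond_pos d) as Hdp.
  assert (B : ball 0 d (d / 2)).
  { change (Rabs (d / 2 - 0) < d). rewrite Rminus_0_r, Rabs_pos_eq; lra. }
  specialize (Hd (d / 2) B). rewrite !Rmax_right in Hd by lra.
  rewrite (Z (d / 2)) in Hd by lra.
  change (Rabs (0 - h 0) < eps) in Hd.
  now rewrite Rminus_0_l, Rabs_Ropp in Hd.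
Qed.

Lemma sobolev_ip_definite (alpha n : nat) (M N : R) (p : R -> R) :
  0 <= M -> 0 <= N -> poly_lt n p -> sobolev_ip alpha M N p p = 0 ->
  forall x, 0 <= x -> p x = 0.
Proof.
  intros HM HN Hp Z. rewrite sobolev_ip_int in Z.
  assert (E := poly_lt_ip_ex alpha _ _ _ _ Hp Hp).
  assert (Cp : contH p) by (eapply (Ck_contH 0), poly_lt_Ck; exact Hp).
  destruct (int_pos_zero (fun x => p x * p x * exp (- x) * x ^ alpha)) as [Hpos Hz];
    auto.
  - repeat apply contH_mult; auto using contH_exp.
    apply (Ck_contH 0), Ck_pow.
  - intros x Hx. apply Rmult_le_pos; [|now apply pow_le].
    apply Rmult_le_pos; [apply Rle_0_sqr | apply Rlt_le, exp_pos].
  - apply contH_zero; auto. intros x Hx.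
    assert (I0 : int (fun x => p x * p x * exp (- x) * x ^ alpha) <= 0).
    { assert (0 <= M * p 0 * p 0).
      { rewrite Rmult_assoc. apply Rmult_le_pos; [auto | apply Rle_0_sqr]. }
      assert (0 <= N * D p 0 * D p 0).
      { rewrite Rmult_assoc. apply Rmult_le_pos; [auto | apply Rle_0_sqr]. }
      apply Rmult_le_reg_l with (/ INR (fact alpha)).
      - apply Rinv_0_lt_compat, INR_fact_lt_0.
      - lra. }
    specialize (Hz I0 x Hx).
    assert (P1 := exp_pos (- x)). assert (P2 := pow_lt x alpha Hx).
    apply Rmult_integral in Hz as [Hz|Hz]; [|lra].
    apply Rmult_integral in Hz as [Hz|Hz]; [|lra].
    apply Rmult_integral in Hz as [Hz|Hz]; auto.
Qed.

(** [p = L y + lambda y] has degree less than [n], and symmetry together with the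
    orthogonality of [y] to lower degrees gives [(p, p) = 0]. *)
Lemma eigen_of_orthogonal (alpha n : nat) (M N : R) (y : R -> R) :
  0 <= M -> 0 <= N -> poly_lt (S n) y ->
  (forall k, (k < n)%nat -> sobolev_ip alpha M N (fun x => x ^ k) y = 0) ->
  forall x, 0 <= x ->
  L_sobolev alpha M N y x = - lambda n alpha M N * y x.
Proof.
  intros HM HN Hy Z.
  set (lam := lambda n alpha M N).
  set (p := fun x => L_sobolev alpha M N y x + lam * y x).
  assert (Hp : poly_lt n p) by now apply L_sobolev_reduces.
  assert (Orth : forall q, poly_lt n q -> sobolev_ip alpha M N q y = 0).
  { intros q Hq. now apply sobolev_ip_low_degree with n (S n). }
  assert (Zp : sobolev_ip alpha M N p p = 0).
  { unfold p at 1.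
    rewrite (sobolev_ip_lin_l alpha (S n) n); auto using L_sobolev_degree.
    rewrite L_sobolev_symmetric; eauto using poly_lt_Ck, poly_lt_products.
    rewrite !(sobolev_ip_comm _ _ _ y), !Orth by auto using L_sobolev_degree.
    ring. }
  intros x Hx.
  pose proof (sobolev_ip_definite alpha n M N p HM HN Hp Zp x Hx) as Ep.
  unfold p in Ep. lra.
Qed.

(** * The Sobolev-Laguerre polynomials *)

(** The polynomial 1F1(-n; b; x). Contiguity in both parameters replaces sums over
    the coefficients by inductions on [n]. *)
Fixpoint kummer (n : nat) (b x : R) : R :=
  match n with
  | O => 1
  | S m => kummer m b x - x / b * kummer m (b + 1) x
  end.

Definition kummer_coef (n : nat) (b : R) (k : nat) : R :=
  poch (- INR n) k / (poch b k * INR (fact k)).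

Lemma poch_pos (b : R) (k : nat) : 0 < b -> 0 < poch b k.
Proof.
  intros Hb. induction k as [|k IH]; simpl; [lra|].
  apply Rmult_lt_0_compat; auto. pose proof (pos_INR k). lra.
Qed.

(** Pascal's rule, since [(-n)_k / k!] is a signed binomial coefficient. *)
Lemma kummer_coef_S (n : nat) (b : R) (k : nat) :
  0 < b ->
  kummer_coef (S n) b k
  = kummer_coef n b k - / b * PS_incr_1 (kummer_coef n (b + 1)) k.
Proof.
  intros Hb. destruct k as [|k].
  - unfold kummer_coef. simpl. change (@zero R_NormedModule) with 0. field. lra.
  - simpl PS_incr_1. unfold kummer_coef.
    rewrite (poch_front (- INR (S n))), (poch_front b).
    replace (- INR (S n) + 1) with (- INR n) by (rewrite S_INR; ring).
    cbn [poch]. rewrite fact_simpl, mult_INR, !S_INR.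
    pose proof (poch_pos (b + 1) k ltac:(lra)). pose proof (pos_INR k).
    field. repeat split; try apply INR_fact_neq_0; lra.
Qed.

Lemma kummer_pseries (n : nat) (b x : R) :
  0 < b -> is_pseries (kummer_coef n b) x (kummer n b x).
Proof.
  revert b. induction n as [|n IH]; intros b Hb.
  - apply (filterlim_ext (fun _ : nat => 1)); [|apply filterlim_const].
    intros k. induction k as [|k IHk].
    + rewrite sum_O. change (1 = 1 * kummer_coef 0 b 0).
      unfold kummer_coef. simpl. field.
    + rewrite sum_Sn, <- IHk.
      change (1 = 1 + pow_n (K := R_AbsRing) x (S k) * kummer_coef 0 b (S k)).
      unfold kummer_coef. pose proof (poch_zero 0 (S k) ltac:(lia)) as P.
      rewrite P. unfold Rdiv. ring.
  - apply is_pseries_ext with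
      (PS_minus (kummer_coef n b) (PS_scal (/ b) (PS_incr_1 (kummer_coef n (b + 1))))).
    { intros k. symmetry. now apply kummer_coef_S. }
    replace (kummer (S n) b x) with
      (minus (kummer n b x) (scal (/ b) (scal x (kummer n (b + 1) x)))).
    2:{ change (kummer n b x - / b * (x * kummer n (b + 1) x) = kummer (S n) b x).
        simpl. field. lra. }
    apply (is_pseries_minus (K := R_AbsRing) (V := R_NormedModule)); [now apply IH|].
    apply (is_pseries_scal (K := R_AbsRing) (V := R_NormedModule));
      [apply Rmult_comm|].
    apply (is_pseries_incr_1 (K := R_AbsRing) (V := R_NormedModule)).
    apply IH. lra.
Qed.

Lemma Laguerre_kummer (n : nat) (a x : R) :
  0 <= a ->
  Laguerre n a x = poch (a + 1) n / INR (fact n) * kummer n (a + 1) x.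
Proof.
  intros Ha. unfold Laguerre, hyp1F1. f_equal.
  apply (is_pseries_unique (kummer_coef n (a + 1))), kummer_pseries. lra.
Qed.

Lemma kummer_poly_lt (n : nat) (b : R) : poly_lt (S n) (kummer n b).
Proof.
  revert b. induction n as [|n IH]; intros b.
  - apply poly_lt_ext with (2 := poly_lt_pow 0). intros; reflexivity.
  - apply poly_lt_ext with (fun x => kummer n b x + (- / b) * (x * kummer n (b + 1) x)).
    + intros; simpl. unfold Rdiv. ring.
    + apply poly_lt_plus; [now apply poly_lt_succ|]. now apply poly_lt_scal, poly_lt_mulx.
Qed.

Lemma kummer_0 (n : nat) (b : R) : kummer n b 0 = 1.
Proof. induction n as [|n IH]; simpl; [reflexivity | rewrite IH; unfold Rdiv; ring]. Qed.

Lemma kummer_D_0 (n : nat) (b : R) : 0 < b -> is_D (kummer n b) 0 (- INR n / b).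
Proof.
  intros Hb. induction n as [|n IH].
  - replace (- INR 0 / b) with 0 by (simpl; field; lra). apply is_D_const.
  - replace (- INR (S n) / b) with (- INR n / b + (- / b) * 1)
      by (rewrite S_INR; field; lra).
    apply is_D_ext with (fun x => kummer n b x + (- / b) * (x * kummer n (b + 1) x)).
    + intros; simpl. unfold Rdiv. ring.
    + lra.
    + apply is_D_plus; [exact IH|]. apply is_D_scal.
      assert (Ck0 : Ck 0 (kummer n (b + 1))) by (eapply poly_lt_Ck, kummer_poly_lt).
      pose proof (is_D_mulx_0 _ (Ck_contH _ _ Ck0)) as H.
      rewrite kummer_0 in H. exact H.
Qed.

(** The Chu-Vandermonde sum; contiguity of [kummer] reduces its proof to a
    relation between two shifted factorials. *)
Lemma kummer_moment (n k : nat) (b : R) :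
  0 < b ->
  is_int (fun x => x ^ k * kummer n b x * exp (- x))
    (INR (fact k) * poch (b - INR k - 1) n / poch b n).
Proof.
  revert k b. induction n as [|n IH]; intros k b Hb.
  - replace (INR (fact k) * poch (b - INR k - 1) 0 / poch b 0)
      with (INR (fact k)) by (simpl; field).
    apply is_int_ext with (2 := exp_moment k). intros; simpl; ring.
  - replace (INR (fact k) * poch (b - INR k - 1) (S n) / poch b (S n)) with
      (INR (fact k) * poch (b - INR k - 1) n / poch b n
       + (- / b) * (INR (fact (S k)) * poch (b + 1 - INR (S k) - 1) n
                    / poch (b + 1) n)).
    + apply is_int_ext with (2 := is_int_plus _ _ _ _ (IH k b Hb)
        (is_int_scal (- / b) _ _ (IH (S k) (b + 1) ltac:(lra)))).
      intros; simpl. unfold Rdiv. ring.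
    + replace (b + 1 - INR (S k) - 1) with (b - INR k - 1)
        by (rewrite S_INR; ring).
      pose proof (poch_pos b n Hb) as Pb.
      pose proof (poch_pos (b + 1) n ltac:(lra)) as Pb1.
      assert (E : b * poch (b + 1) n = poch b n * (b + INR n)).
      { rewrite <- poch_front. reflexivity. }
      pose proof (pos_INR n).
      replace (poch (b + 1) n) with (poch b n * (b + INR n) / b)
        by (rewrite <- E; field; lra).
      rewrite fact_simpl, mult_INR, S_INR. cbn [poch]. field. lra.
Qed.

Lemma Laguerre_moment (n k : nat) (a : R) :
  0 <= a ->
  is_int (fun x => x ^ k * Laguerre n a x * exp (- x))
    (INR (fact k) * poch (a - INR k) n / INR (fact n)).
Proof.
  intros Ha.
  pose proof (poch_pos (a + 1) n ltac:(lra)).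
  replace (INR (fact k) * poch (a - INR k) n / INR (fact n)) with
    (poch (a + 1) n / INR (fact n) *
     (INR (fact k) * poch (a + 1 - INR k - 1) n / poch (a + 1) n)).
  - apply is_int_ext with (2 := is_int_scal (poch (a + 1) n / INR (fact n)) _ _
      (kummer_moment n k (a + 1) ltac:(lra))).
    intros x _. rewrite Laguerre_kummer by assumption. ring.
  - replace (a + 1 - INR k - 1) with (a - INR k) by ring.
    field. split; [apply INR_fact_neq_0 | lra].
Qed.

Lemma Laguerre_poly_lt (n : nat) (a : R) : 0 <= a -> poly_lt (S n) (Laguerre n a).
Proof.
  intros Ha. eapply poly_lt_ext; [|apply poly_lt_scal, (kummer_poly_lt n (a + 1))].
  intros x _. symmetry. now apply Laguerre_kummer.
Qed.

Lemma Laguerre_0 (n : nat) (a : R) :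
  0 <= a -> Laguerre n a 0 = poch (a + 1) n / INR (fact n).
Proof. intros Ha. rewrite Laguerre_kummer, kummer_0 by assumption. ring. Qed.

Lemma Laguerre_D_0 (n : nat) (a : R) :
  0 <= a ->
  is_D (Laguerre n a) 0 (poch (a + 1) n / INR (fact n) * (- INR n / (a + 1))).
Proof.
  intros Ha.
  apply is_D_ext with (fun x => poch (a + 1) n / INR (fact n) * kummer n (a + 1) x).
  - intros x _. symmetry. now apply Laguerre_kummer.
  - lra.
  - apply is_D_scal, kummer_D_0. lra.
Qed.

Definition laguerre_comb (n alpha : nat) (A B C x : R) : R :=
  A * Laguerre n (INR alpha) x
  + B * (x * Laguerre (n - 1) (INR alpha + 2) x)
  + C * (x ^ 2 * Laguerre (n - 2) (INR alpha + 4) x).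

Section Comb.

Variables (n alpha : nat) (M N A B C : R).
Hypothesis Hn : (2 <= n)%nat \/ n = 1%nat /\ C = 0.

Lemma comb_poly_lt : poly_lt (S n) (laguerre_comb n alpha A B C).
Proof.
  pose proof (pos_INR alpha).
  unfold laguerre_comb. apply poly_lt_plus; [apply poly_lt_plus|].
  - apply poly_lt_scal, Laguerre_poly_lt. lra.
  - apply poly_lt_scal. replace (S n) with (S (S (n - 1))) by lia.
    apply poly_lt_mulx, Laguerre_poly_lt. lra.
  - destruct Hn as [Hn2 | [_ ->]].
    + apply poly_lt_scal. replace (S n) with (2 + S (n - 2))%nat by lia.
      apply poly_lt_mulpow, Laguerre_poly_lt. lra.
    + apply poly_lt_zero. intros; ring.
Qed.

Lemma comb_moment (k : nat) :
  is_int (fun x => x ^ k * laguerre_comb n alpha A B C x * exp (- x) * x ^ alpha)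
   (A * (INR (fact (alpha + k)) * poch (- INR k) n / INR (fact n))
    + B * (INR (fact (alpha + k + 1)) * poch (1 - INR k) (n - 1) / INR (fact (n - 1)))
    + C * (INR (fact (alpha + k + 2)) * poch (2 - INR k) (n - 2) / INR (fact (n - 2)))).
Proof.
  pose proof (pos_INR alpha) as Ha.
  assert (M0 := Laguerre_moment n (alpha + k) (INR alpha) Ha).
  assert (M1 := Laguerre_moment (n - 1) (alpha + k + 1) (INR alpha + 2) ltac:(lra)).
  assert (M2 := Laguerre_moment (n - 2) (alpha + k + 2) (INR alpha + 4) ltac:(lra)).
  rewrite plus_INR in M0.
  rewrite (plus_INR (alpha + k)), (plus_INR alpha k) in M1, M2.
  simpl (INR 1) in M1. simpl (INR 2) in M2.
  replace (INR alpha - (INR alpha + INR k)) with (- INR k) in M0 by ring.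
  replace (INR alpha + 2 - (INR alpha + INR k + 1)) with (1 - INR k) in M1 by ring.
  replace (INR alpha + 4 - (INR alpha + INR k + (1 + 1))) with (2 - INR k) in M2 by ring.
  apply is_int_ext with (2 := is_int_plus _ _ _ _ (is_int_plus _ _ _ _
    (is_int_scal A _ _ M0) (is_int_scal B _ _ M1)) (is_int_scal C _ _ M2)).
  intros x _. unfold laguerre_comb. rewrite !pow_add. ring.
Qed.

Lemma comb_0 :
  laguerre_comb n alpha A B C 0 = A * (poch (INR alpha + 1) n / INR (fact n)).
Proof.
  unfold laguerre_comb. rewrite (Laguerre_0 n) by apply pos_INR. ring.
Qed.

Lemma comb_D_0 :
  D (laguerre_comb n alpha A B C) 0
  = A * (poch (INR alpha + 1) n / INR (fact n) * (- INR n / (INR alpha + 1)))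
    + B * (poch (INR alpha + 3) (n - 1) / INR (fact (n - 1))).
Proof.
  pose proof (pos_INR alpha) as Ha.
  apply D_unique; [lra|].
  replace (_ + B * _) with
    (A * (poch (INR alpha + 1) n / INR (fact n) * (- INR n / (INR alpha + 1)))
    + B * Laguerre (n - 1) (INR alpha + 2) 0
    + C * (0 * Laguerre (n - 2) (INR alpha + 4) 0)).
  2:{ rewrite (Laguerre_0 (n - 1)) by lra.
      replace (INR alpha + 2 + 1) with (INR alpha + 3) by ring. ring. }
  assert (CL : forall m a, 0 <= a -> contH (Laguerre m a)).
  { intros m a H. apply (Ck_contH 0). eapply poly_lt_Ck, Laguerre_poly_lt, H. }
  apply is_D_plus; [apply is_D_plus|]; apply is_D_scal.
  - now apply Laguerre_D_0.
  - apply is_D_mulx_0, CL. lra.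
  - apply is_D_ext with (fun x => x * (x * Laguerre (n - 2) (INR alpha + 4) x));
      [intros; ring | lra |].
    apply (is_D_mulx_0 (fun x => x * Laguerre (n - 2) (INR alpha + 4) x)).
    apply contH_mult; [apply contH_id | apply CL; lra].
Qed.

(** For [2 <= k < n] every moment contains a shifted factorial of a non-positive
    integer that vanishes. The two relations on [A], [B], [C] are the cases
    [k = 0] and [k = 1]. *)
Lemma comb_orthogonal_pow (k : nat) :
  (k < n)%nat ->
  A * (M * poch (INR alpha + 1) n / INR (fact n))
    + (INR alpha + 1) * B + (INR alpha + 1) * (INR alpha + 2) * (INR n - 1) * C = 0 ->
  ((2 <= n)%nat ->
   N * (A * (poch (INR alpha + 1) n / INR (fact n) * (- INR n / (INR alpha + 1)))
     + B * (poch (INR alpha + 3) (n - 1) / INR (fact (n - 1))))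
   + (INR alpha + 1) * (INR alpha + 2) * (INR alpha + 3) * C = 0) ->
  sobolev_ip alpha M N (fun x => x ^ k) (laguerre_comb n alpha A B C) = 0.
Proof.
  intros Hk H0 H1. rewrite sobolev_ip_int.
  rewrite (is_int_unique _ _ (comb_moment k)).
  rewrite comb_0, comb_D_0, D_pow by lra.
  rewrite poch_zero by exact Hk.
  destruct k as [|[|k]].
  - replace (1 - INR 0) with (INR 0 + 1) by (simpl; ring).
    pose proof (poch_fact 0 (n - 1)) as P1. simpl (0 + (n - 1))%nat in P1.
    change (INR (fact 0)) with 1 in P1. rewrite Rmult_1_r in P1. rewrite P1.
    assert (P2 : C * poch (2 - INR 0) (n - 2)
                 = C * ((INR n - 1) * INR (fact (n - 2)))).
    { destruct Hn as [Hn2|[_ ->]]; [|ring].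
      pose proof (poch_fact 1 (n - 2)) as P2.
      change (INR (fact 1)) with 1 in P2. rewrite Rmult_1_r in P2.
      replace (2 - INR 0) with (INR 1 + 1) by (simpl; ring). rewrite P2.
      replace (1 + (n - 2))%nat with (S (n - 2)) by lia.
      rewrite fact_simpl, mult_INR, S_INR, minus_INR by lia. simpl (INR 2). ring. }
    unfold Rdiv at 3.
    replace (C * (INR (fact (alpha + 0 + 2)) * poch (2 - INR 0) (n - 2)
                  * / INR (fact (n - 2))))
      with ((C * poch (2 - INR 0) (n - 2)) * INR (fact (alpha + 0 + 2))
                  * / INR (fact (n - 2))) by ring.
    rewrite P2.
    replace (alpha + 0 + 2)%nat with (S (S alpha)) by lia.
    replace (alpha + 0 + 1)%nat with (S alpha) by lia.
    rewrite !fact_simpl, !mult_INR, !S_INR. simpl pow. simpl (INR 0).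
    etransitivity; [|exact H0].
    pose proof (pos_INR alpha).
    field. repeat split; try apply INR_fact_neq_0; lra.
  - replace (1 - INR 1) with (- INR 0) by (simpl; ring).
    rewrite (poch_zero 0 (n - 1)) by lia.
    replace (2 - INR 1) with (INR 0 + 1) by (simpl; ring).
    pose proof (poch_fact 0 (n - 2)) as P1. simpl (0 + (n - 2))%nat in P1.
    change (INR (fact 0)) with 1 in P1. rewrite Rmult_1_r in P1. rewrite P1.
    replace (alpha + 1 + 2)%nat with (S (S (S alpha))) by lia.
    rewrite !fact_simpl, !mult_INR, !S_INR. simpl pow. simpl (INR 1).
    etransitivity; [|exact (H1 ltac:(lia))]. simpl (INR 0). pose proof (pos_INR alpha).
    field. repeat split; try apply INR_fact_neq_0; lra.
  - replace (1 - INR (S (S k))) with (- INR (S k)) by (rewrite (S_INR (S k)); ring).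
    replace (2 - INR (S (S k))) with (- INR k) by (rewrite !S_INR; ring).
    rewrite !poch_zero by lia. simpl pow. rewrite S_INR. unfold Rdiv. 
    ring.
Qed.

End Comb.

Definition weightU (n alpha : nat) : R :=
  poch (INR alpha + 3) (n - 2)
      / ((INR alpha + 1) * (INR alpha + 3) * INR (fact (n - 2))).

Definition weightV (n alpha : nat) : R :=
  / (INR alpha + 1)
      * (poch (INR alpha + 3) (n - 2) / INR (fact (n - 1)))
      * (poch (INR alpha + 4) (n - 2) / INR (fact n)).

Lemma SobolevLaguerre_comb_1 (alpha : nat) (M N x : R) :
  SobolevLaguerre 1 alpha M N x = laguerre_comb 1 alpha 1 (- M) 0 x.
Proof.
  unfold SobolevLaguerre, laguerre_comb, T_poly, U_poly, V_poly.
  simpl (1 - 1)%nat. simpl poch. simpl (fact 1). simpl (INR 1). field.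
Qed.

Lemma SobolevLaguerre_comb (n alpha : nat) (M N x : R) :
  (2 <= n)%nat ->
  SobolevLaguerre n alpha M N x
  = laguerre_comb n alpha
      (1 - N * weightU n alpha * (INR n + INR alpha + 1))
      (- M * (poch (INR alpha + 2) (n - 1) / INR (fact n))
       - N * weightU n alpha * (INR alpha + 2))
      (N * weightU n alpha / (INR n - 1) + M * N * weightV n alpha) x.
Proof.
  intros Hn. destruct n as [|[|k]]; try lia.
  unfold SobolevLaguerre, laguerre_comb, T_poly, U_poly, V_poly, weightU, weightV.
  simpl (S (S k) - 2)%nat. unfold Rdiv. ring.
Qed.

Lemma SobolevLaguerre_poly_lt (n alpha : nat) (M N : R) :
  poly_lt (S n) (SobolevLaguerre n alpha M N).
Proof.
  destruct n as [|[|k]].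
  - apply poly_lt_ext with (fun x => 1 * x ^ 0); [|apply poly_lt_scal, poly_lt_pow].
    intros x _. unfold SobolevLaguerre, T_poly, U_poly, V_poly.
    rewrite Laguerre_kummer by apply pos_INR. simpl. field.
  - eapply poly_lt_ext; [|apply (comb_poly_lt 1 alpha 1 (- M) 0); auto].
    intros. now rewrite SobolevLaguerre_comb_1.
  - eapply poly_lt_ext; [|apply comb_poly_lt; left; lia].
    intros. symmetry. apply SobolevLaguerre_comb. lia.
Qed.

(** The two relations of [comb_orthogonal_pow] are checked with all shifted
    factorials expressed by [alpha!] and [(alpha + n - 2)!]. *)
Lemma SobolevLaguerre_orthogonal_pow (n alpha k : nat) (M N : R) :
  (k < n)%nat ->
  sobolev_ip alpha M N (fun x => x ^ k) (SobolevLaguerre n alpha M N) = 0.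
Proof.
  intros Hk. pose proof (pos_INR alpha) as Ha.
  assert (Pk : poly_lt (S k) (fun x => x ^ k)) by apply poly_lt_pow.
  rewrite sobolev_ip_comm.
  rewrite (sobolev_ip_ext_l alpha (S n) (S k) M N _
    (if Nat.leb 2 n then laguerre_comb n alpha
      (1 - N * weightU n alpha * (INR n + INR alpha + 1))
      (- M * (poch (INR alpha + 2) (n - 1) / INR (fact n))
       - N * weightU n alpha * (INR alpha + 2))
      (N * weightU n alpha / (INR n - 1) + M * N * weightV n alpha)
     else laguerre_comb n alpha 1 (- M) 0)); auto using SobolevLaguerre_poly_lt.
  2:{ intros x _. destruct (Nat.leb_spec 2 n).
      - now apply SobolevLaguerre_comb.
      - replace n with 1%nat by lia. apply SobolevLaguerre_comb_1. }
  rewrite sobolev_ip_comm.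
  destruct (Nat.leb_spec 2 n) as [Hn|Hn].
  - destruct n as [|[|m]]; try lia.
    assert (Q1 := poch_fact alpha (S (S m))).
    assert (Q2 := poch_fact (alpha + 1) (S m)).
    assert (Q3 := poch_fact (alpha + 2) m).
    assert (Q4 := poch_fact (alpha + 3) m).
    assert (Q5 := poch_fact (alpha + 2) (S m)).
    rewrite !plus_INR in Q2, Q3, Q4, Q5.
    change (INR 1) with 1 in *. change (INR 2) with (1 + 1) in *.
    change (INR 3) with (1 + 1 + 1) in *.
    replace (INR alpha + 1 + 1) with (INR alpha + 2) in Q2 by ring.
    replace (INR alpha + (1 + 1) + 1) with (INR alpha + 3) in Q3, Q5 by ring.
    replace (INR alpha + (1 + 1 + 1) + 1) with (INR alpha + 4) in Q4 by ring.
    set (F := INR (fact alpha)).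
    set (G := INR (fact (alpha + m))).
    assert (HF : F <> 0) by apply INR_fact_neq_0.
    assert (Q1' : poch (INR alpha + 1) (S (S m))
       = (INR alpha + INR m + 2) * (INR alpha + INR m + 1) * G / F).
    { unfold F, G. apply Rmult_eq_reg_r with (INR (fact alpha)); [|exact HF].
      rewrite Q1. norm_nat. field. apply INR_fact_neq_0. }
    assert (Q2' : poch (INR alpha + 2) (S m)
       = (INR alpha + INR m + 2) * (INR alpha + INR m + 1) * G
         / ((INR alpha + 1) * F)).
    { unfold F, G. apply Rmult_eq_reg_r with (INR (fact (alpha + 1)));
        [|apply INR_fact_neq_0].
      rewrite Q2. norm_nat. field. split; [apply INR_fact_neq_0|lra]. }
    assert (Q3' : poch (INR alpha + 3) m
       = (INR alpha + INR m + 2) * (INR alpha + INR m + 1) * G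
         / ((INR alpha + 2) * (INR alpha + 1) * F)).
    { unfold F, G. apply Rmult_eq_reg_r with (INR (fact (alpha + 2)));
        [|apply INR_fact_neq_0].
      rewrite Q3. norm_nat. field. repeat split; try apply INR_fact_neq_0; lra. }
    assert (Q4' : poch (INR alpha + 4) m
       = (INR alpha + INR m + 3) * (INR alpha + INR m + 2) * (INR alpha + INR m + 1)
         * G / ((INR alpha + 3) * (INR alpha + 2) * (INR alpha + 1) * F)).
    { unfold F, G. apply Rmult_eq_reg_r with (INR (fact (alpha + 3)));
        [|apply INR_fact_neq_0].
      rewrite Q4. norm_nat. field. repeat split; try apply INR_fact_neq_0; lra. }
    assert (Q5' : poch (INR alpha + 3) (S m)
       = (INR alpha + INR m + 3) * (INR alpha + INR m + 2) * (INR alpha + INR m + 1)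
         * G / ((INR alpha + 2) * (INR alpha + 1) * F)).
    { unfold F, G. apply Rmult_eq_reg_r with (INR (fact (alpha + 2)));
        [|apply INR_fact_neq_0].
      rewrite Q5. norm_nat. field. repeat split; try apply INR_fact_neq_0; lra. }
    clear Q1 Q2 Q3 Q4 Q5. clearbody G F.
    pose proof (pos_INR m) as Hm. pose proof (INR_fact_neq_0 m) as Hfm.
    apply comb_orthogonal_pow; auto.
    + unfold weightU, weightV. replace (S (S m) - 2)%nat with m by lia.
      replace (S (S m) - 1)%nat with (S m) by lia.
      rewrite Q1', Q2', Q3', Q4'. norm_nat.
      field. repeat split; auto; lra.
    + intros _. unfold weightU, weightV. replace (S (S m) - 2)%nat with m by lia.
      replace (S (S m) - 1)%nat with (S m) by lia.
      rewrite Q1', Q2', Q3', Q4', Q5'. norm_nat.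
      field. repeat split; auto; lra.
  - replace n with 1%nat in * by lia.
    apply comb_orthogonal_pow; auto.
    + simpl. field.
    + lia.
Qed.

Theorem theorem3p1 (alpha : nat) (M N : R) (hM : 0 <= M) (hN : 0 < N) :
  (forall f g : R -> R,
     Ck (4 * alpha + 10) f -> Ck (4 * alpha + 10) g ->
     products_integrable (4 * alpha + 10) f g ->
     sobolev_ip alpha M N (L_sobolev alpha M N f) g
     = sobolev_ip alpha M N f (L_sobolev alpha M N g))
  /\
  ((forall (n : nat) (x : R), 0 <= x ->
      L_sobolev alpha M N (SobolevLaguerre n alpha M N) x
      = - lambda n alpha M N * SobolevLaguerre n alpha M N x)
   /\
   (forall n m : nat, n <> m ->
      sobolev_ip alpha M N (SobolevLaguerre n alpha M N)
        (SobolevLaguerre m alpha M N) = 0)).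
Proof.
  split; [|split].
  - apply L_sobolev_symmetric.
  - intros n. apply eigen_of_orthogonal; [lra | lra | apply SobolevLaguerre_poly_lt|].
    intros k Hk. now apply SobolevLaguerre_orthogonal_pow.
  - assert (W : forall n m, (m < n)%nat ->
      sobolev_ip alpha M N (SobolevLaguerre m alpha M N)
        (SobolevLaguerre n alpha M N) = 0).
    { intros n m Hm. apply sobolev_ip_low_degree with n (S n).
      - apply SobolevLaguerre_poly_lt.
      - intros k Hk. now apply SobolevLaguerre_orthogonal_pow.
      - apply poly_lt_le with (S m); [lia | apply SobolevLaguerre_poly_lt]. }
    intros n m Hnm. destruct (Nat.lt_ge_cases m n).
    + rewrite sobolev_ip_comm. now apply W.
    + apply W. lia.
Qed.
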